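(* Let $n$ be a positive integer, let $X$ be a hyperbolic Riemann surface, let $\boldsymbol q=(q_1,\dots,q_{n-1},q_n)\in\bigoplus_{i=1}^{n-1}H^0(X,K_X^{2i})\oplus H^0(X,K_X^n)$, and let $h$ be a harmonic metric of $(\mathbb K_{\mathrm{SO}_0(n,n)},\theta(\boldsymbol q))$ which is compatible with the $\mathrm{SO}_0(n,n)$-structure. Let $\rho$ be the holonomy representation of the flat connection $\mathbb D_h=\nabla_h+\theta(\boldsymbol q)+\theta(\boldsymbol q)^{*h}$ and $f$ the $\rho$-equivariant harmonic map from the universal cover of $X$ to $\mathrm{SO}_0(n,n)/\mathrm{SO}(n)\times\mathrm{SO}(n)$ determined by $h$. Let $\rho_0$ and $f_0$ be the holonomy representation and the $\rho_0$-equivariant harmonic map obtained in the same way from $(\mathbb K_{\mathrm{SO}_0(n,n)},\theta(\boldsymbol 0))$ with the metric $h_X$. If $h$ weakly dominates $h_X$, then $e(f)\ge e(f_0)$. Moreover, equality holds at a point if and only if $h=h_X$ and $\boldsymbol q=0$, i.e. $\rho=\rho_0$ and $f=f_0$.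
   Context: $X$ is a (connected) hyperbolic Riemann surface (universal cover the disc $\mathbb D$) with canonical bundle $K=K_X$; $g_X$ is its unique complete Kähler metric of Gauss curvature $-1$. **The Higgs bundle.** For $\boldsymbol q=(q_1,\dots,q_n)$ with $q_i\in H^0(X,K^{2i})$ ($1\le i\le n-1$), $q_n\in H^0(X,K^n)$, put $V=K^{n-1}\oplus K^{n-3}\oplus\dots\oplus K^{3-n}\oplus K^{1-n}$ ($n$ summands) and $W=K^{n-2}\oplus K^{n-4}\oplus\dots\oplus K^{4-n}\oplus K^{2-n}\oplus\mathcal O'$ ($n-1$ powers of $K$, none if $n=1$, followed by $\mathcal O'$), where $\mathcal O'$ is an extra copy of the trivial line bundle. $Q_V$ is the symmetric pairing on $V$ pairing $K^{j}$ with $K^{-j}$ naturally (anti-diagonal matrix of $1$'s); $Q_W$ pairs $K^j$ with $K^{-j}$ naturally on the first $n-1$ summands and is the standard pairing (equal to $1$) on $\mathcal O'$, which is orthogonal to the rest. Define $\eta(\boldsymbol q):W\to V\otimes K$ by the $n\times n$ matrix with entries (rows: summands of $V$, columns: summands of $W$, in the given order): for $1\le j\le n-1$, $\eta_{i,j}=q_{j-i+1}$ if $i\le j$, $\eta_{j+1,j}=1$, $\eta_{i,j}=0$ if $i>j+1$; $\eta_{1,n}=q_n$ and $\eta_{i,n}=0$ for $i\ge2$. Let $\eta^\dagger:V\to W\otimes K$ be the adjoint with respect to $Q_V,Q_W$. Then $\mathbb K_{\mathrm{SO}_0(n,n)}=V\oplus W$ and $\theta(\boldsymbol q)=\begin{pmatrix}0&\eta(\boldsymbol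 q)\\ \eta(\boldsymbol q)^\dagger&0\end{pmatrix}$. **Harmonic metric.** A Hermitian metric $h$ is harmonic for $(E,\theta)$ if $F(h)+[\theta,\theta^{*h}]=0$, with $F(h)$ the curvature of the Chern connection $\nabla_h$ and $\theta^{*h}$ the $h$-adjoint. **Compatibility.** A Hermitian metric $h$ on a complex vector space $U$ is compatible with a non-degenerate symmetric pairing $C$ if $\Phi_C:U\to U^*$, $u\mapsto C(u,\cdot)$, is an isometry from $h$ to the dual metric $h^*$ (in matrices: $H\,\overline{C^{-1}}\,H^{T}=C$). $h$ on $V\oplus W$ is compatible with the $\mathrm{SO}_0(n,n)$-structure if $h=h|_V\oplus h|_W$ and $h|_V$, $h|_W$ are compatible with $Q_V$, $Q_W$ on every fibre. **Filtration and weak domination.** Reorder the summands as $K^{n-1}\oplus K^{n-2}\oplus\dots\oplus K\oplus\mathcal O\oplus\mathcal O'\oplus K^{-1}\oplus\dots\oplus K^{1-n}$ (where $\mathcal O=K^0$) and let $F_k$ be the sum of the first $k$ summands, $1\le k\le 2n$. For Hermitian metrics $h,h_0$ on $\mathbb K_{\mathrm{SO}_0(n,n)}$, $h$ weakly dominates $h_0$ if $\det(h|_{F_k})\le\det(h_0|_{F_k})$ as metrics on $\det F_k$, for $1\le k\le 2n$. **The metric $h_X$.** Write $g_X=g(dx^2+dy^2)$ locally with $z=x+\sqrt{-1}y$, and denote also by $g_X$ the Hermitian metric on $K^{-1}$ with $|\partial_z|^2=g/2$. Then $h_X=\bigoplus_{k=1}^{2n-1}a_{k,n}\,g_X^{k-n}\oplus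 h_0$, where $a_{k,n}g_X^{k-n}$ is a metric on $K^{n-k}$, $h_0$ is the constant metric $1$ on $\mathcal O'$, and $a_{k,n}=\prod_{l=1}^{n-1}\left(\frac{l(2n-1-l)}{2}\right)^{-1}\prod_{l=1}^{k-1}\frac{l(2n-1-l)}{2}$. It is a harmonic metric of $(\mathbb K_{\mathrm{SO}_0(n,n)},\theta(\boldsymbol 0))$, compatible with the $\mathrm{SO}_0(n,n)$-structure. **Harmonic maps and energy.** A harmonic metric compatible with the $\mathrm{SO}_0(n,n)$-structure is equivalent to a $\rho$-equivariant harmonic map $f:\mathbb D\to\mathrm{SO}_0(n,n)/\mathrm{SO}(n)\times\mathrm{SO}(n)$. The target is regarded as a totally geodesic submanifold of $\mathrm{SO}(2n,\mathbb C)/\mathrm{SO}(2n,\mathbb R)$ with the Riemannian metric induced by the Killing form $B(X,Y)=(2n-2)\operatorname{tr}(XY)$; for $n=1$ the paper regards the target as just a point. The energy density of $f$ with respect to $g_X$ is $e(f)=(2n-2)|\theta(\boldsymbol q)|^2_{h,g_X}=(2n-2)\sqrt{-1}\Lambda_{g_X}\operatorname{tr}(\theta(\boldsymbol q)\wedge\theta(\boldsymbol q)^{*h})$, which descends to a function on $X$; here $\Lambda_{g_X}$ is contraction with the Kähler form $\omega=\frac{\sqrt{-1}}2 g\,dz\wedge d\bar z$.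
   Formalization: The equality characterization (the ''Moreover'' part) is stated only for n ≥ 2: for n = 1 the metric h is forced to be h_X and e(f) = e(f_0) = 0 for every holomorphic q_1, so equality does not imply q = 0; the inequality is stated for all n ≥ 1. *)

(* Defs.v *)
From HB Require Import structures.
From mathcomp Require Import all_boot all_order all_algebra.
From mathcomp Require Import all_classical all_reals all_analysis.
From mathcomp Require Import complex.
Set Implicit Arguments.
Unset Strict Implicit.
Unset Printing Implicit Defensive.
Import Order.TTheory GRing.Theory Num.Theory numFieldNormedType.Exports.
Local Open Scope classical_set_scope.
Local Open Scope ring_scope.

(* R[i]^o carries the norm topology of R[i]; derivable and derive1 on
   R[i]^o -> R[i]^o are complex differentiability and the complex derivative. *)
Notation Cplx R := (R[i])%C^o.

Section Calculus.
Variable R : realType.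
Local Notation C := (Cplx R).
Implicit Types (f : C -> C) (v z : C).

Definition disc : set C := [set z | `|z| < 1].

Definition re_along v f z : R -> R :=
  fun t => complex.Re (f (z + (t%:C)%C * v)).
Definition im_along v f z : R -> R :=
  fun t => complex.Im (f (z + (t%:C)%C * v)).

(* Real directional derivative: v = 1 gives d/dx and v = 'i gives d/dy. *)
Definition dirder v f z : C :=
  (derive1 (re_along v f z) 0 +i* derive1 (im_along v f z) 0)%C.

Definition dirderivable v f z : Prop :=
  derivable (re_along v f z) 0 1 /\ derivable (im_along v f z) 0 1.

Definition d_z f z : C := (dirder 1 f z - 'i%C * dirder 'i%C f z) / 2.
Definition d_zbar f z : C := (dirder 1 f z + 'i%C * dirder 'i%C f z) / 2.

Fixpoint Ck (k : nat) (f : C -> C) : Prop :=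
  (forall z, disc z -> {for z, continuous f}) /\
  if k is k'.+1 then
    [/\ forall z, disc z -> dirderivable 1 f z /\ dirderivable 'i%C f z,
        Ck k' (dirder 1 f) & Ck k' (dirder 'i%C f)]
  else True.

Definition smooth f : Prop := forall k, Ck k f.

Definition holomorphic f : Prop := forall z, disc z -> derivable f z 1.

Definition disc_automorphism (g : C -> C) : Prop :=
  set_bij disc disc g /\ holomorphic g.

End Calculus.

(* A Riemann surface X with universal covering proj : disc -> X.  The charts of
   X are the local inverses of proj, and the last field says that two of them
   differ by a holomorphic automorphism of the disc, so that X is the quotient
   of the disc by its deck group.  The values of proj outside the disc are
   irrelevant. *)
Record hyperbolic_surface (R : realType) := HyperbolicSurface {
  carrier : topologicalType;
  proj : Cplx R -> carrier;
  carrier_hausdorff : hausdorff_space carrier;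
  proj_surj : proj @` @disc R = setT;
  proj_continuous : forall z, disc z -> {for z, continuous proj};
  proj_open : forall U, open U -> U `<=` @disc R -> open (proj @` U);
  proj_locally_injective : forall z, disc z ->
    exists2 U, nbhs z U & {in U &, injective proj};
  proj_deck : forall z w, disc z -> disc w -> proj z = proj w ->
    exists g, [/\ disc_automorphism g,
                  forall u, disc u -> proj (g u) = proj u & g z = w]
}.

Section Surface.
Variables (R : realType) (X : hyperbolic_surface R).
Local Notation C := (Cplx R).

Definition deck (g : C -> C) : Prop :=
  disc_automorphism g /\ forall z, disc z -> proj X (g z) = proj X z.

(* A holomorphic section of K_X^m is written f (dz)^m on the disc, with
   f (dz)^m invariant under the deck group. *)
Definition holo_section (m : nat) (f : C -> C) : Prop :=
  holomorphic f /\
  forall g z, deck g -> disc z -> f (g z) * (derive1 g z) ^+ m = f z.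

(* The metric g_X is the push-forward of g (dx^2 + dy^2) on the disc, the
   complete conformal metric of curvature -1. *)
Definition poincare (z : C) : C := 4 / (1 - `|z| ^+ 2) ^+ 2.

End Surface.

(* The bundle V (+) W pulled back to the disc is trivialised by the powers of
   dz; an endomorphism, pairing or metric is a matrix of size n + n, the first
   n indices being the summands of V and the last n those of W. *)
Section Bundle.
Variables (R : realType) (n : nat).
Local Notation C := (Cplx R).
Local Notation M := 'M[C]_(n + n).

Definition wtV (i : 'I_n) : int := n%:Z - 1 - 2 * i%:Z.

(* The last summand of W is the extra trivial bundle O'. *)
Definition wtW (j : 'I_n) : int :=
  if j.+1 == n then 0 else n%:Z - 2 - 2 * j%:Z.

Definition wt (s : 'I_(n + n)) : int :=
  match fintype.split s with inl i => wtV i | inr j => wtW j end.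

Definition is_extra (s : 'I_(n + n)) : bool :=
  if fintype.split s is inr j then j.+1 == n else false.

Definition QV : 'M[C]_n := \matrix_(i, j) ((i + j).+1 == n)%:R.

Definition QW : 'M[C]_n :=
  \matrix_(i, j) (if (i.+1 == n) || (j.+1 == n) then (i == j)%:R
                  else ((i + j).+2 == n)%:R).

(* Indices start at 0 here, so that the entry q_{j-i+1} keeps its form. *)
Definition eta (q : nat -> C -> C) (z : C) : 'M[C]_n :=
  \matrix_(i, j)
    (if j.+1 == n then (if i == 0 :> nat then q n z else 0)
     else if (i <= j)%N then q (j - i).+1 z
     else (i == j.+1 :> nat)%:R).

(* QV (eta w, v) = QW (w, eta_adj v) *)
Definition eta_adj (q : nat -> C -> C) (z : C) : 'M[C]_n :=
  invmx QW *m (eta q z)^T *m QV.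

(* The Higgs field is theta q z dz. *)
Definition theta (q : nat -> C -> C) (z : C) : M :=
  block_mx 0 (eta q z) (eta_adj q z) 0.

Definition conjmx (m1 m2 : nat) (A : 'M[C]_(m1, m2)) : 'M[C]_(m1, m2) :=
  map_mx (fun x : C => (x^*)%C) A.

(* (dz)^w at g z is pulled back to (g' z)^w (dz)^w at z. *)
Definition cocycle (g : C -> C) (z : C) : M :=
  diag_mx (\row_s (derive1 g z) ^ wt s).

(* The Gram matrix H of h is h(u, v) = u^T H conj(v). *)
Definition hermitian_metric (X : hyperbolic_surface R) (H : C -> M) : Prop :=
  [/\ forall i j, smooth (fun z => H z i j),
      forall z, disc z -> conjmx (H z)^T = H z,
      forall z (u : 'cV[C]_(n + n)), disc z -> u != 0 ->
        0 < (u^T *m H z *m conjmx u) 0 0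
    & forall g z, deck X g -> disc z ->
        H (g z) = cocycle g z *m H z *m conjmx (cocycle g z)].

Definition compatible (Q H : 'M[C]_n) : Prop :=
  H *m conjmx (invmx Q) *m H^T = Q.

Definition SOnn_compatible (H : C -> M) : Prop :=
  forall z, disc z ->
  [/\ ursubmx (H z) = 0, dlsubmx (H z) = 0,
      compatible QV (ulsubmx (H z)) & compatible QW (drsubmx (H z))].

Definition mxd_z (A : C -> M) (z : C) : M :=
  \matrix_(i, j) d_z (fun w => A w i j) z.
Definition mxd_zbar (A : C -> M) (z : C) : M :=
  \matrix_(i, j) d_zbar (fun w => A w i j) z.

(* The Chern connection is d + chern H dz, and its curvature is
   - (mxd_zbar (chern H)) dz /\ dzbar. *)
Definition chern (H : C -> M) (z : C) : M := (mxd_z H z *m invmx (H z))^T.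

(* Adjoint for u^T H conj(v). *)
Definition hadj (H T : M) : M :=
  invmx (conjmx H) *m (conjmx T)^T *m conjmx H.

(* F(h) + [theta, theta^*] = 0, as the coefficient of dz /\ dzbar; the bracket
   of the two 1-forms is theta /\ theta^* + theta^* /\ theta. *)
Definition harmonic_metric (q : nat -> C -> C) (H : C -> M) : Prop :=
  forall z, disc z ->
  - mxd_zbar (chern H) z
  + (theta q z *m hadj (H z) (theta q z) - hadj (H z) (theta q z) *m theta q z)
  = 0.

(* filt p is the summand in position p (from 0) in the order
   K^(n-1), ..., K, O, O', K^-1, ..., K^(1-n).  The default value of insubd is
   never used. *)
Definition filt (p : 'I_(n + n)) : 'I_(n + n) :=
  insubd p
    (if p == n :> nat then n + n.-1
     else if (p < n)%N then (if odd p then n + p./2 else p./2)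
     else (if odd p then p./2 else n + p./2.-1))%N.

(* Gram determinant on det F_{k+1}, in the frame given by the powers of dz. *)
Definition gramF (H : M) (k : 'I_(n + n)) : C :=
  \det (\matrix_(i < k.+1, j < k.+1)
    H (filt (widen_ord (ltn_ord k) i)) (filt (widen_ord (ltn_ord k) j))).

Definition weakly_dominates (H H0 : C -> M) : Prop :=
  forall z k, disc z -> gramF (H z) k <= gramF (H0 z) k.

Definition a_coef (k : nat) : C :=
  (\prod_(1 <= l < n) ((l * (2 * n - 1 - l))%:R / 2)^-1)
  * \prod_(1 <= l < k) ((l * (2 * n - 1 - l))%:R / 2).

(* On K^w = K^(n-k): a_{k,n} (g/2)^(k-n) with k = n - w. *)
Definition hX (z : C) : M :=
  diag_mx (\row_s
    (if is_extra s then 1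
     else a_coef `|n%:Z - wt s|%N * (poincare z / 2) ^ (- wt s))).

(* (2n-2) sqrt(-1) Lambda tr(theta /\ theta^* ), where Lambda (dz /\ dzbar) is
   the inverse of sqrt(-1) g / 2. *)
Definition energy_density (q : nat -> C -> C) (H : C -> M) (z : C) : C :=
  (2 * n - 2)%:R *
  ('i%C * ('i%C / 2 * poincare z)^-1
   * \tr (theta q z *m hadj (H z) (theta q z))).

(* D_h = nabla_h + theta + theta^* preserves the form QV (+) -QW and the
   antilinear involution v |-> (QV (+) QW)^-1 H conj(v).  P is a D_h-parallel
   frame in which these are the form diag(1, -1) and the complex conjugation of
   R^(n,n); the last two conditions fix the orientations of the real forms of V
   and W (they involve square roots of det QV and det QW), so that two such
   frames differ by a constant element of SO_0(n,n). *)
Definition parallel_frame (q : nat -> C -> C) (H P : C -> M) : Prop :=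
  (forall i j, smooth (fun z => P z i j)) /\
  forall z, disc z ->
  [/\ mxd_z P z = - ((chern H z + theta q z) *m P z),
      mxd_zbar P z = - (hadj (H z) (theta q z) *m P z),
      (P z)^T *m block_mx QV 0 0 (- QW) *m P z = block_mx 1%:M 0 0 (- 1%:M),
      H z *m conjmx (P z) = block_mx QV 0 0 QW *m P z
    & 0 < \det (ulsubmx (P z)) / 'i%C ^+ 'C(n, 2) /\
      0 < \det (drsubmx (P z)) / 'i%C ^+ 'C(n.-1, 2)].

(* SO_0(n,n)/SO(n)xSO(n) is the space of metrics on R^(n,n) compatible with
   diag(1, -1), and the harmonic map sends z to h(z) read in the frame P. *)
Definition harmonic_map (H P : C -> M) (z : C) : M :=
  (P z)^T *m H z *m conjmx (P z).

(* The deck group acts on parallel sections through the constant matrices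
   rho g = P(g z)^-1 (cocycle g z)^-1 P(z); here z = 0. *)
Definition holonomy (P : C -> M) (g : C -> C) : M :=
  invmx (P (g 0)) *m invmx (cocycle g 0) *m P 0.

End Bundle.

(* Main.v *)
(* In the order of the filtration h becomes a positive matrix, and weak
   domination says that e_k = (k-th leading minor of h) / (that of h_X) is at
   most 1.  Write r_p = e_(p+1) / e_p.  In the unitriangular frame that
   diagonalises h, the 1's of theta joining consecutive powers of K contribute
   rho^2 sum_t c_t r_(t+1) / r_t to the energy (the position of O' being
   skipped), with c_t = (t+1)(2n-2-t) and rho = 1 / (1 - |z|^2); for h_X this is
   the whole energy.  Since x >= 1 + ln x, summation by parts bounds the
   difference of the energies below by -2 times a sum of ln e_k, which is
   nonnegative, and equality at a point forces e_k = 1 there for k < n.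

   The curvature of det F_k turns the harmonic equation into
   Delta ln e_k >= C rho^2 (1 - e_(k+1) e_(k-1) / e_k^2), so that 1 - e_k^2 is a
   nonnegative function with lap f <= K f locally, and the strong maximum
   principle gives e_k = 1 on the whole disc.  All off-diagonal terms discarded
   in the inequality then vanish: the first n - 1 steps of the filtration are
   parallel, and with the harmonic equation and the orthogonal structure theta^*
   is strictly upper triangular.  Hence theta^T h = h conj(theta^* ) with a strictly
   triangular right factor, so theta is nilpotent, which kills every q_i in turn;
   comparing columns then gives h = h_X.

   For the harmonic maps, G = P^T h conj(P) satisfies
   tr(d'G G^-1 d''G G^-1) = 4 tr(theta theta^* ), so equal maps have equal energy. *)
From HB Require Import structures.
Require Import Defs.
From mathcomp Require Import all_boot all_order all_algebra.
From mathcomp Require Import all_classical all_reals all_analysis.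
From mathcomp Require Import complex ring lra zify.
Set Implicit Arguments.
Unset Strict Implicit.
Unset Printing Implicit Defensive.
Import Order.TTheory GRing.Theory Num.Theory numFieldNormedType.Exports.
Local Open Scope classical_set_scope.
Local Open Scope ring_scope.

(** The extra summand [O'] shapes the argument. Its position [n] interrupts the chain of powers of
    [K]: the energy bound involves [ln e_k] for every [k] except [n], and the equation for [e_k], in
    which a single entry of theta leaves [F_k] and joins neighbouring positions, is available only
    for [k < n]. Two supplements bridge the gap. That [e_n = 1] is read off the equation for
    [k = n - 1], and row [n - 1] of theta is cleared by an off-diagonal entry of the harmonic
    equation instead of a curvature term. The symmetric pairing then reflects what is known about
    the first half of the filtration to the second half. The frame that diagonalises [h] is chosen
    separately at each point and never differentiated; only minors are. The differential part avoids
    logarithms: [f^2] times the complex Laplacian of [ln f] is polynomial in [f] and its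
    derivatives, and [1 - e_k^2] takes the place of [- ln e_k], so that smoothness is always read
    off from products, sums and inverses. *)

Local Notation conjmx := Defs.conjmx.

(** * Differential calculus on the disc *)

Section Calc.
Variable R : realType.
Local Notation C := (Cplx R).
Implicit Types (f g : C -> C) (v z a b : C).

(** Existence and value in one relation, so that the rules of calculus compose; [dirder] alone is a
    total function that says nothing about existence. *)
Definition has_dir v f z a : Prop :=
  is_derive (0 : R) (1 : R) (re_along v f z) (complex.Re a) /\
  is_derive (0 : R) (1 : R) (im_along v f z) (complex.Im a).

Lemma has_dir_dirder v f z a : has_dir v f z a -> dirder v f z = a.
Proof.
case=> h1 h2; rewrite /dirder !derive1E.
by rewrite (@derive_val _ _ _ _ _ _ _ h1) (@derive_val _ _ _ _ _ _ _ h2); case: (a).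
Qed.

Lemma has_dir_dirderivable v f z a : has_dir v f z a -> dirderivable v f z.
Proof. case=> -[h1 _] [h2 _]; exact: (conj h1 h2). Qed.

Lemma dirderivable_has_dir v f z : dirderivable v f z -> has_dir v f z (dirder v f z).
Proof. case=> h1 h2; split; rewrite /dirder /= derive1E; [exact: (derivableP h1)|exact: (derivableP h2)]. Qed.

Lemma re_imE (x : C) : (complex.Re x +i* complex.Im x)%C = x.
Proof. by case: x. Qed.

Lemma has_dir_cst v z a : has_dir v (fun _ => a) z 0.
Proof. by split; rewrite /re_along /im_along /=; exact: is_derive_cst. Qed.

Lemma has_dirD v f g z a b : has_dir v f z a -> has_dir v g z b ->
  has_dir v (fun w => f w + g w) z (a + b).
Proof.
move=> [f1 f2] [g1 g2]; split.
  by rewrite (_ : complex.Re _ = complex.Re a + complex.Re b) ?raddfD; [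
    rewrite (_ : re_along _ _ _ = re_along v f z + re_along v g z);
    [exact: is_deriveD | apply/funext=> t; rewrite /re_along /GRing.add /=; by case: (f _); case: (g _)]
   | case: a b {f1 f2 g1 g2} => ? ? []].
by rewrite (_ : complex.Im _ = complex.Im a + complex.Im b) ?raddfD; [
  rewrite (_ : im_along _ _ _ = im_along v f z + im_along v g z);
  [exact: is_deriveD | apply/funext=> t; rewrite /im_along /GRing.add /=; by case: (f _); case: (g _)]
 | case: a b {f1 f2 g1 g2} => ? ? []].
Qed.

Lemma cReM (x y : C) : complex.Re (x * y) =
  complex.Re x * complex.Re y - complex.Im x * complex.Im y.
Proof. by case: x; case: y. Qed.
Lemma cImM (x y : C) : complex.Im (x * y) =
  complex.Re x * complex.Im y + complex.Im x * complex.Re y.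
Proof. by case: x; case: y. Qed.
Lemma cReD (x y : C) : complex.Re (x + y) = complex.Re x + complex.Re y.
Proof. by case: x; case: y. Qed.
Lemma cImD (x y : C) : complex.Im (x + y) = complex.Im x + complex.Im y.
Proof. by case: x; case: y. Qed.
Lemma cReN (x : C) : complex.Re (- x) = - complex.Re x.
Proof. by case: x. Qed.
Lemma cImN (x : C) : complex.Im (- x) = - complex.Im x.
Proof. by case: x. Qed.

Lemma along0 z v : z + (0%:C)%C * v = z.
Proof. by rewrite mul0r addr0. Qed.

Lemma has_dirM v f g z a b : has_dir v f z a -> has_dir v g z b ->
  has_dir v (fun w => f w * g w) z (a * g z + f z * b).
Proof.
move=> [f1 f2] [g1 g2]; split.
  rewrite (_ : re_along _ _ _ =
    re_along v f z * re_along v g z - im_along v f z * im_along v g z).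
    apply: (is_derive_eq (is_deriveB (is_deriveM f1 g1) (is_deriveM f2 g2))).
    by rewrite /re_along /im_along !along0 cReD !cReM /GRing.scale /=; ring.
  by apply/funext=> t; rewrite {1}/re_along cReM.
rewrite (_ : im_along _ _ _ =
  re_along v f z * im_along v g z + im_along v f z * re_along v g z).
  apply: (is_derive_eq (is_deriveD (is_deriveM f1 g2) (is_deriveM f2 g1))).
  by rewrite /re_along /im_along !along0 cImD !cImM /GRing.scale /=; ring.
by apply/funext=> t; rewrite {1}/im_along cImM.
Qed.

Lemma has_dirN v f z a : has_dir v f z a -> has_dir v (fun w => - f w) z (- a).
Proof.
move=> [f1 f2]; split; rewrite ?cReN ?cImN.
  rewrite (_ : re_along _ _ _ = - re_along v f z); first exact: is_deriveN.
  by apply/funext=> t; rewrite {1}/re_along cReN.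
rewrite (_ : im_along _ _ _ = - im_along v f z); first exact: is_deriveN.
by apply/funext=> t; rewrite {1}/im_along cImN.
Qed.

Lemma has_dir_conj v f z a : has_dir v f z a ->
  has_dir v (fun w => ((f w)^*)%C) z (a^*)%C.
Proof.
move=> [f1 f2]; split.
  rewrite (_ : re_along _ _ _ = re_along v f z); first by case: a f1 f2.
  by apply/funext=> t; rewrite /re_along; case: (f _).
rewrite (_ : im_along _ _ _ = - im_along v f z).
  by rewrite (_ : complex.Im _ = - complex.Im a); [exact: is_deriveN|case: a f1 f2].
by apply/funext=> t; rewrite {1}/im_along /GRing.opp /= /im_along; case: (f _).
Qed.

Lemma has_dir_id v z : has_dir v id z v.
Proof.
have hl (c d : R) : is_derive (0 : R) 1 (fun t : R => c + t * d) d.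
  have h := is_deriveD (is_derive_cst c (0 : R) (1 : R))
    (is_deriveM (is_derive_id (0 : R) (1 : R)) (is_derive_cst d (0 : R) (1 : R))).
  rewrite (_ : (fun t => _) = cst c + id * cst d); last by apply/funext.
  apply: (is_derive_eq h).
  by rewrite /GRing.scale /= mulr0 mulr1 !add0r.
split.
  rewrite (_ : re_along _ _ _ = (fun t => complex.Re z + t * complex.Re v)) //.
  by apply/funext=> t; rewrite /re_along cReD cReM /= mul0r subr0.
rewrite (_ : im_along _ _ _ = (fun t => complex.Im z + t * complex.Im v)) //.
by apply/funext=> t; rewrite /im_along cImD cImM /= mul0r addr0.
Qed.

Lemma disc_nbhs z : disc z -> nbhs z (@disc R).
Proof.
move=> zd; apply/nbhs_ballP; exists (1 - `|z|); first by rewrite /= subr_gt0.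
move=> w; rewrite -ball_normE /= => hw; rewrite /disc /=.
rewrite -(subrK z w) (le_lt_trans (ler_normD _ _)) //.
by rewrite -ltrBrDr distrC.
Qed.

Lemma rc_continuous : continuous (fun t : R => (t%:C)%C : C).
Proof.
move=> t; apply/(@cvgrPdist_lt _ C) => e e0.
have [r er] : exists r : R, e = (r%:C)%C by move: e0; case: e => r i; rewrite ltcE /= => /andP[/eqP -> _]; exists r.
move: e0; rewrite er ltcR => r0.
near=> s; rewrite -rmorphB normc_def /= expr0n /= addr0 sqrtr_sqr ltcR.
near: s; exact: (@cvgr_dist_lt _ _ _ _ _ id).
Unshelve. all: by end_near. Qed.

Lemma near_along z v (P : set C) : nbhs z P ->
  \forall t \near (0 : R), P (z + (t%:C)%C * v).
Proof.
move=> hP.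
have hc : (fun t : R => z + (t%:C)%C * v : C) @ (0 : R) --> z.
  rewrite -[X in _ --> X](along0 z v).
  apply: (@cvgD _ C) ; first exact: cvg_cst.
  apply: (@cvgM C); last exact: cvg_cst.
  exact: rc_continuous.
exact: hc.
Qed.

Lemma has_dir_ext v f g z a : (\forall w \near z, f w = g w) ->
  has_dir v f z a -> has_dir v g z a.
Proof.
move=> fg [h1 h2]; have {}fg := near_along v fg.
split.
  apply: (near_eq_is_derive _ h1); by near=> t; rewrite /re_along; congr complex.Re; near: t.
apply: (near_eq_is_derive _ h2); by near=> t; rewrite /im_along; congr complex.Im; near: t.
Unshelve. all: by end_near. Qed.

Lemma eq_disc_near (f g : C -> C) z : disc z -> (forall w, disc w -> f w = g w) ->
  \forall w \near z, f w = g w.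
Proof. by move=> zd fg; apply: filterS (disc_nbhs zd) => w; exact: fg. Qed.

Lemma has_dirV v f z a : f z != 0 -> has_dir v f z a ->
  has_dir v (fun w => (f w)^-1) z (- a / f z ^+ 2).
Proof.
move=> fz0 [f1 f2].
(* [N] is the squared modulus of [f] along the line; the real and imaginary parts of the inverse are
   those of the conjugate divided by [N]. *)
pose N t := re_along v f z t ^+ 2 + im_along v f z t ^+ 2.
have N0 : N 0 != 0.
  rewrite /N /re_along /im_along !along0; apply: contra fz0.
  rewrite paddr_eq0 ?sqr_ge0 // !sqrf_eq0 => /andP[/eqP h1 /eqP h2].
  by rewrite eq_complex /= h1 h2 !eqxx.
have hN : is_derive (0 : R) 1 N (2 * (complex.Re (f z) * complex.Re a + complex.Im (f z) * complex.Im a)).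
  rewrite (_ : N = re_along v f z * re_along v f z + im_along v f z * im_along v f z).
    apply: (is_derive_eq (is_deriveD (is_deriveM f1 f1) (is_deriveM f2 f2))).
    by rewrite /re_along /im_along !along0 /GRing.scale /=; ring.
  by apply/funext=> t; rewrite /N !expr2.
have N0' : complex.Re (f z) ^+ 2 + complex.Im (f z) ^+ 2 != 0.
  by move: N0; rewrite /N /re_along /im_along !along0.
have hV := @is_deriveV R N 0 _ 1 N0 hN.
have E (x y p r : R) : x ^+ 2 + y ^+ 2 != 0 ->
  (- ((p +i* r)%C : C) / ((x +i* y)%C : C) ^+ 2) =
  ((x * (- (x ^+ 2 + y ^+ 2) ^- 2 * (2 * (x * p + y * r))) + (x ^+ 2 + y ^+ 2)^-1 * p) +i*
  (- (y * (- (x ^+ 2 + y ^+ 2) ^- 2 * (2 * (x * p + y * r))) + (x ^+ 2 + y ^+ 2)^-1 * r)))%C :> C.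
  move=> h; have h2 : ((x +i* y)%C : C) != 0.
    rewrite eq_complex /=; apply: contra h => /andP[/eqP -> /eqP ->].
    by rewrite expr0n addr0.
  apply: (@mulIf _ (((x +i* y)%C : C) ^+ 2)); first by rewrite expf_neq0.
  rewrite mulfVK ?expf_neq0 // expr2.
  apply/eqP; rewrite eq_complex !(cReM, cImM) /=.
  by apply/andP; split; apply/eqP; field.
have hE := E (complex.Re (f z)) (complex.Im (f z)) (complex.Re a) (complex.Im a) N0'.
rewrite !re_imE in hE; split.
  rewrite (_ : re_along v (fun w => (f w)^-1) z = re_along v f z * (fun t => (N t)^-1)).
    apply: (is_derive_eq (is_deriveM f1 hV)); rewrite hE /= /N /re_along /im_along !along0 /GRing.scale /=.
    by [].
  by apply/funext=> t; rewrite {1}/re_along /GRing.mul /= /N /re_along /im_along; case: (f _).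
rewrite (_ : im_along v (fun w => (f w)^-1) z = - (im_along v f z * (fun t => (N t)^-1))).
  apply: (is_derive_eq (is_deriveN (is_deriveM f2 hV))); rewrite hE /= /N /re_along /im_along !along0 /GRing.scale /=.
  by [].
by apply/funext=> t; rewrite {1}/im_along /GRing.opp /GRing.mul /= /N /re_along /im_along; case: (f _).
Qed.

End Calc.

(** * Closure properties of functions smooth on the disc *)

Section Smooth.
Variable R : realType.
Local Notation C := (Cplx R).
Implicit Types (f g : C -> C) (v z a b s : C).

Lemma eq_on_dirder v f g z : disc z -> dirderivable v f z ->
  (forall w, disc w -> f w = g w) -> dirder v f z = dirder v g z.
Proof.
move=> zd fd fg; apply/esym/has_dir_dirder.
by apply: (has_dir_ext (eq_disc_near zd fg)); exact: dirderivable_has_dir.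
Qed.

Lemma Ck0 f : (forall z, disc z -> {for z, continuous f}) -> Ck 0 f.
Proof. by move=> h; exact: (conj h I). Qed.

Lemma Ck_cont k f : Ck k f -> forall z, disc z -> {for z, continuous f}.
Proof. by case: k => [|k] [h _]. Qed.

Lemma CkS k f : Ck k.+1 f <-> [/\ Ck 0 f,
  forall z, disc z -> dirderivable 1 f z /\ dirderivable 'i%C f z,
  Ck k (dirder 1 f) & Ck k (dirder 'i%C f)].
Proof. by split=> [[h0 [h1 h2 h3]]|[[h0 _] h1 h2 h3]]. Qed.

Lemma cont_ext f g z : disc z -> (forall w, disc w -> f w = g w) ->
  {for z, continuous f} -> {for z, continuous g}.
Proof.
move=> zd fg h0; have e := eq_disc_near zd fg => P; rewrite -(fg z zd) => /h0.
by apply: filterS2 e => w /= <-.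
Qed.

(** The disc is open, so derivatives of every order at its points depend only on the values on
    it. *)
Lemma Ck_ext k f g : (forall z, disc z -> f z = g z) -> Ck k f -> Ck k g.
Proof.
elim: k f g => [|k IH] f g fg.
  move=> [h _]; apply: Ck0 => z zd; exact: cont_ext zd fg (h z zd).
move=> /CkS[h0 h1 h2 h3]; apply/CkS; split.
- by have [h0' _] := h0; apply: Ck0 => z zd; exact: cont_ext zd fg (h0' z zd).
- move=> z zd; have [d1 d2] := h1 z zd; have e := eq_disc_near zd fg.
  by split; apply: has_dir_dirderivable; apply: (has_dir_ext e);
    exact: dirderivable_has_dir.
- by apply: (IH _ _ _ h2) => z zd; apply: eq_on_dirder => //; have [] := h1 z zd.
- by apply: (IH _ _ _ h3) => z zd; apply: eq_on_dirder => //; have [] := h1 z zd.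
Qed.

Lemma Ck_pred k f : Ck k.+1 f -> Ck k f.
Proof.
elim: k f => [|k IH] f /CkS[h0 h1 h2 h3]; first exact: h0.
by apply/CkS; split; [exact: Ck0 (Ck_cont h0)|exact: h1|exact: IH|exact: IH].
Qed.

(** Introduction rule behind the closure lemmas: [d] is the expected formula for the derivative and
    needs to be right only on the disc. *)
Lemma Ck_build k f (d : C -> C -> C) : Ck 0 f ->
  (forall v z, v = 1 \/ v = 'i%C -> disc z -> has_dir v f z (d v z)) ->
  Ck k (d 1) -> Ck k (d 'i%C) -> Ck k.+1 f.
Proof.
move=> f0 fd h1 hi; apply/CkS; split; first exact: f0.
- move=> z zd; split; apply: has_dir_dirderivable; apply: fd => //; by [left|right].
- by apply: (Ck_ext _ h1) => z zd; apply/esym/has_dir_dirder/fd => //; left.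
- by apply: (Ck_ext _ hi) => z zd; apply/esym/has_dir_dirder/fd => //; right.
Qed.

Lemma Ck_has_dir k f v z : v = 1 \/ v = 'i%C -> disc z -> Ck k.+1 f ->
  has_dir v f z (dirder v f z).
Proof.
move=> hv zd /CkS[_ h _ _]; have [h1 h2] := h z zd.
by apply: dirderivable_has_dir; case: hv => ->.
Qed.

Lemma Ck_dir k f v : v = 1 \/ v = 'i%C -> Ck k.+1 f -> Ck k (dirder v f).
Proof. by move=> [->|->] /CkS[]. Qed.

Lemma Ck_cst k a : Ck k (fun=> a).
Proof.
elim: k a => [|k IH] a; first by apply: Ck0 => z _; exact: (@cst_continuous C C a).
apply: (@Ck_build _ _ (fun _ _ => 0)) => [|v z _ _||].
- by apply: Ck0 => z _; exact: (@cst_continuous C C a).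
- exact: has_dir_cst.
- exact: IH.
- exact: IH.
Qed.

Lemma CkD k f g : Ck k f -> Ck k g -> Ck k (fun z => f z + g z).
Proof.
elim: k f g => [|k IH] f g hf hg.
  by apply: Ck0 => z zd; have h := cvgD (Ck_cont hf zd) (Ck_cont hg zd); exact: h.
apply: (@Ck_build _ _ (fun v z => dirder v f z + dirder v g z)).
- by apply: Ck0 => z zd; have h := cvgD (Ck_cont hf zd) (Ck_cont hg zd); exact: h.
- by move=> v z hv zd; apply: has_dirD; [exact: (Ck_has_dir hv zd hf)|exact: (Ck_has_dir hv zd hg)].
- by apply: IH; apply: Ck_dir => //; left.
- by apply: IH; apply: Ck_dir => //; right.
Qed.

Lemma CkM k f g : Ck k f -> Ck k g -> Ck k (fun z => f z * g z).
Proof.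
elim: k f g => [|k IH] f g hf hg.
  by apply: Ck0 => z zd; have h := cvgM (Ck_cont hf zd) (Ck_cont hg zd); exact: h.
apply: (@Ck_build _ _ (fun v z => dirder v f z * g z + f z * dirder v g z)).
- by apply: Ck0 => z zd; have h := cvgM (Ck_cont hf zd) (Ck_cont hg zd); exact: h.
- by move=> v z hv zd; apply: has_dirM; [exact: (Ck_has_dir hv zd hf)|exact: (Ck_has_dir hv zd hg)].
- by apply: CkD; apply: IH; try exact: Ck_pred; apply: Ck_dir => //; left.
- by apply: CkD; apply: IH; try exact: Ck_pred; apply: Ck_dir => //; right.
Qed.

Lemma Ck_conj k f : Ck k f -> Ck k (fun z => ((f z)^*)%C).
Proof.
have c1 : continuous (fun x : C => (x^*)%C : C).
  move=> x P /nbhs_ballP[e e0 h]; apply/nbhs_ballP; exists e => //.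
  by move=> w hw; apply: h; move: hw; rewrite -!ball_normE /= -rmorphB normcJ.
have cc (h : C -> C) z : {for z, continuous h} -> {for z, continuous (fun z => ((h z)^*)%C : C)}.
  by move=> hc; have h1 := continuous_comp hc (c1 (h z)); exact: h1.
elim: k f => [|k IH] f hf; first by apply: Ck0 => z zd; apply: cc; exact: (Ck_cont hf).
apply: (@Ck_build _ _ (fun v z => ((dirder v f z)^*)%C)).
- by apply: Ck0 => z zd; apply: cc; exact: (Ck_cont hf).
- by move=> v z hv zd; apply: has_dir_conj; exact: (Ck_has_dir hv zd hf).
- by apply: IH; apply: Ck_dir => //; left.
- by apply: IH; apply: Ck_dir => //; right.
Qed.

Lemma CkV k f : (forall z, disc z -> f z != 0) -> Ck k f -> Ck k (fun z => (f z)^-1).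
Proof.
move=> f0; elim: k => [|k IH] hf.
  by apply: Ck0 => z zd; have h := cvgV (f0 z zd) (Ck_cont hf zd); exact: h.
have hI := IH (Ck_pred hf).
(* The factored form of the derivative lets [CkM] and the induction hypothesis handle it. *)
apply: (@Ck_build _ _ (fun v z => (-1) * dirder v f z * ((f z)^-1 * (f z)^-1))).
- by apply: Ck0 => z zd; have h := cvgV (f0 z zd) (Ck_cont hf zd); exact: h.
- move=> v z hv zd.
  rewrite (_ : _ * _ = - dirder v f z / f z ^+ 2); last by rewrite mulN1r expr2 invfM.
  by apply: has_dirV; [exact: f0|exact: Ck_has_dir hf].
- apply: CkM; last by apply: CkM.
  by apply: CkM; [exact: Ck_cst|apply: Ck_dir => //; left].
- apply: CkM; last by apply: CkM.
  by apply: CkM; [exact: Ck_cst|apply: Ck_dir => //; right].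
Qed.

Lemma Ck_id k : Ck k (@id C).
Proof.
case: k => [|k]; first by apply: Ck0 => z _ P.
apply: (@Ck_build _ _ (fun v z => v)) => [|v z _ _||].
- by apply: Ck0 => z _ P.
- exact: has_dir_id.
- exact: Ck_cst.
- exact: Ck_cst.
Qed.

Lemma smooth_ext f g : (forall z, disc z -> f z = g z) -> smooth f -> smooth g.
Proof. by move=> fg h k; apply: Ck_ext (h k). Qed.
Lemma smooth_cst a : smooth (fun=> a : C). Proof. by move=> k; exact: Ck_cst. Qed.
Lemma smooth_id : smooth (@id C). Proof. by move=> k; exact: Ck_id. Qed.
Lemma smoothD f g : smooth f -> smooth g -> smooth (fun z => f z + g z).
Proof. by move=> hf hg k; exact: CkD. Qed.
Lemma smoothM f g : smooth f -> smooth g -> smooth (fun z => f z * g z).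
Proof. by move=> hf hg k; exact: CkM. Qed.
Lemma smooth_conj f : smooth f -> smooth (fun z => ((f z)^*)%C).
Proof. by move=> hf k; exact: Ck_conj. Qed.
Lemma smoothV f : (forall z, disc z -> f z != 0) -> smooth f -> smooth (fun z => (f z)^-1).
Proof. by move=> f0 hf k; exact: CkV. Qed.
Lemma smoothN f : smooth f -> smooth (fun z => - f z).
Proof.
move=> hf; apply: (@smooth_ext (fun z => (-1) * f z)) => [z _|]; first by rewrite mulN1r.
by apply: smoothM => //; exact: smooth_cst.
Qed.
Lemma smooth_sum (I : Type) (r : seq I) (P : pred I) (F : I -> C -> C) :
  (forall i, smooth (F i)) -> smooth (fun z => \sum_(i <- r | P i) F i z).
Proof.
move=> hF; elim: r => [|i r IH].
  by apply: smooth_ext (smooth_cst 0) => z _; rewrite big_nil.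
case Pi: (P i); last by apply: smooth_ext IH => z _; rewrite big_cons Pi.
by apply: smooth_ext (smoothD (hF i) IH) => z _; rewrite big_cons Pi.
Qed.
Lemma smooth_prod (I : Type) (r : seq I) (P : pred I) (F : I -> C -> C) :
  (forall i, smooth (F i)) -> smooth (fun z => \prod_(i <- r | P i) F i z).
Proof.
move=> hF; elim: r => [|i r IH].
  by apply: smooth_ext (smooth_cst 1) => z _; rewrite big_nil.
case Pi: (P i); last by apply: smooth_ext IH => z _; rewrite big_cons Pi.
by apply: smooth_ext (smoothM (hF i) IH) => z _; rewrite big_cons Pi.
Qed.
Lemma smoothX f n : smooth f -> smooth (fun z => f z ^+ n).
Proof.
move=> hf; apply: smooth_ext (@smooth_prod _ (index_enum 'I_n) xpredT (fun _ => f) (fun _ => hf)) => z _.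
by rewrite prodr_const card_ord.
Qed.
Lemma smooth_has_dir f v z : smooth f -> v = 1 \/ v = 'i%C -> disc z ->
  has_dir v f z (dirder v f z).
Proof. by move=> /(_ 1%N) hf hv zd; exact: Ck_has_dir hf. Qed.

End Smooth.

(** Both Wirtinger derivatives at once: [s = - 'i] gives [d_z] and [s = 'i] gives [d_zbar], so each
    rule is proved once. *)
HB.lock Definition dop (R : realType) (s : Cplx R) (f : Cplx R -> Cplx R) (z : Cplx R) : Cplx R :=
  (dirder 1 f z + s * dirder 'i%C f z) / 2.

Section Dop.
Variable R : realType.
Local Notation C := (Cplx R).
Implicit Types (f g : C -> C) (v z a b s : C).

Lemma d_zE f z : d_z f z = dop (- 'i%C) f z.
Proof. by rewrite /d_z dop.unlock mulNr. Qed.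
Lemma d_zbarE f z : d_zbar f z = dop 'i%C f z. Proof. by rewrite dop.unlock. Qed.

Lemma smooth_dop s f : smooth f -> smooth (dop s f).
Proof.
move=> hf; rewrite dop.unlock; apply: smoothM; last exact: smooth_cst.
apply: smoothD; first by move=> k; apply: Ck_dir (hf k.+1); left.
apply: smoothM; first exact: smooth_cst.
by move=> k; apply: Ck_dir (hf k.+1); right.
Qed.

Lemma dop_val s f z a b : has_dir 1 f z a -> has_dir 'i%C f z b ->
  dop s f z = (a + s * b) / 2.
Proof. by move=> /has_dir_dirder ha /has_dir_dirder hb; rewrite dop.unlock ha hb. Qed.

Lemma eq_dop s f g z : smooth f -> disc z -> (forall w, disc w -> f w = g w) ->
  dop s f z = dop s g z.
Proof.
move=> hf zd fg; rewrite dop.unlock; have /CkS[_ /(_ z zd)[h1 h2] _ _] := hf 1%N.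
by rewrite (eq_on_dirder zd h1 fg) (eq_on_dirder zd h2 fg).
Qed.

Local Notation l1 := (or_introl erefl).
Local Notation r1 := (or_intror erefl).

Lemma dop_cst s a z : dop s (fun=> a) z = 0.
Proof. by rewrite (dop_val s (has_dir_cst _ _ _) (has_dir_cst _ _ _)) mulr0 addr0 mul0r. Qed.

Lemma dopD s f g z : smooth f -> smooth g -> disc z ->
  dop s (fun w => f w + g w) z = dop s f z + dop s g z.
Proof.
move=> hf hg zd; rewrite (dop_val s (has_dirD (smooth_has_dir hf l1 zd) (smooth_has_dir hg l1 zd))
  (has_dirD (smooth_has_dir hf r1 zd) (smooth_has_dir hg r1 zd))) !dop.unlock.
by field.
Qed.

Lemma dopM s f g z : smooth f -> smooth g -> disc z ->
  dop s (fun w => f w * g w) z = dop s f z * g z + f z * dop s g z.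
Proof.
move=> hf hg zd; rewrite (dop_val s (has_dirM (smooth_has_dir hf l1 zd) (smooth_has_dir hg l1 zd))
  (has_dirM (smooth_has_dir hf r1 zd) (smooth_has_dir hg r1 zd))) !dop.unlock.
by field.
Qed.

Lemma dopN s f z : smooth f -> disc z -> dop s (fun w => - f w) z = - dop s f z.
Proof.
move=> hf zd; rewrite (dop_val s (has_dirN (smooth_has_dir hf l1 zd))
  (has_dirN (smooth_has_dir hf r1 zd))) !dop.unlock; by field.
Qed.

Lemma dop_conj s f z : smooth f -> disc z ->
  dop s (fun w => ((f w)^*)%C) z = ((dop (s^*)%C f z)^*)%C.
Proof.
move=> hf zd; rewrite (dop_val s (has_dir_conj (smooth_has_dir hf l1 zd))
  (has_dir_conj (smooth_has_dir hf r1 zd))) dop.unlock.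
have h2 : ((2^-1 : C)^*)%C = 2^-1 by rewrite conjc_inv conjc_nat.
move: h2; move: (2^-1 : C) => h h2.
by rewrite rmorphM rmorphD rmorphM /= conjcK h2.
Qed.

Lemma dop_sum s (I : Type) (r : seq I) (P : pred I) (F : I -> C -> C) z :
  (forall i, smooth (F i)) -> disc z ->
  dop s (fun z => \sum_(i <- r | P i) F i z) z = \sum_(i <- r | P i) dop s (F i) z.
Proof.
move=> hF zd; elim: r => [|i r IH].
  rewrite big_nil -[RHS](dop_cst s 0 z); apply: eq_dop => // [|w _].
    exact: (@smooth_sum _ _ [::]).
  by rewrite big_nil.
case Pi: (P i); rewrite big_cons Pi -IH.
  rewrite -dopD //; last exact: smooth_sum.
  by apply: eq_dop => // [|w _]; [exact: (@smooth_sum _ _ (i :: r))|rewrite big_cons Pi].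
by apply: eq_dop => // [|w _]; [exact: (@smooth_sum _ _ (i :: r))|rewrite big_cons Pi].
Qed.

Lemma dop_prod_seq s (I : eqType) (r : seq I) (F : I -> C -> C) z : uniq r ->
  (forall i, smooth (F i)) -> disc z ->
  dop s (fun z => \prod_(i <- r) F i z) z =
  \sum_(i <- r) dop s (F i) z * \prod_(j <- r | j != i) F j z.
Proof.
move=> + hF zd; elim: r => [|i r IH] /=.
  move=> _; rewrite big_nil -[RHS](dop_cst s 1 z); apply: eq_dop => // [|w _].
    exact: (@smooth_prod _ _ [::]).
  by rewrite big_nil.
move=> /andP[ir ur].
rewrite (@eq_dop _ _ (fun w => F i w * \prod_(i <- r) F i w)) //; last first.
- by move=> w _; rewrite big_cons.
- exact: (@smooth_prod _ _ (i :: r)).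
rewrite dopM //; last exact: smooth_prod.
rewrite big_cons big_cons eqxx /= IH //; congr (_ * _ + _).
  rewrite big_seq_cond [in RHS]big_seq_cond; apply: eq_bigl => j.
  by case jr: (j \in r) => //=; apply/esym; apply: contraNneq ir => <-.
rewrite mulr_sumr [LHS]big_seq_cond [RHS]big_seq_cond; apply: eq_bigr => j; rewrite andbT => jr.
rewrite big_cons ifT; first by rewrite mulrCA.
by apply: contraNneq ir => ->.
Qed.

Lemma dop_prod s (I : finType) (F : I -> C -> C) z :
  (forall i, smooth (F i)) -> disc z ->
  dop s (fun z => \prod_i F i z) z = \sum_i dop s (F i) z * \prod_(j | j != i) F j z.
Proof. by move=> hF zd; apply: dop_prod_seq => //; exact: index_enum_uniq. Qed.

End Dop.

(** * The strong maximum principle *)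

Section StrongMax.
Variable R : realType.
Local Notation C := (Cplx R).
Implicit Types (f g : C -> C) (v z a b s : C).

(** If [g2] were negative, then [g1], which is 0 at the minimum, would be negative just to the right
    of it, and the mean value theorem would give a smaller value of [g]. *)
Lemma second_deriv_min (g g1 : R -> R) (g2 : R) :
  (\forall t \near (0 : R), is_derive t (1 : R) g (g1 t)) ->
  is_derive (0 : R) (1 : R) g1 g2 ->
  (\forall t \near (0 : R), g 0 <= g t) -> 0 <= g2.
Proof.
move=> hd hd1 hmin; rewrite leNgt; apply/negP => g20.
have [dg1 vg1] := hd1.
have hq : (fun h : R => h^-1 *: (g1 (h *: 1 + 0) - g1 0)) @ 0^' --> g2.
  rewrite -vg1 /derive; under eq_fun do rewrite addrC.
  by move: dg1; rewrite /derivable; under eq_fun do rewrite addrC.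
have hneg : \forall h \near (0 : R)^', h^-1 *: (g1 (h *: 1 + 0) - g1 0) < 0.
  exact: (cvgr_lt _ hq).
have hneg' : \forall h \near (0 : R), h != 0 -> h^-1 * (g1 h - g1 0) < 0.
  have {}hneg : \forall h \near (0 : R), h != 0 -> h^-1 *: (g1 (h *: 1 + 0) - g1 0) < 0 := hneg.
  near=> h; rewrite -[in g1 h](addr0 h) -[in h + 0](mulr1 h); near: h; exact: hneg.
have /nbhs_ballP[e /= e0 he] : \forall t \near (0 : R),
    [/\ is_derive t (1 : R) g (g1 t), g 0 <= g t & t != 0 -> t^-1 * (g1 t - g1 0) < 0].
  near=> t; split; [near: t; exact: hd|near: t; exact: hmin|].
  by near: t.
have inb (t : R) : `|t| < e -> ball 0 e t by rewrite -ball_normE /= sub0r normrN.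
have g10 : g1 0 = 0.
  have h : is_derive (0 : R) 1 g 0.
    apply: (@derive1_at_min _ _ (- e) e) => [|t||t].
    - by rewrite ge0_cp // ltW.
    - rewrite in_itv /= -ltr_norml => /inb /he[d _ _]; have [d1 _] := d; exact: d1.
    - by rewrite in_itv /= oppr_lt0 e0.
    - by rewrite in_itv /= -ltr_norml => /inb /he[].
  have [h' _ _] := he 0 (inb 0 ltac:(by rewrite normr0)).
  by rewrite -(@derive_val _ _ _ _ _ _ _ h') (@derive_val _ _ _ _ _ _ _ h).
have e2 : 0 < e / 2 by rewrite divr_gt0.
have e2e : e / 2 < e by rewrite ltr_pdivrMr // ltr_pMr // ltr1n.
have hin x : 0 <= x <= e / 2 -> `|x| < e.
  by move=> /andP[x0 x1]; rewrite ger0_norm // (le_lt_trans x1).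
have [c ce hc] : exists2 c, c \in `]0, e / 2[%R & g (e / 2) - g 0 = g1 c * (e / 2 - 0).
  apply: MVT => // [x|].
    by rewrite in_itv /= => /andP[x0 x1]; have [] := he x (inb x (hin x ltac:(by rewrite !ltW))).
  apply: derivable_within_continuous => x; rewrite in_itv /= => xi.
  by have [d _ _] := he x (inb x (hin x xi)); have [d1 _] := d; exact: d1.
move: ce; rewrite in_itv /= => /andP[c0 c1].
have [_ _ /(_ (lt0r_neq0 c0))] := he c (inb c (hin c ltac:(by rewrite !ltW))).
have [_ hg _] := he (e / 2) (inb _ (hin (e / 2) ltac:(by rewrite lexx ltW))).
rewrite g10 subr0 pmulr_rlt0 ?invr_gt0 // => g1c.
have : g1 c * (e / 2 - 0) < 0 by rewrite subr0 pmulr_llt0.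
by rewrite -hc subr_lt0 ltNge hg.
Unshelve. all: by end_near. Qed.

Lemma Re_continuous : continuous (fun z : C => complex.Re z).
Proof.
move=> z P /nbhs_ballP[e e0 h]; apply/nbhs_ballP; exists (e%:C)%C; first by rewrite /= ltcR.
move=> w hw; apply: h; move: hw; rewrite -!ball_normE /= => hw.
rewrite -cReN -cReD -ltcR; apply: le_lt_trans hw; exact: normc_ge_Re.
Qed.

Lemma Im_continuous : continuous (fun z : C => complex.Im z).
Proof.
have E : (fun z : C => complex.Im z) = (fun z => complex.Re (- ('i%C * z))).
  by apply/funext=> z; rewrite cReN cReM /= mul0r sub0r opprK mul1r.
rewrite E => z; apply: (@continuous_comp _ _ _ (fun z : C => - ('i%C * z) : C)); last exact: Re_continuous.
apply: (@continuousN C C); apply: (@continuousM C C); last by [].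
exact: (@cst_continuous C C).
Qed.

(** The norm of [C] takes values in [C]; [n2] and [nrm] bring the squared norm and the norm into
    [R], where the estimates take place. *)
Definition n2 z : R := complex.Re z ^+ 2 + complex.Im z ^+ 2.

Lemma n2_continuous (p : C) : continuous (fun z : C => n2 (z - p)).
Proof.
move=> z.
have hs : continuous (fun z : C => z - p : C).
  move=> w; apply: (@continuousB C C); first by []. exact: (@cst_continuous C C).
have hR : {for z, continuous (fun z : C => complex.Re (z - p))}.
  by have h := continuous_comp (hs z) (@Re_continuous (z - p)); exact: h.
have hI : {for z, continuous (fun z : C => complex.Im (z - p))}.
  by have h := continuous_comp (hs z) (@Im_continuous (z - p)); exact: h.
have h := cvgD (cvgM hR hR) (cvgM hI hI).
rewrite /continuous_at (_ : (fun z : C => n2 (z - p)) = (fun z : C => complex.Re (z - p)) * (fun z : C => complex.Re (z - p)) + (fun z : C => complex.Im (z - p)) * (fun z : C => complex.Im (z - p))).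
  exact: h.
by apply/funext=> w; rewrite /n2 !expr2.
Qed.

Definition nrm z : R := Num.sqrt (n2 z).
Lemma n2_ge0 z : 0 <= n2 z. Proof. by rewrite addr_ge0 ?sqr_ge0. Qed.
Lemma nrm_sqr z : nrm z ^+ 2 = n2 z.
Proof. by rewrite /nrm sqr_sqrtr ?n2_ge0. Qed.
Lemma nrm_ge0 z : 0 <= nrm z. Proof. by rewrite /nrm sqrtr_ge0. Qed.
Lemma nrmE z : `|z| = ((nrm z)%:C)%C. Proof. by rewrite normc_def. Qed.
Lemma discE z : disc z <-> nrm z < 1.
Proof. by rewrite /disc /= nrmE ltcR. Qed.
Lemma nrmD z a : nrm (z + a) <= nrm z + nrm a.
Proof. by rewrite -lecR rmorphD /= -!nrmE ler_normD. Qed.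
Lemma n2_lt z (r : R) : 0 <= r -> (n2 z < r ^+ 2) = (nrm z < r).
Proof. by move=> r0; rewrite -nrm_sqr ltr_pXn2r // ?nnegrE ?nrm_ge0. Qed.
Lemma n2_le z (r : R) : 0 <= r -> (n2 z <= r ^+ 2) = (nrm z <= r).
Proof. by move=> r0; rewrite -nrm_sqr ler_pXn2r // ?nnegrE ?nrm_ge0. Qed.

(** The annulus is closed in the continuous image of the square [[-r, r] x [-r, r]]. *)
Lemma compact_annulus (p : C) (s r : R) : 0 <= r ->
  compact [set z : C | s <= n2 (z - p) <= r ^+ 2].
Proof.
move=> r0.
pose E (xy : R * R) : C := p + (xy.1 +i* xy.2)%C.
have Ec : continuous E.
  move=> xy; apply: (@continuousD C C).
    exact: (@cst_continuous _ C).
  have -> : (fun w : R * R => (w.1 +i* w.2)%C : C) =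
      (fun w => (w.1)%:C%C + 'i%C * (w.2)%:C%C).
    by apply/funext=> w; rewrite [LHS]complexE.
  apply: (@continuousD C C).
    apply: (@continuous_comp _ _ _ fst (fun x : R => (x%:C)%C : C)); [exact: cvg_fst|exact: rc_continuous].
  apply: (@continuousM C).
    exact: (@cst_continuous _ C).
  apply: (@continuous_comp _ _ _ snd (fun x : R => (x%:C)%C : C)); [exact: cvg_snd|exact: rc_continuous].
have cK : compact (E @` (`[- r, r] `*` `[- r, r])).
  apply: continuous_compact; first exact: continuous_subspaceT.
  by apply: compact_setX; exact: segment_compact.
apply: subclosed_compact cK _.
  have -> : [set z : C | s <= n2 (z - p) <= r ^+ 2] =
      (fun z : C => n2 (z - p)) @^-1` `[s, r ^+ 2].
    by apply/seteqP; split=> z /=; rewrite in_itv.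
  by apply: closed_comp => [z _|]; [exact: n2_continuous|exact: interval_closed].
move=> z /= /andP[_ hz]; exists (complex.Re (z - p), complex.Im (z - p)).
  rewrite /= !in_itv /= -!ler_norml -(@ler_pXn2r _ 2) ?nnegrE // real_normK ?num_real //.
  rewrite -(@ler_pXn2r _ 2 _ `|complex.Im _|) ?nnegrE // real_normK ?num_real //.
  by split; apply: le_trans hz; rewrite /n2 ?lerDl ?lerDr sqr_ge0.
by rewrite /E /= re_imE addrC subrK.
Qed.

(** The barrier |w - p|^(-2m) along a line parallel to an axis: [a] is the coordinate of the base
    point, relative to [p], in the moving direction, and [c] the square of the other coordinate. *)
Definition bar (m : nat) (a c : R) (t : R) : R := (((a + t) ^+ 2 + c)^-1) ^+ m.
Definition bar1 (m : nat) (a c : R) (t : R) : R :=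
  - (2 * m%:R * (a + t) * (((a + t) ^+ 2 + c)^-1) ^+ m.+1).

Lemma is_derive_bar m (a c t : R) : (a + t) ^+ 2 + c != 0 ->
  is_derive t (1 : R) (bar m a c) (bar1 m a c t).
Proof.
move=> h0.
have h1 : is_derive t (1 : R) (fun t : R => (a + t) ^+ 2 + c) (2 * (a + t)).
  have hl : is_derive t (1 : R) (fun t : R => a + t) 1.
    have h := is_deriveD (is_derive_cst a t (1 : R)) (is_derive_id t (1 : R)).
    by apply: is_derive_eq; rewrite add0r.
  have h := is_deriveD (is_deriveX 2 hl) (is_derive_cst c t (1 : R)).
  rewrite (_ : (fun t => _) = (fun t : R => a + t) ^+ 2 + cst c).
    by apply: (is_derive_eq h); rewrite addr0 /GRing.scale /= mulr1 expr1 mulr_natl.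
  by apply/funext=> u; rewrite /= !expr2.
have h2 := is_deriveX m (@is_deriveV R (fun t : R => (a + t) ^+ 2 + c) t _ 1 h0 h1).
rewrite (_ : bar m a c = (fun y : R => ((a + y) ^+ 2 + c)^-1) ^+ m); last first.
  by apply/funext=> u; rewrite /bar; elim: (m) => [|k IH]; rewrite ?expr0 // [LHS]exprS IH [in RHS]exprS.
apply: (is_derive_eq h2); rewrite /bar1 /GRing.scale /=.
case: m {h2} => [|m] /=; first by rewrite !mulr0n !mul0r mulr0 !mul0r oppr0.
rewrite -mulr_natl; set N := (a + t) ^+ 2 + c.
by rewrite -[N ^- 2]exprVn 2!(exprS _ m.+1, exprS _ m) expr2; ring.
Qed.

Lemma is_derive_bar1 m (a c : R) : a ^+ 2 + c != 0 ->
  is_derive (0 : R) (1 : R) (bar1 m a c)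
   (4 * m%:R * m.+1%:R * a ^+ 2 * ((a ^+ 2 + c)^-1) ^+ m.+2
    - 2 * m%:R * ((a ^+ 2 + c)^-1) ^+ m.+1).
Proof.
move=> h0; have h0' : (a + 0) ^+ 2 + c != 0 by rewrite addr0.
have hl : is_derive (0 : R) (1 : R) (fun t : R => a + t) 1.
  have h := is_deriveD (is_derive_cst a (0 : R) (1 : R)) (is_derive_id (0 : R) (1 : R)).
  by apply: is_derive_eq; rewrite add0r.
have h := is_deriveN (is_deriveM (is_deriveM (is_derive_cst (2 * m%:R : R) (0 : R) (1 : R)) hl) (is_derive_bar m.+1 h0')).
apply: (is_derive_eq h).
rewrite /bar1 /bar !addr0 /GRing.scale /= mulr0 addr0 mulr1.
rewrite (exprS _ m.+1) (exprS _ m).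
have -> : (cst (2 * m%:R) * (fun t : R => a + t)) 0 = 2 * m%:R * (a + 0) by [].
ring.
Qed.

End StrongMax.

Section StrongMax.
Variable R : realType.
Local Notation C := (Cplx R).
Implicit Types (f g : C -> C) (v z p : C).

Definition lap f z : R :=
  complex.Re (dirder 1 (dirder 1 f) z) + complex.Re (dirder 'i%C (dirder 'i%C f) z).

Lemma is_derive_along v f z (t : R) : dirderivable v f (z + (t%:C)%C * v) ->
  is_derive t (1 : R) (re_along v f z) (complex.Re (dirder v f (z + (t%:C)%C * v))).
Proof.
move=> /dirderivable_has_dir[h _].
rewrite (_ : re_along v f z = re_along v f (z + (t%:C)%C * v) \o (fun s => s - t)); last first.
  apply/funext=> s; rewrite /re_along /= -addrA -mulrDl -rmorphD /=.
  by rewrite (_ : t + (s - t) = s) // addrC subrK.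
have hs : is_derive t (1 : R) (fun s : R => s - t) 1.
  have h2 := is_deriveB (is_derive_id t (1 : R)) (is_derive_cst t t (1 : R)).
  by apply: (is_derive_eq h2); rewrite subr0.
have h' : is_derive (t - t) (1 : R) (re_along v f (z + (t%:C)%C * v)) (complex.Re (dirder v f (z + (t%:C)%C * v))).
  by rewrite subrr.
have h3 := @is_derive1_comp R _ _ t _ _ h' hs.
by apply: (is_derive_eq h3); rewrite mulr1.
Qed.

Lemma second_dir_min f z v (e : R) m (a c : R) : smooth f -> disc z ->
  v = 1 \/ v = 'i%C -> a ^+ 2 + c != 0 ->
  (\forall t \near (0 : R), complex.Re (f z) - e * bar m a c 0 <=
     complex.Re (f (z + (t%:C)%C * v)) - e * bar m a c t) ->
  e * (4 * m%:R * m.+1%:R * a ^+ 2 * ((a ^+ 2 + c)^-1) ^+ m.+2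
    - 2 * m%:R * ((a ^+ 2 + c)^-1) ^+ m.+1) <=
  complex.Re (dirder v (dirder v f) z).
Proof.
move=> hf zd hv hac hmin.
rewrite -subr_ge0.
have sd : smooth (dirder v f) by move=> k; apply: Ck_dir hv (hf k.+1).
apply: (@second_deriv_min _ (fun t => re_along v f z t - e * bar m a c t)
  (fun t => re_along v (dirder v f) z t - e * bar1 m a c t)).
- have hN : \forall t \near (0 : R), (a + t) ^+ 2 + c != 0.
    have hc : (fun t : R => (a + t) ^+ 2 + c) @ (0 : R) --> a ^+ 2 + c.
      rewrite -[in X in _ --> X](addr0 a).
      apply: cvgD; last exact: cvg_cst.
      apply: (@continuous_comp _ _ _ (fun t : R => a + t) (fun x => x ^+ 2)); last exact: exprn_continuous.
      apply: cvgD; [exact: cvg_cst|exact: cvg_id].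
    exact: (cvgr_neq0 _ hc).
  have hD := near_along v (disc_nbhs zd).
  near=> t.
  have h1 : is_derive t (1 : R) (re_along v f z) (re_along v (dirder v f) z t).
    apply: is_derive_along; apply: has_dir_dirderivable.
    apply: smooth_has_dir => //; near: t; exact: hD.
  have h2 : is_derive t (1 : R) (bar m a c) (bar1 m a c t).
    by apply: is_derive_bar; near: t; exact: hN.
  have h3 := is_deriveB h1 (is_deriveZ e h2).
  exact: h3.
- have h1 : is_derive (0 : R) (1 : R) (re_along v (dirder v f) z)
     (complex.Re (dirder v (dirder v f) z)).
    by have [h _] := smooth_has_dir sd hv zd.
  have h3 := is_deriveB h1 (is_deriveZ e (is_derive_bar1 m hac)).
  exact: h3.
- by apply: filterS hmin => t; rewrite /re_along along0.
Unshelve. all: by end_near. Qed.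

Lemma n2_line1 p z (t : R) : n2 (z + (t%:C)%C * 1 - p) =
  (complex.Re (z - p) + t) ^+ 2 + complex.Im (z - p) ^+ 2.
Proof.
have -> : z + (t%:C)%C * 1 - p = (z - p) + (t%:C)%C by rewrite mulr1 addrAC.
by case: (z - p) => x y; rewrite /n2 /= addr0.
Qed.

Lemma n2_linei p z (t : R) : n2 (z + (t%:C)%C * 'i%C - p) =
  (complex.Im (z - p) + t) ^+ 2 + complex.Re (z - p) ^+ 2.
Proof.
have -> : z + (t%:C)%C * 'i%C - p = (z - p) + (t%:C)%C * 'i%C by rewrite addrAC.
by case: (z - p) => x y; rewrite /n2 /=; ring.
Qed.

(** The second derivative tests in the two axis directions are added; in the plane the Laplacian of
    |w - p|^(-2m) is 4 m^2 |w - p|^(-2m-2). *)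
Lemma lap_min f p z (e : R) m : smooth f -> disc z -> n2 (z - p) != 0 ->
  (\forall w \near z, complex.Re (f z) - e * ((n2 (z - p))^-1) ^+ m <=
     complex.Re (f w) - e * ((n2 (w - p))^-1) ^+ m) ->
  e * (4 * m%:R ^+ 2 * ((n2 (z - p))^-1) ^+ m.+1) <= lap f z.
Proof.
move=> hf zd n0 hmin.
set a := complex.Re (z - p); set b := complex.Im (z - p).
have nE : n2 (z - p) = a ^+ 2 + b ^+ 2 by [].
have nE' : n2 (z - p) = b ^+ 2 + a ^+ 2 by rewrite nE addrC.
have h1 := @second_dir_min f z 1 e m a (b ^+ 2) hf zd (or_introl erefl) n0.
have h2 := @second_dir_min f z 'i%C e m b (a ^+ 2) hf zd (or_intror erefl) ltac:(by rewrite -nE').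
have k1 := h1 ltac:(apply: filterS (near_along 1 hmin) => t; rewrite n2_line1 -/a -/b /bar addr0 -nE; exact).
have k2 := h2 ltac:(apply: filterS (near_along 'i%C hmin) => t; rewrite n2_linei -/a -/b /bar addr0 -nE'; exact).
apply: le_trans (lerD k1 k2).
rewrite -nE -nE' -mulrDr; set N := n2 (z - p).
rewrite [X in _ <= e * X](_ : _ = 4 * m%:R ^+ 2 * (N^-1) ^+ m.+1) //.
have NN : (a ^+ 2 + b ^+ 2) * N^-1 = 1 by rewrite -nE divff.
have e2 : N^-1 ^+ m.+2 = N^-1 * N^-1 ^+ m.+1 by rewrite exprS.
have -> : 4 * m%:R * m.+1%:R * a ^+ 2 * N^-1 ^+ m.+2 - 2 * m%:R * N^-1 ^+ m.+1 +
  (4 * m%:R * m.+1%:R * b ^+ 2 * N^-1 ^+ m.+2 - 2 * m%:R * N^-1 ^+ m.+1) =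
  4 * m%:R * m.+1%:R * ((a ^+ 2 + b ^+ 2) * N^-1) * N^-1 ^+ m.+1 - 4 * m%:R * N^-1 ^+ m.+1.
  by rewrite e2; ring.
by rewrite NN -natr1; ring.
Qed.

(** Hopf's barrier argument. On an annulus around [p] the barrier b = e |w - p|^(-2m) satisfies lap
    b >= c b, so f - b has no interior minimum below -B, where B is the value of b on the outer
    circle. Hence f >= b - B, which is positive inside the ball. *)
Lemma ball_max f p (K r r0 : R) : smooth f -> (forall z, disc z -> 0 <= complex.Re (f z)) ->
  0 < r -> nrm p + r <= r0 -> r0 < 1 ->
  (forall z, nrm z <= r0 -> lap f z <= K * complex.Re (f z)) ->
  0 < complex.Re (f p) -> forall z, nrm (z - p) < r -> 0 < complex.Re (f z).
Proof.
move=> hf f0 r_gt0 pr r01 hK fp z0 hz0.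
have inr z : nrm (z - p) <= r -> nrm z <= r0.
  move=> h; apply: le_trans pr; rewrite -(subrK p z) addrC; apply: le_trans (nrmD _ _) _.
  by rewrite lerD2l.
have ind z : nrm (z - p) <= r -> disc z.
  by move=> h; apply/discE; apply: le_lt_trans r01; exact: inr.
have pd : disc p by apply: ind; rewrite subrr /nrm /n2 /= expr0n addr0 sqrtr0 ltW.
pose F z : R := complex.Re (f z).
have Fc z : disc z -> {for z, continuous F}.
  move=> zd; have h := continuous_comp (Ck_cont (hf 0%N) zd) (@Re_continuous _ (f z)); exact: h.
have [s [s0 sr hs]] : exists s : R, [/\ 0 < s, s < r & forall z, nrm (z - p) <= s -> F p / 2 <= F z].
  have h : \forall z \near p, F p / 2 <= F z.
    apply: (cvgr_ge _ (Fc p pd)).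
    by rewrite ltr_pdivrMr // ltr_pMr // ltr1n.
  move/nbhs_ballP: h => [e /= e0 he].
  have [er ee] : exists er : R, e = (er%:C)%C.
    by move: e0; case: (e) => x y; rewrite ltcE /= => /andP[/eqP -> _]; exists x.
  rewrite {}ee ltcR in e0 he.
  exists (Num.min (er / 2) (r / 2)); split.
  - by rewrite lt_min !divr_gt0.
  - by rewrite gt_min orbC ltr_pdivrMr // ltr_pMr // ltr1n.
  - move=> z hz; apply: he; rewrite -ball_normE /= distrC nrmE ltcR.
    apply: le_lt_trans hz _; rewrite gt_min ltr_pdivrMr // ltr_pMr // ltr1n.
    by [].
have Fs z : nrm (z - p) <= s -> 0 < F z.
  by move=> h; apply: lt_le_trans (hs z h); rewrite divr_gt0.
(* Since [f] is nonnegative, [K] may be enlarged to a positive constant. *)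
pose c : R := Num.max K 1.
have c0 : 0 < c by rewrite lt_max ltr01 orbT.
(* This exponent ensures 4 m^2 >= c r^2, hence lap b >= c b throughout the punctured ball. *)
pose m := (Num.truncn (c * r ^+ 2)).+1.
have hm : c * r ^+ 2 <= 4 * m%:R ^+ 2.
  have h1 : c * r ^+ 2 < m%:R.
    by apply: truncnS_gt.
  apply: le_trans (ltW h1) _.
  have m1 : (1 : R) <= m%:R by rewrite ler1n.
  nra.
(* With this factor the barrier equals [F p / 2] on the inner circle, where [F] is at least that
   large. *)
pose e : R := F p / 2 * (s ^+ 2) ^+ m.
have s20 : 0 < s ^+ 2 by rewrite exprn_gt0.
have e0 : 0 < e by rewrite mulr_gt0 ?divr_gt0 // exprn_gt0.
pose A : set C := [set z | s ^+ 2 <= n2 (z - p) <= r ^+ 2].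
pose g z : R := F z - e * ((n2 (z - p))^-1) ^+ m.
have Ad z : A z -> disc z by move=> /andP[_ h]; apply: ind; rewrite -n2_le // ltW.
have An z : A z -> 0 < n2 (z - p) by move=> /andP[h _]; exact: lt_le_trans h.
have cA : compact A by apply: compact_annulus; exact: ltW.
have [hsz|hsz] := leP (nrm (z0 - p)) s; first exact: Fs.
have Az0 : A z0.
  by apply/andP; split; [rewrite leNgt n2_lt ?(ltW s0) // -leNgt ltW|rewrite n2_le ltW].
have gc : {within A, continuous g}.
  apply: continuous_in_subspaceT => z; rewrite inE => Az.
  have h1 : {for z, continuous (fun z => (n2 (z - p))^-1 ^+ m)}.
    apply: (@continuous_comp _ _ _ (fun z : C => (n2 (z - p))^-1) (fun x => x ^+ m)); last exact: exprn_continuous.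
    by have h := cvgV (lt0r_neq0 (An z Az)) (@n2_continuous _ p z); exact: h.
  have h2 := cvgB (Fc z (Ad z Az)) (cvgM (cvg_cst e) h1).
  exact: h2.
have [zm + hmin] := compact_EVT_min (ex_intro _ z0 Az0) cA gc.
rewrite inE => Azm.
pose B : R := e * ((r ^+ 2)^-1) ^+ m.
have r2 : 0 < r ^+ 2 by rewrite exprn_gt0.
(* A lower minimum can lie on neither circle, and in the open annulus the upper and lower bounds for
   [lap f] contradict each other. *)
have key : - B <= g zm.
  rewrite leNgt; apply/negP => hlt.
  have zmd := Ad _ Azm.
  have hr : n2 (zm - p) != r ^+ 2.
    apply: contraTneq hlt => h; rewrite -leNgt /g h lerBrDr addNr; exact: f0.
  have hs' : n2 (zm - p) != s ^+ 2.
    apply: contraTneq hlt => h; rewrite -leNgt /g h.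
    have -> : e * (s ^+ 2)^-1 ^+ m = F p / 2.
      by rewrite /e -mulrA -exprMn divff ?expr1n ?mulr1 // lt0r_neq0.
    have : 0 <= B by rewrite mulr_ge0 ?ltW // exprn_gt0 // invr_gt0.
    have : F p / 2 <= F zm by apply: hs; rewrite -n2_le ?(ltW s0) // h.
    by move=> h1 h2; apply: (@le_trans _ _ 0); rewrite ?oppr_le0 ?subr_ge0.
  have Ain : \forall w \near zm, A w.
    have /andP[h1 h2] : s ^+ 2 < n2 (zm - p) < r ^+ 2.
      by move: Azm => /andP[h1 h2]; rewrite !lt_neqAle h1 h2 eq_sym hs' hr.
    have k1 : \forall w \near zm, s ^+ 2 < n2 (w - p) by exact: (cvgr_gt _ (@n2_continuous R p zm)).
    have k2 : \forall w \near zm, n2 (w - p) < r ^+ 2 by exact: (cvgr_lt _ (@n2_continuous R p zm)).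
    apply: filterS2 k1 k2 => w w1 w2; apply/andP; split; exact: ltW.
  have hl := @lap_min f p zm e m hf zmd (lt0r_neq0 (An _ Azm)) ltac:(
    by apply: filterS Ain => w Aw; apply: hmin; rewrite inE).
  have hk : lap f zm <= c * F zm.
    apply: le_trans (hK zm _) _.
      by apply: inr; rewrite -n2_le ?(ltW r_gt0) //; case/andP: Azm.
    by rewrite ler_wpM2r ?f0 // le_max lexx.
  have hF : F zm < e * ((n2 (zm - p))^-1) ^+ m.
    by move: hlt; rewrite /g ltrBlDr => /lt_le_trans; apply; rewrite gerDr oppr_le0 mulr_ge0 ?ltW // exprn_gt0 // invr_gt0.
  have hbad : lap f zm < lap f zm; last by rewrite ltxx in hbad.
  apply: le_lt_trans hk _; apply: lt_le_trans hl.
  have : c * F zm < c * (e * ((n2 (zm - p))^-1) ^+ m) by rewrite ltr_pM2l.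
  move/lt_le_trans; apply.
  rewrite mulrCA ler_pM2l // (exprS _ m) mulrA ler_pM2r; last by rewrite exprn_gt0 // invr_gt0 An.
  rewrite ler_pdivlMr ?An //; apply: le_trans hm.
  by rewrite ler_pM2l //; case/andP: Azm.
have : - B <= g z0 by apply: le_trans key _; apply: hmin; rewrite inE.
rewrite /g lerBrDr => /(lt_le_trans _); apply.
rewrite addrC subr_gt0 /B ltr_pM2l //.
have m0 : (0 < m)%N by [].
rewrite ltr_pXn2r // ?nnegrE ?invr_ge0 ?(ltW r2) ?(ltW (An _ Az0)) //.
by rewrite ltf_pV2 ?posrE ?An // n2_lt // ltW.
Qed.

Lemma strong_max f z0 : smooth f -> (forall z, disc z -> 0 <= complex.Re (f z)) ->
  (forall r : R, r < 1 -> exists K, forall z, nrm z <= r -> lap f z <= K * complex.Re (f z)) ->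
  disc z0 -> complex.Re (f z0) = 0 -> forall z, disc z -> complex.Re (f z) = 0.
Proof.
move=> hf f0 hK zd fz0 p pd; apply/eqP; rewrite eq_le f0 // andbT leNgt; apply/negP => fp.
pose mx : R := Num.max (nrm p) (nrm z0).
have mx1 : mx < 1 by rewrite gt_max; apply/andP; split; exact/discE.
(* Balls of radius [r] centred on the segment from [p] to [z0] stay within radius [mx + r < 1], so
   that one constant [K] serves for all of them. *)
pose r : R := (1 - mx) / 2.
have r_gt0 : 0 < r by rewrite divr_gt0 // subr_gt0.
have r01 : mx + r < 1 by rewrite /r; lra.
have [K {}hK] := hK _ r01.
(* Enough equal steps to make consecutive points of the segment less than [r] apart, so that
   positivity spreads from [p] to [z0]. *)
pose N := (Num.truncn (nrm (z0 - p) / r)).+1.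
have hN : nrm (z0 - p) / N%:R < r.
  by rewrite ltr_pdivrMr // mulrC -ltr_pdivrMr //; exact: truncnS_gt.
pose q (i : nat) : C := p + ((i%:R / N%:R)%:C)%C * (z0 - p).
have nrmZ (t : R) (w : C) : 0 <= t -> nrm ((t%:C)%C * w) = t * nrm w.
  move=> t0; have : `|(t%:C)%C * w| = ((t * nrm w)%:C)%C.
    by rewrite normrM !nrmE -rmorphM /=; congr ((_ * _)%:C)%C; rewrite /nrm /n2 /= expr0n addr0 sqrtr_sqr ger0_norm.
  by rewrite nrmE => /complexI.
have hq i : (i <= N)%N -> 0 < complex.Re (f (q i)).
  elim: i => [|i IH] hi; first by rewrite /q mul0r mul0r addr0.
  have iN : (i <= N)%N by exact: ltnW.
  have t0 : (0 : R) <= i%:R / N%:R by rewrite divr_ge0.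
  have t1 : 0 <= 1 - (i%:R / N%:R) :> R by rewrite subr_ge0 ler_pdivrMr // mul1r ler_nat.
  have qi : nrm (q i) <= mx.
    have -> : q i = ((1 - i%:R / N%:R)%:C)%C * p + ((i%:R / N%:R)%:C)%C * z0.
      by rewrite /q rmorphB rmorph1; ring.
    apply: le_trans (nrmD _ _) _; rewrite !nrmZ //.
    have h1 : nrm p <= mx by rewrite le_max lexx.
    have h2 : nrm z0 <= mx by rewrite le_max lexx orbT.
    nra.
  apply: (@ball_max f (q i) K r (mx + r)) => //; first by rewrite lerD2r.
    exact: IH.
  have -> : q i.+1 - q i = ((N%:R^-1)%:C)%C * (z0 - p).
    rewrite /q -natr1 mulrDl mul1r rmorphD /=; ring.
  by rewrite nrmZ ?invr_ge0 // mulrC.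
have := hq N (leqnn N).
by rewrite /q divff ?pnatr_eq0 // mul1r addrC subrK fz0 ltxx.
Qed.

Lemma dirder_real f v z : disc z -> (forall w, disc w -> complex.Im (f w) = 0) ->
  complex.Im (dirder v f z) = 0.
Proof.
move=> zd fr; rewrite /dirder /=.
have h : is_derive (0 : R) (1 : R) (im_along v f z) 0.
  apply: (near_eq_is_derive _ (is_derive_cst (0 : R) (0 : R) (1 : R))).
  by apply: filterS (near_along v (disc_nbhs zd)) => t /fr h0; rewrite /im_along h0.
by rewrite derive1E (@derive_val _ _ _ _ _ _ _ h).
Qed.

(** The symmetry of mixed derivatives is avoided: for real [f] both mixed derivatives are real and
    enter with a factor ['i], so the real part drops them. *)
Lemma Re_dop_dop f z : smooth f -> disc z -> (forall w, disc w -> complex.Im (f w) = 0) ->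
  4 * complex.Re (dop 'i%C (dop (- 'i%C) f) z) = lap f z.
Proof.
move=> hf zd fr.
have s1 : smooth (dirder 1 f) by move=> k; apply: Ck_dir (hf k.+1); left.
have s2 : smooth (dirder 'i%C f) by move=> k; apply: Ck_dir (hf k.+1); right.
have r1 w : disc w -> complex.Im (dirder 1 f w) = 0 by move=> wd; apply: dirder_real.
have r2 w : disc w -> complex.Im (dirder 'i%C f w) = 0 by move=> wd; apply: dirder_real.
have e : dop 'i%C (dop (- 'i%C) f) z =
  (dop 'i%C (dirder 1 f) z - 'i%C * dop 'i%C (dirder 'i%C f) z) / 2.
  rewrite (@eq_dop _ _ _ (fun w => 2^-1 * (dirder 1 f w + - 'i%C * dirder 'i%C f w))) //.
  - have si : smooth (fun w : C => - 'i%C * dirder 'i%C f w).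
      by apply: smoothM => //; exact: smooth_cst.
    rewrite dopM //; [|exact: smooth_cst|exact: smoothD].
    rewrite dop_cst mul0r add0r dopD // dopM //; last exact: smooth_cst.
    by rewrite dop_cst mul0r add0r mulrC mulNr.
  - exact: smooth_dop.
  - by move=> w _; rewrite dop.unlock mulrC.
rewrite e dop.unlock.
have h2 : (2^-1 : C) = ((2^-1 : R)%:C)%C by rewrite fmorphV rmorph_nat.
move: (dirder_real 'i%C zd r1) (dirder_real 1 zd r2) (dirder_real 1 zd r1) (dirder_real 'i%C zd r2).
rewrite /lap h2; case: (dirder 'i%C (dirder 1 f) z) => a1 b1; case: (dirder 1 (dirder 'i%C f) z) => a2 b2.
case: (dirder 1 (dirder 1 f) z) => a3 b3; case: (dirder 'i%C (dirder 'i%C f) z) => a4 b4 /= -> -> -> ->.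
by field.
Qed.

End StrongMax.

(** * Matrix-valued functions *)

HB.lock Definition mdop (R : realType) (s : Cplx R) (m n : nat)
    (A : Cplx R -> 'M[Cplx R]_(m, n)) (z : Cplx R) : 'M[Cplx R]_(m, n) :=
  \matrix_(i, j) dop s (fun w => A w i j) z.

Section MatrixCalculus.
Variable R : realType.
Local Notation C := (Cplx R).
Implicit Types (z s t : C).

Definition msmooth m n (A : C -> 'M[C]_(m, n)) := forall i j, smooth (fun z => A z i j).
Lemma mdopE s m n (A : C -> 'M[C]_(m, n)) z i j : mdop s A z i j = dop s (fun w => A w i j) z.
Proof. by rewrite mdop.unlock mxE. Qed.

Lemma eq_mdop s m n (A B : C -> 'M[C]_(m, n)) z : msmooth A -> disc z ->
  (forall z, disc z -> A z = B z) -> mdop s A z = mdop s B z.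
Proof.
move=> hA zd AB; apply/matrixP=> i j; rewrite !(mdopE, mxE); apply: eq_dop => // w wd.
by rewrite AB.
Qed.

Lemma msmooth_cst m n (A : 'M[C]_(m, n)) : msmooth (fun=> A).
Proof. by move=> i j; exact: smooth_cst. Qed.

Lemma mdop_cst s m n (A : 'M[C]_(m, n)) z : mdop s (fun=> A) z = 0.
Proof. by apply/matrixP=> i j; rewrite !(mdopE, mxE) dop_cst. Qed.

Lemma msmoothM m n p (A : C -> 'M[C]_(m, n)) (B : C -> 'M[C]_(n, p)) :
  msmooth A -> msmooth B -> msmooth (fun z => A z *m B z).
Proof.
move=> hA hB i j.
apply: (@smooth_ext _ (fun z => \sum_k A z i k * B z k j)) => [z _|]; first by rewrite mxE.
by apply: smooth_sum => k; exact: smoothM.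
Qed.

Lemma mdopM s m n p (A : C -> 'M[C]_(m, n)) (B : C -> 'M[C]_(n, p)) z :
  msmooth A -> msmooth B -> disc z ->
  mdop s (fun z => A z *m B z) z = mdop s A z *m B z + A z *m mdop s B z.
Proof.
move=> hA hB zd; apply/matrixP=> i j; rewrite !(mdopE, mxE).
rewrite (@eq_dop _ _ _ (fun z => \sum_k A z i k * B z k j)) //; last first.
- by move=> w _; rewrite mxE.
- exact: msmoothM.
rewrite dop_sum //; last by move=> k; exact: smoothM.
by rewrite -big_split /=; apply: eq_bigr => k _; rewrite dopM // !mdopE.
Qed.

Lemma msmooth_tr m n (A : C -> 'M[C]_(m, n)) : msmooth A -> msmooth (fun z => (A z)^T).
Proof. by move=> hA i j; apply: smooth_ext (hA j i) => z _; rewrite mxE. Qed.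

Lemma mdop_tr s m n (A : C -> 'M[C]_(m, n)) z : msmooth A -> disc z ->
  mdop s (fun z => (A z)^T) z = (mdop s A z)^T.
Proof.
move=> hA zd; apply/matrixP=> i j; rewrite !(mdopE, mxE); apply: eq_dop => //.
  exact: msmooth_tr.
by move=> w _; rewrite mxE.
Qed.

Lemma msmooth_conj m n (A : C -> 'M[C]_(m, n)) : msmooth A -> msmooth (fun z => conjmx (A z)).
Proof.
by move=> hA i j; apply: smooth_ext (smooth_conj (hA i j)) => z _; rewrite mxE.
Qed.

Lemma mdop_conj s m n (A : C -> 'M[C]_(m, n)) z : msmooth A -> disc z ->
  mdop s (fun z => conjmx (A z)) z = conjmx (mdop (s^*)%C A z).
Proof.
move=> hA zd; apply/matrixP=> i j; rewrite !(mdopE, mxE) -dop_conj //; apply: eq_dop => //.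
  exact: msmooth_conj.
by move=> w _; rewrite mxE.
Qed.

Lemma msmooth_mdop s m n (A : C -> 'M[C]_(m, n)) : msmooth A -> msmooth (mdop s A).
Proof.
by move=> hA i j; apply: smooth_ext (smooth_dop s (hA i j)) => z _; rewrite mdopE.
Qed.

Lemma smooth_mxtrace n (A : C -> 'M[C]_n) : msmooth A -> smooth (fun z => \tr (A z)).
Proof. by move=> hA; exact: smooth_sum. Qed.

Lemma dop_mxtrace s n (A : C -> 'M[C]_n) z : msmooth A -> disc z ->
  dop s (fun z => \tr (A z)) z = \tr (mdop s A z).
Proof.
by move=> hA zd; rewrite dop_sum //; apply: eq_bigr => i _; rewrite mdopE.
Qed.

Lemma smooth_det n (A : C -> 'M[C]_n) : msmooth A -> smooth (fun z => \det (A z)).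
Proof.
move=> hA; apply: smooth_sum => p; apply: smoothM; first exact: smooth_cst.
by apply: smooth_prod => i; exact: hA.
Qed.

(** Jacobi's formula: the product rule in the Leibniz expansion, grouped by the differentiated row;
    [B i] is [A z] with row [i] replaced by its derivative. *)
Lemma dop_det s n (A : C -> 'M[C]_n) z : msmooth A -> disc z ->
  dop s (fun z => \det (A z)) z = \tr (\adj (A z) *m mdop s A z).
Proof.
move=> hA zd.
rewrite dop_sum //; last first.
  move=> p; apply: smoothM; first exact: smooth_cst.
  by apply: smooth_prod => i; exact: hA.
pose B i := \matrix_(k, l) (if k == i then dop s (fun w => A w k l) z else A z k l).
have hB i : \det (B i) = \sum_j dop s (fun w => A w i j) z * cofactor (A z) i j.
  rewrite (expand_det_row _ i); apply: eq_bigr => j _; rewrite mxE eqxx; congr (_ * _).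
  rewrite /cofactor; congr (_ * \det _); apply/matrixP=> k l; rewrite !(mdopE, mxE).
  by rewrite eq_sym (negbTE (neq_lift _ _)).
transitivity (\sum_i \det (B i)).
  rewrite exchange_big /=; apply: eq_bigr => p _.
  rewrite dopM //; [|exact: smooth_cst|by apply: smooth_prod => i; exact: hA].
  rewrite dop_cst mul0r add0r dop_prod // mulr_sumr; apply: eq_bigr => i _.
  congr (_ * _); rewrite [RHS](bigD1 i) //= mxE eqxx; congr (_ * _).
  by apply: eq_bigr => j ji; rewrite mxE (negbTE ji).
rewrite mxtrace_mulC; apply: eq_bigr => i _; rewrite hB mxE; apply: eq_bigr => j _.
by rewrite mxE mdopE.
Qed.

Lemma msmoothV n (A : C -> 'M[C]_n) : msmooth A -> (forall z, disc z -> A z \in unitmx) ->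
  msmooth (fun z => invmx (A z)).
Proof.
move=> hA uA i j.
apply: (@smooth_ext _ (fun z => (\det (A z))^-1 * cofactor (A z) j i)) => [z zd|].
  by rewrite /invmx uA // !mxE.
apply: smoothM.
  apply: smoothV; last exact: smooth_det.
  by move=> z zd; have := uA z zd; rewrite unitmxE unitfE.
apply: smoothM; first exact: smooth_cst.
apply: smooth_det => k l.
by apply: smooth_ext (hA (lift j k) (lift i l)) => z _; rewrite !(mdopE, mxE).
Qed.

Lemma mdopV s n (A : C -> 'M[C]_n) z : msmooth A -> (forall z, disc z -> A z \in unitmx) ->
  disc z -> mdop s (fun z => invmx (A z)) z = - (invmx (A z) *m mdop s A z *m invmx (A z)).
Proof.
move=> hA uA zd; have hV := msmoothV hA uA.
have h : mdop s (fun z => invmx (A z) *m A z) z = 0.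
  rewrite (@eq_mdop _ _ _ _ (fun=> 1%:M)) ?mdop_cst //.
    exact: msmoothM.
  by move=> w wd; rewrite mulVmx // uA.
rewrite mdopM // in h; have {h} := congr1 (mulmxr (invmx (A z))) h.
rewrite /= mul0mx mulmxDl -[X in X + _]mulmxA mulmxV ?uA // mulmx1 => /eqP.
by rewrite addr_eq0 => /eqP.
Qed.

Lemma dop_det_unit s n (A : C -> 'M[C]_n) z : msmooth A -> disc z -> A z \in unitmx ->
  dop s (fun z => \det (A z)) z = \det (A z) * \tr (invmx (A z) *m mdop s A z).
Proof.
move=> hA zd uA; rewrite dop_det // /invmx uA -scalemxAl mxtraceZ mulrA divff ?mul1r //.
Qed.

(** The second logarithmic derivative of a determinant, multiplied by its square so that no
    logarithm appears. *)
Lemma log_laplacian_det s t n (A : C -> 'M[C]_n) z : msmooth A ->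
  (forall z, disc z -> A z \in unitmx) -> disc z ->
  let D z := \det (A z) in
  D z * dop t (dop s D) z - dop t D z * dop s D z =
  D z ^+ 2 * (\tr (invmx (A z) *m mdop t (mdop s A) z)
     - \tr (invmx (A z) *m mdop t A z *m invmx (A z) *m mdop s A z)).
Proof.
move=> hA uA zd D; have hV := msmoothV hA uA.
have hD : smooth D by exact: smooth_det.
have hd := msmooth_mdop s hA.
have hm := msmoothM hV hd.
rewrite (@eq_dop _ t (dop s D) (fun z => D z * \tr (invmx (A z) *m mdop s A z)) z) //;
  [|exact: smooth_dop|by move=> w wd; rewrite dop_det_unit ?uA].
rewrite dopM //; last exact: smooth_mxtrace.
rewrite dop_mxtrace // mdopM // mdopV // mxtraceD mulNmx raddfN /=.
rewrite [dop s D z]dop_det_unit ?uA // -/(D z).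
have H (d d' x y w : C) : d * (d' * x + d * (- y + w)) - d' * (d * x) = d ^+ 2 * (w - y).
  by ring.
exact: H.
Qed.

End MatrixCalculus.

(** * Leading minors and unitriangular frames *)

Section ConjField.
Variables (F : numFieldType) (cj : {rmorphism F -> F}).
Hypothesis cjN2 : forall x, x * cj x = `|x| ^+ 2.
Local Notation conjmx A := (map_mx cj A).

Lemma cj_pos (x : F) : 0 < x -> cj x = x.
Proof.
move=> x0; apply: (mulfI (lt0r_neq0 x0)).
by rewrite cjN2 gtr0_norm // expr2.
Qed.
(** Applying [cj] to the norm identity gives [cj x * cj (cj x) = |x|^2], as positive elements are
    fixed; cancelling [cj x] yields the claim. *)
Lemma cjK : involutive cj.
Proof.
move=> x; have [->|x0] := eqVneq x 0; first by rewrite !rmorph0.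
have cx0 : cj x != 0 by rewrite fmorph_eq0.
apply: (mulfI cx0); rewrite cjN2 mulrC cjN2.
have := congr1 cj (cjN2 x); rewrite rmorphM cjN2 => ->.
by rewrite cj_pos // exprn_gt0 // normr_gt0.
Qed.
Lemma cjmxK m n (A : 'M[F]_(m, n)) : conjmx (conjmx A) = A.
Proof. by apply/matrixP=> i j; rewrite !mxE cjK. Qed.
Lemma addmxT m p (A B : 'M[F]_(m, p)) : (A + B)^T = A^T + B^T.
Proof. by apply/matrixP=> i j; rewrite !mxE. Qed.
Lemma oppmxT m p (A : 'M[F]_(m, p)) : (- A)^T = - A^T.
Proof. by apply/matrixP=> i j; rewrite !mxE. Qed.

Definition unitri n (N : 'M[F]_n) :=
  (forall i j : 'I_n, (j < i)%N -> N i j = 0) /\ (forall i, N i i = 1).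
Definition posdef n (H : 'M[F]_n) := conjmx H^T = H /\
  forall u : 'cV[F]_n, u != 0 -> 0 < (u^T *m H *m conjmx u) 0 0.

(** Gram-Schmidt along the filtration, by induction on the size: [E] clears the first row and
    column, and the Schur complement [S] is again positive definite. *)
Lemma LDL n (H : 'M[F]_n) : posdef H ->
  exists N (d : 'rV[F]_n), [/\ unitri N, N^T *m H *m conjmx N = diag_mx d & forall p, 0 < d 0 p].
Proof.
elim: n H => [|m IH] H [Hh Hp].
  exists 1%:M, 0; split; last by case.
    by split; case.
  by apply/matrixP; case.
have Hij i j : H j i = cj (H i j) by rewrite -{1}Hh !mxE.
change 'M[F]_(1 + m) in H.
pose a := ulsubmx H 0 0; pose b := ursubmx H; pose H' := drsubmx H.
have eH : H = block_mx a%:M b (conjmx b)^T H'.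
  rewrite -[LHS]submxK; congr block_mx.
    by apply/matrixP=> i j; rewrite !ord1 [RHS]mxE eqxx.
  by apply/matrixP=> i j; rewrite !mxE [LHS]Hij.
have a0 : 0 < a.
  have e0 : (delta_mx 0 0 : 'cV[F]_(1 + m)) != 0.
    by apply/eqP => /matrixP/(_ 0 0); rewrite !mxE /= => /eqP; rewrite oner_eq0.
  have := Hp _ e0.
  have -> : (delta_mx 0 0 : 'cV[F]_(1 + m))^T *m H = row 0 H by rewrite trmx_delta rowE.
  rewrite mxE (bigD1 0) //= big1 => [|j j0]; rewrite !mxE.
    by rewrite !eqxx rmorph_nat mulr1 addr0 /a !mxE; congr (0 < H _ _); apply/val_inj.
  by rewrite (negbTE j0) rmorph_nat mulr0.
have ha : H'^T = conjmx H'.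
  by apply/matrixP=> i j; rewrite !mxE [LHS]Hij.
clearbody a b H'.
pose x : 'rV[F]_m := - (a^-1 *: conjmx b).
have cx : conjmx x = - (a^-1 *: b).
  by rewrite /x map_mxN map_mxZ cjmxK fmorphV cj_pos.
pose E : 'M[F]_(1 + m) := block_mx 1%:M x 0 1%:M.
pose S := H' - a^-1 *: ((conjmx b)^T *m b).
have a0' : a != 0 by exact: lt0r_neq0.
have xT : x^T *m a%:M = - (conjmx b)^T.
  by rewrite mul_mx_scalar linearN /= linearZ /= scalerN scalerA divff // scale1r.
have xb : x^T *m b = - (a^-1 *: ((conjmx b)^T *m b)).
  by rewrite linearN /= linearZ /= mulNmx -scalemxAl.
have ax : a%:M *m conjmx x = - b.
  by rewrite cx mul_scalar_mx scalerN scalerA divff // scale1r.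
have eE : E^T *m H *m conjmx E = block_mx a%:M 0 0 S.
  have -> : conjmx E = block_mx 1%:M (conjmx x) 0 1%:M.
    by rewrite map_block_mx !map_mx1 map_mx0.
  rewrite /E eH tr_block_mx !trmx1 trmx0 mulmx_block.
  rewrite !mul1mx !mul0mx !addr0 xT addNr mulmx_block !mulmx1 !mulmx0 !addr0 mul0mx add0r.
  by rewrite ax addNr xb /S addrC.
have Eu : E \in unitmx by rewrite unitmxE det_ublock !det1 mulr1 unitr1.
have Sp : posdef S.
  split.
    rewrite /S linearB /= linearZ /= trmx_mul trmxK ha /=.
    by rewrite map_mxD map_mxN map_mxZ map_mxM map_trmx !cjmxK fmorphV cj_pos.
  move=> u u0; pose w : 'cV[F]_(1 + m) := E *m col_mx 0 u.
  have w0 : w != 0.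
    apply: contra u0 => /eqP w0; have := congr1 (mulmx (invmx E)) w0.
    by rewrite mulKmx // mulmx0 => /(congr1 dsubmx); rewrite col_mxKd => ->; rewrite linear0.
  have := Hp w w0; rewrite /w trmx_mul map_mxM !mulmxA.
  rewrite -(mulmxA _ E^T) -(mulmxA _ (E^T *m H)) eE.
  have -> : conjmx (col_mx 0 u : 'cV[F]_(1 + m)) = col_mx 0 (conjmx u).
    by rewrite map_col_mx map_mx0.
  rewrite tr_col_mx mul_row_block trmx0 !mul0mx !mulmx0 !add0r mul_row_col mulmx0 add0r.
  by [].
have [N' [d' [[N0 N1] Nd d0]]] := IH S Sp.
exists (E *m block_mx 1%:M 0 0 N'), (row_mx a%:M d'); split.
- have -> : E *m block_mx 1%:M 0 0 N' = block_mx 1%:M (x *m N') 0 N'.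
    by rewrite mulmx_block !mulmx0 !mul0mx !mulmx1 !mul1mx !addr0 !add0r.
  split=> [i j|i].
    have [i' ->|i' ->] := @split_ordP 1 m i; have [j' ->|j' ->] := @split_ordP 1 m j.
    + by rewrite !ord1.
    + by rewrite !ord1.
    + by move=> _; rewrite [LHS](@block_mxEdl _ 1 m 1 m) mxE.
    + by rewrite (@block_mxEdr _ 1 m 1 m) /= !add1n ltnS => /N0.
  have [i' ->|i' ->] := @split_ordP 1 m i.
    by rewrite (@block_mxEul _ 1 m 1 m) !ord1 mxE eqxx.
  by rewrite (@block_mxEdr _ 1 m 1 m).
- rewrite map_mxM trmx_mul !mulmxA -(mulmxA _ E^T) -(mulmxA _ (E^T *m H)) eE.
  have -> : conjmx (block_mx 1%:M 0 0 N' : 'M[F]_(1 + m)) = block_mx 1%:M 0 0 (conjmx N').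
    by rewrite map_block_mx map_mx1 !map_mx0.
  have -> : (block_mx 1%:M 0 0 N' : 'M[F]_(1 + m))^T = block_mx 1%:M 0 0 N'^T.
    by rewrite tr_block_mx trmx1 !trmx0.
  have -> : diag_mx (row_mx a%:M d') = block_mx (diag_mx a%:M) 0 0 (diag_mx d').
    exact: diag_mx_row.
  change (block_mx 1%:M 0 0 N'^T *m block_mx a%:M 0 0 S *m block_mx 1%:M 0 0 (conjmx N') = block_mx (diag_mx a%:M) 0 0 (diag_mx d') :> 'M[F]_(1 + m)).
  rewrite !mulmx_block !mulmx0 !mul0mx !mulmx1 !mul1mx !addr0 !add0r !mul0mx Nd ?mulmx0; congr block_mx.
  by apply/matrixP=> i j; rewrite !ord1 !mxE eqxx.
- move=> p; have [p' ->|p' ->] := @split_ordP 1 m p.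
    by rewrite (@row_mxEl _ 1 1 m) ord1 mxE eqxx.
  by rewrite (@row_mxEr _ 1 1 m).
Qed.

Section Frames.
Variable n : nat.
Implicit Types (N H A B M X Y Z U : 'M[F]_n) (d : 'rV[F]_n).

Definition headmx (k : nat) : 'M[F]_n := diag_mx (\row_i (i < k)%:R).
(** The leading block padded by the identity: its determinant is the leading minor, while all [k]
    share one matrix type. *)
Definition trunc (k : nat) A : 'M[F]_n := headmx k *m A *m headmx k + (1%:M - headmx k).

Lemma headmxK k : headmx k *m headmx k = headmx k.
Proof.
rewrite /headmx mulmx_diag; congr diag_mx; apply/rowP=> i; rewrite !mxE.
by case: ltnP; rewrite ?mulr1 ?mulr0.
Qed.

Lemma headmx_compl k : headmx k *m (1%:M - headmx k) = 0.
Proof. by rewrite mulmxBr mulmx1 headmxK subrr. Qed.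
Lemma compl_headmx k : (1%:M - headmx k) *m headmx k = 0.
Proof. by rewrite mulmxBl mul1mx headmxK subrr. Qed.
Lemma complK k : (1%:M - headmx k) *m (1%:M - headmx k) = 1%:M - headmx k.
Proof. by rewrite mulmxBl mul1mx headmx_compl subr0. Qed.
Lemma headmxT k : (headmx k)^T = headmx k. Proof. exact: tr_diag_mx. Qed.
Lemma headmx_conj k : conjmx (headmx k) = headmx k.
Proof.
rewrite /headmx map_diag_mx; congr diag_mx; apply/rowP=> i; rewrite !mxE.
by rewrite rmorph_nat.
Qed.

Lemma headmxE k A i j : (headmx k *m A) i j = (i < k)%:R * A i j.
Proof. by rewrite mul_diag_mx !mxE. Qed.
Lemma mulheadE k A i j : (A *m headmx k) i j = A i j * (j < k)%:R.
Proof. by rewrite mul_mx_diag !mxE. Qed.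

Lemma truncE k A i j :
  trunc k A i j = if (i < k)%N && (j < k)%N then A i j else (i == j)%:R.
Proof.
rewrite mxE mulheadE headmxE !mxE.
case: (ltnP i k) => ik; case: (ltnP j k) => jk /=; rewrite ?mul1r ?mulr1 ?mul0r ?mulr0 ?add0r.
- by case: eqP => _; rewrite ?subrr ?addr0 // ?mulr1n ?mulr0n ?subrr ?addr0 // subr0 addr0.
- case: eqP => [e|_]; last by rewrite mulr0n subr0.
  by move: ik jk; rewrite e ltnNge => /negP.
- by rewrite mul0rn subr0.
- by rewrite mul0rn subr0.
Qed.

Lemma unitri_head k N : unitri N -> N *m headmx k = headmx k *m N *m headmx k.
Proof.
move=> [N0 _]; apply/matrixP=> i j; rewrite !mulheadE headmxE.
case: (ltnP j k) => jk; rewrite ?mulr0 // !mulr1.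
case: (ltnP i k) => ik; rewrite ?mul1r // mul0r N0 //.
exact: leq_trans ik.
Qed.

Lemma block_congr (P Q X H Y : 'M[F]_n) : P *m Q = 0 -> Q *m P = 0 -> Q *m Q = Q ->
  X *m P = X -> P *m Y = Y ->
  (X + Q) *m (P *m H *m P + Q) *m (Y + Q) = X *m H *m Y + Q.
Proof.
move=> PQ QP QQ XP PY.
have XQ : X *m Q = 0 by rewrite -XP -mulmxA PQ mulmx0.
have QY : Q *m Y = 0 by rewrite -PY mulmxA QP mul0mx.
have e1 : (X + Q) *m (P *m H *m P + Q) = X *m H *m P + Q.
  by rewrite mulmxDr [X in X + _]mulmxDl [X in _ + X]mulmxDl !mulmxA XP XQ QP QQ !mul0mx addr0 add0r.
by rewrite e1 mulmxDr [X in X + _]mulmxDl [X in _ + X]mulmxDl -(mulmxA _ P Y) PY -(mulmxA _ P Q) PQ QY QQ mulmx0 addr0 add0r.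
Qed.

(** Upper unitriangular matrices preserve the span of the first [k] basis vectors, so congruence by
    them commutes with truncation. *)
Lemma trunc_congr k N H : unitri N ->
  (trunc k N)^T *m trunc k H *m conjmx (trunc k N) = trunc k (N^T *m H *m conjmx N).
Proof.
move=> hN.
have PN : headmx k *m N *m headmx k = N *m headmx k by rewrite -unitri_head.
have hNP : trunc k N = N *m headmx k + (1%:M - headmx k) by rewrite /trunc PN.
have cNP : conjmx (trunc k N) = conjmx N *m headmx k + (1%:M - headmx k).
  by rewrite hNP map_mxD map_mxM headmx_conj map_mxD map_mxN map_mx1 headmx_conj.
have tNP : (trunc k N)^T = headmx k *m N^T + (1%:M - headmx k).
  by rewrite hNP addmxT trmx_mul headmxT addmxT oppmxT trmx1 headmxT.
have PNt : headmx k *m N^T *m headmx k = headmx k *m N^T.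
  by have := congr1 trmx PN; rewrite !trmx_mul headmxT mulmxA.
have cPN : headmx k *m (conjmx N *m headmx k) = conjmx N *m headmx k.
  by have := congr1 (fun A : 'M[F]_n => conjmx A) PN; rewrite !map_mxM headmx_conj mulmxA.
rewrite tNP cNP /trunc.
rewrite (block_congr H (headmx_compl k) (compl_headmx k) (complK k) PNt cPN).
by rewrite !mulmxA.
Qed.

Lemma det_trunc_unitri k N : unitri N -> \det (trunc k N) = 1.
Proof.
move=> [N0 N1]; rewrite -det_tr det_trig.
  by rewrite big1 // => i _; rewrite mxE truncE eqxx N1; case: ifP.
apply/is_trig_mxP => i j ij; rewrite mxE truncE N0 //.
by rewrite (_ : (j == i) = false) ?if_same //; apply/negbTE; rewrite eq_sym; apply: contraTneq ij => ->; rewrite ltnn.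
Qed.

Lemma det_unitri N : unitri N -> \det N = 1.
Proof.
move=> [N0 N1]; rewrite -det_tr det_trig.
  by rewrite big1 // => i _; rewrite mxE N1.
by apply/is_trig_mxP => i j ij; rewrite mxE N0.
Qed.

Lemma unitri_unit N : unitri N -> N \in unitmx.
Proof. by move=> h; rewrite unitmxE det_unitri // unitr1. Qed.

Lemma trunc_diag k d : trunc k (diag_mx d) = diag_mx (\row_i (if (i < k)%N then d 0 i else 1)).
Proof.
apply/matrixP=> i j; rewrite truncE !mxE.
by case: eqP => [<-|_]; [rewrite andbb; case: ifP|rewrite !mulr0n if_same].
Qed.

Lemma det_trunc_diag k d : \det (trunc k (diag_mx d)) = \prod_(p : 'I_n | (p < k)%N) d 0 p.
Proof.
rewrite trunc_diag det_diag [RHS]big_mkcond; apply: eq_bigr => i _.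
by rewrite mxE.
Qed.

Lemma det_trunc k N H d : unitri N -> N^T *m H *m conjmx N = diag_mx d ->
  \det (trunc k H) = \prod_(p : 'I_n | (p < k)%N) d 0 p.
Proof.
move=> hN hd; rewrite -det_trunc_diag -hd -trunc_congr // !det_mulmx det_tr det_map_mx.
by rewrite (det_trunc_unitri k hN) mul1r rmorph1 mulr1.
Qed.

Section Fixed.
Variables (H N : 'M[F]_n) (d : 'rV[F]_n).
Hypotheses (hN : unitri N) (hd : N^T *m H *m conjmx N = diag_mx d) (d0 : forall p, 0 < d 0 p).

Let dn p : d 0 p != 0. Proof. exact: lt0r_neq0. Qed.

Lemma trunc_unit k : trunc k H \in unitmx.
Proof.
rewrite unitmxE (det_trunc k hN hd) unitfE; apply/prodf_neq0 => p _; exact: dn.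
Qed.

Lemma det_trunc_gt0 k : 0 < \det (trunc k H).
Proof. by rewrite (det_trunc k hN hd) prodr_gt0. Qed.

Definition dinv : 'rV[F]_n := \row_i (d 0 i)^-1.

(** The inverse of the leading block, read in the diagonalising frame; the outer factors [headmx k]
    remove the padding. *)
Lemma head_inv_trunc k : headmx k *m invmx (trunc k H) *m headmx k =
  conjmx N *m (headmx k *m diag_mx dinv) *m N^T.
Proof.
pose T := trunc k N; pose e : 'rV[F]_n := \row_i (if (i < k)%N then (d 0 i)^-1 else 1).
have Tu : T \in unitmx by rewrite unitmxE det_trunc_unitri // unitr1.
have cTu : conjmx T \in unitmx by rewrite map_unitmx.
have hV : invmx (trunc k H) = conjmx T *m diag_mx e *m T^T.
  have h : (conjmx T *m diag_mx e *m T^T) *m trunc k H = 1%:M.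
    have hT : T^T *m trunc k H *m conjmx T = trunc k (diag_mx d) by rewrite trunc_congr // hd.
    rewrite -[LHS](mulmxK cTu).
    have -> : conjmx T *m diag_mx e *m T^T *m trunc k H *m conjmx T =
        conjmx T *m (diag_mx e *m (T^T *m trunc k H *m conjmx T)) by rewrite !mulmxA.
    rewrite hT trunc_diag mulmx_diag (_ : diag_mx _ = 1%:M) ?mulmx1 ?mulmxV //.
    rewrite -diag_const_mx; congr diag_mx; apply/rowP=> i; rewrite !mxE.
    by case: ltnP => _; rewrite ?mulr1 // mulVf.
  by rewrite -[LHS]mul1mx -h mulmxK // trunc_unit.
rewrite hV.
have PT : headmx k *m T = N *m headmx k.
  by rewrite /T /trunc mulmxDr headmx_compl addr0 !mulmxA headmxK -unitri_head.
have PcT : headmx k *m conjmx T = conjmx N *m headmx k.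
  by rewrite -[in LHS](headmx_conj k) -map_mxM PT map_mxM headmx_conj.
have TP : T^T *m headmx k = headmx k *m N^T.
  by rewrite -[in LHS](headmxT k) -trmx_mul PT trmx_mul headmxT.
rewrite !mulmxA PcT -!mulmxA TP !mulmxA; congr (_ *m _); rewrite -!mulmxA; congr (_ *m _).
rewrite /headmx !mulmx_diag; congr diag_mx; apply/rowP=> i; rewrite !mxE.
by case: ltnP => _; rewrite ?mul1r ?mulr1 // !mul0r.
Qed.

Definition frame X := invmx N *m X *m N.
(** The squared modulus of an entry of [X] in the orthonormal frame obtained by normalising the
    columns of [N], written without square roots. *)
Definition m2 X a b : F := `|frame X a b| ^+ 2 * (d 0 a / d 0 b).

Let Nu : N \in unitmx. Proof. exact: unitri_unit. Qed.

Lemma m2_ge0 X a b : 0 <= m2 X a b.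
Proof. by rewrite mulr_ge0 ?exprn_ge0 // divr_ge0 // ltW. Qed.

Lemma frameE X : N *m frame X = X *m N.
Proof. by rewrite /frame -mulmxA mulKVmx. Qed.

Lemma frameM X Y : frame (X *m Y) = frame X *m frame Y.
Proof. by rewrite /frame !mulmxA mulmxK. Qed.

Lemma frameB X Y : frame (X - Y) = frame X - frame Y.
Proof. by rewrite /frame mulmxBr mulmxBl. Qed.

Lemma mxtrace_frame X : \tr (frame X) = \tr X.
Proof. by rewrite /frame mxtrace_mulC mulKVmx. Qed.

Lemma cj_diag : conjmx (diag_mx d) = diag_mx d.
Proof. by rewrite map_diag_mx; congr diag_mx; apply/rowP=> i; rewrite !mxE cj_pos. Qed.

Lemma conj_gram : (conjmx N)^T *m conjmx H *m N = diag_mx d.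
Proof. by rewrite -cj_diag -hd !map_mxM map_trmx cjmxK. Qed.

Section Adjoint.
Variables X U : 'M[F]_n.
Hypothesis hU : conjmx H *m U = (conjmx X)^T *m conjmx H.

Lemma frame_adj : diag_mx d *m frame U = (conjmx (frame X))^T *m diag_mx d.
Proof.
rewrite -conj_gram -!mulmxA frameE (mulmxA _ U) hU !mulmxA; congr (_ *m _ *m _).
by rewrite -!trmx_mul -!map_mxM frameE.
Qed.

Lemma frame_adjE a b : frame U a b = cj (frame X b a) * (d 0 b / d 0 a).
Proof.
have := congr1 (fun Y : 'M[F]_n => Y a b) frame_adj; rewrite mul_diag_mx mul_mx_diag !mxE => h.
by apply: (mulfI (dn a)); rewrite h [RHS]mulrCA [X in _ = _ * X]mulrCA divff ?mulr1.
Qed.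

Lemma mxtrace_adj : \tr (X *m U) = \sum_a \sum_b m2 X a b.
Proof.
rewrite -mxtrace_frame frameM; apply: eq_bigr => a _; rewrite mxE; apply: eq_bigr => b _.
by rewrite frame_adjE [LHS]mulrA cjN2.
Qed.

(** Inside the leading block the terms cancel in pairs by antisymmetry, which leaves the entries
    crossing the border of the block. *)
Lemma frame_bracket k : \sum_(p : 'I_n | (p < k)%N) frame (X *m U - U *m X) p p =
  \sum_(p : 'I_n | (p < k)%N) \sum_(b : 'I_n | (k <= b)%N) (m2 X p b - m2 X b p).
Proof.
transitivity (\sum_(p : 'I_n | (p < k)%N) \sum_b (m2 X p b - m2 X b p)).
  apply: eq_bigr => p _; rewrite frameB !frameM mxE [X in _ + X]mxE !mxE -sumrB.
  apply: eq_bigr => b _; rewrite !frame_adjE; congr (_ - _).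
    by rewrite [LHS]mulrA cjN2.
  by rewrite mulrAC [cj _ * _]mulrC cjN2.
rewrite (eq_bigr (fun p : 'I_n => \sum_(b : 'I_n | (b < k)%N) (m2 X p b - m2 X b p) +
   \sum_(b : 'I_n | (k <= b)%N) (m2 X p b - m2 X b p))); last first.
  move=> p _; rewrite (bigID (fun b : 'I_n => (b < k)%N)) /=; congr (_ + _).
  by apply: eq_bigl => b; rewrite -leqNgt.
rewrite big_split /= [X in X + _](_ : _ = 0) ?add0r //.
under eq_bigr do rewrite sumrB.
by rewrite sumrB [X in _ - X]exchange_big subrr.
Qed.
End Adjoint.

Lemma trace_head k X : \tr (invmx (trunc k H) *m (headmx k *m X *m headmx k)) =
  \sum_(p : 'I_n | (p < k)%N) (d 0 p)^-1 * (N^T *m X *m conjmx N) p p.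
Proof.
have -> : \tr (invmx (trunc k H) *m (headmx k *m X *m headmx k)) =
    \tr (headmx k *m (diag_mx dinv *m (N^T *m X *m conjmx N))).
  rewrite [in LHS]mulmxA [LHS]mxtrace_mulC !mulmxA head_inv_trunc -!mulmxA mxtrace_mulC.
  by rewrite !mulmxA.
rewrite [RHS]big_mkcond; apply: eq_bigr => p _; rewrite headmxE mul_diag_mx.
rewrite ![in LHS]mxE; case: ltnP => _; rewrite ?mul1r ?mul0r //.
by rewrite !mxE.
Qed.

Lemma trace_head2 k Z Y : \tr (invmx (trunc k H) *m (headmx k *m Z *m headmx k) *m
    invmx (trunc k H) *m (headmx k *m Y *m headmx k)) =
  \sum_(p : 'I_n | (p < k)%N) \sum_(b : 'I_n | (b < k)%N) (d 0 p)^-1 * (N^T *m Z *m conjmx N) p b *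
    ((d 0 b)^-1 * (N^T *m Y *m conjmx N) b p).
Proof.
set V := invmx _; set K := conjmx N *m (headmx k *m diag_mx dinv) *m N^T.
have hK : headmx k *m V *m headmx k = K by exact: head_inv_trunc.
have -> : \tr (V *m (headmx k *m Z *m headmx k) *m V *m (headmx k *m Y *m headmx k)) =
    \tr (K *m Z *m K *m Y).
  by rewrite -hK !mulmxA [LHS]mxtrace_mulC !mulmxA.
pose E := headmx k *m diag_mx dinv.
have -> : \tr (K *m Z *m K *m Y) = \tr ((E *m (N^T *m Z *m conjmx N)) *m (E *m (N^T *m Y *m conjmx N))).
  by rewrite /K -/E -!mulmxA mxtrace_mulC !mulmxA.
have EE (W : 'M[F]_n) i j : (E *m W) i j = (i < k)%:R * ((d 0 i)^-1 * W i j).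
  by rewrite /E -mulmxA headmxE mul_diag_mx !mxE.
rewrite [RHS]big_mkcond; apply: eq_bigr => p _; rewrite mxE.
case: (ltnP p k) => pk; last first.
  by apply: big1 => b _; rewrite EE ltnNge pk !mul0r.
rewrite [RHS]big_mkcond; apply: eq_bigr => b _; rewrite !EE pk mul1r.
by case: ltnP => _; rewrite ?mul1r ?mul0r ?mulr0.
Qed.

(** For a harmonic metric, [Y], [Z] and [W] are the z-derivative, the zbar-derivative and the mixed
    second derivative of [H]. Entries of the connection [A] inside the block cancel, and those left
    over form the second fundamental form of [F_k]. *)
Lemma lap_formula k A X U (Z := H *m conjmx A) (Y := A^T *m H)
  (W := (X *m U - U *m X)^T *m H + A^T *m H *m conjmx A) :
  conjmx H *m U = (conjmx X)^T *m conjmx H ->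
  \tr (invmx (trunc k H) *m (headmx k *m W *m headmx k)) -
  \tr (invmx (trunc k H) *m (headmx k *m Z *m headmx k) *m
    invmx (trunc k H) *m (headmx k *m Y *m headmx k)) =
  \sum_(p : 'I_n | (p < k)%N) \sum_(b : 'I_n | (k <= b)%N) (m2 X p b - m2 X b p + m2 A b p).
Proof.
move=> hU; rewrite trace_head trace_head2.
have tE (G : 'M[F]_n) : N^T *m G^T *m H *m conjmx N = (frame G)^T *m diag_mx d.
  by rewrite -hd !mulmxA -trmx_mul -frameE trmx_mul.
have cE (G : 'M[F]_n) : N^T *m H *m conjmx G *m conjmx N = diag_mx d *m conjmx (frame G).
  by rewrite -hd -mulmxA -map_mxM -frameE map_mxM mulmxA.
have hW : N^T *m W *m conjmx N = (frame (X *m U - U *m X))^T *m diag_mx d +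
    (frame A)^T *m diag_mx d *m conjmx (frame A).
  rewrite /W mulmxDr mulmxDl !mulmxA tE; congr (_ + _).
  by rewrite -tE -[RHS]mulmxA -map_mxM frameE map_mxM !mulmxA.
have hZ : N^T *m Z *m conjmx N = diag_mx d *m conjmx (frame A) by rewrite /Z !mulmxA cE.
have hY : N^T *m Y *m conjmx N = (frame A)^T *m diag_mx d by rewrite /Y !mulmxA tE.
rewrite hW hZ hY.
have e1 : \sum_(p : 'I_n | (p < k)%N) (d 0 p)^-1 * ((frame (X *m U - U *m X))^T *m diag_mx d +
    (frame A)^T *m diag_mx d *m conjmx (frame A)) p p =
  \sum_(p : 'I_n | (p < k)%N) frame (X *m U - U *m X) p p +
  \sum_(p : 'I_n | (p < k)%N) \sum_b m2 A b p.
  rewrite -big_split; apply: eq_bigr => p _; rewrite mxE mulrDr; congr (_ + _).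
    by move: (frame _) => f; rewrite mul_mx_diag !mxE mulrCA mulVf ?mulr1.
  rewrite mxE mulr_sumr; apply: eq_bigr => b _; rewrite /m2 -cjN2; move: (frame A) => f.
  rewrite mul_mx_diag !mxE.
  have E (x y e c : F) : e * (x * c * y) = x * y * (c * e) by ring.
  exact: E.
have e2 : \sum_(p : 'I_n | (p < k)%N) \sum_(b : 'I_n | (b < k)%N)
    (d 0 p)^-1 * (diag_mx d *m conjmx (frame A)) p b *
    ((d 0 b)^-1 * ((frame A)^T *m diag_mx d) b p) =
  \sum_(p : 'I_n | (p < k)%N) \sum_(b : 'I_n | (b < k)%N) m2 A b p.
  rewrite [RHS]exchange_big; apply: eq_bigr => p _; apply: eq_bigr => b _.
  rewrite /m2 -cjN2; move: (frame A) => f.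
  rewrite mul_diag_mx mul_mx_diag !mxE mulKf //=.
  have E (x y e c : F) : y * (e * (x * c)) = x * y * (c * e) by ring.
  exact: E.
rewrite e1 e2 (frame_bracket hU) -addrA -sumrB -big_split.
apply: eq_bigr => p _; rewrite [RHS]big_split; congr (_ + _).
rewrite (bigID (fun b : 'I_n => (b < k)%N)) /= addrC addrK.
by apply: eq_bigl => b; rewrite -leqNgt.
Qed.

End Fixed.

End Frames.
End ConjField.

(** * The energy inequality for ratios of minors *)

Section RealEnergy.
Variable R : realType.

(* Position of the [t]-th power of [K] in the order of the filtration, where
   position [n] is taken by the extra trivial summand. *)
Definition pos (n t : nat) : nat := if (t < n)%N then t else t.+1.

Definition ratio_coef (n t : nat) : R := (t.+1 * (2 * n - 2 - t))%:R.

(** Summation by parts: the weights [(t + 1)(M - t)] and [t (M - t + 1)] differ by [M - 2t]. *)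
Lemma abel_ratio (L : nat -> R) (M m : nat) : (m <= M)%N ->
  \sum_(0 <= t < m) (t.+1 * (M - t))%:R * (L t.+1 - L t) =
  (m * (M.+1 - m))%:R * L m - \sum_(0 <= t < m) (M%:R - 2 * t%:R) * L t.
Proof.
elim: m => [|m IH] hm; first by rewrite !big_geq // mul0n mul0r subrr.
rewrite big_nat_recr //= IH ?(ltnW hm) // big_nat_recr //= subSS.
rewrite subSn ?(ltnW hm) // !natrM -!natr1 natrB ?(ltnW hm) //; ring.
Qed.

Lemma abel_low (u : nat -> R) (n K : nat) : u 0%N = 0 ->
  \sum_(0 <= t < K) (2 * n%:R - 2 - 2 * t%:R) * (u t.+1 - u t) =
  (2 * n%:R - 2 * K%:R) * u K + 2 * \sum_(0 <= k < K) u k.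
Proof.
move=> u0; elim: K => [|K IH]; first by rewrite !big_geq // u0; ring.
rewrite !big_nat_recr //= IH -natr1; ring.
Qed.

Lemma abel_high (u : nat -> R) (n K : nat) :
  \sum_(0 <= j < K) (- 2 * j.+1%:R) * (u (n + j).+2 - u (n + j).+1) =
  - 2 * K%:R * u (n + K).+1 + 2 * \sum_(0 <= j < K) u (n + j).+1.
Proof.
elim: K => [|K IH]; first by rewrite !big_geq //; ring.
rewrite !big_nat_recr //= IH -!natr1 addnS; ring.
Qed.

(** The weights are quadratic in [t], so summing by parts twice leaves the constant -2. The second
    time is done on each side of position [n] separately; the skipped position leaves [u n] with
    weight 0, and the end terms vanish with [u 0] and [u (n + n)]. *)
Lemma abel_chain (l u : nat -> R) (n : nat) : (1 < n)%N ->
  (forall k, u k = \sum_(0 <= p < k) l p) -> u (n + n)%N = 0 ->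
  \sum_(0 <= t < 2 * n - 2) ratio_coef n t * (l (pos n t.+1) - l (pos n t)) =
  - 2 * (\sum_(0 <= k < n) u k + \sum_(0 <= j < n.-1) u (n + j).+1).
Proof.
move=> n1 hu u2n.
have lE p : l p = u p.+1 - u p by rewrite !hu big_nat_recr //= addrAC subrr add0r.
have u0 : u 0%N = 0 by rewrite hu big_geq.
rewrite (abel_ratio (fun t => l (pos n t)) (leqnn _)).
have hM : (2 * n - 2)%:R = 2 * n%:R - 2 :> R by rewrite natrB ?natrM // mul2n; lia.
rewrite subSnn muln1.
have -> : (2 * n - 2)%:R * l (pos n (2 * n - 2)) - \sum_(0 <= t < 2 * n - 2)
    ((2 * n - 2)%:R - 2 * t%:R) * l (pos n t) =
  - \sum_(0 <= t < (2 * n - 2).+1) ((2 * n - 2)%:R - 2 * t%:R) * l (pos n t).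
  by rewrite [in RHS]big_nat_recr //=; ring.
rewrite (@big_cat_nat _ _ _ n) /=; [|by []|lia].
rewrite [X in - (X + _)](_ : _ = 2 * \sum_(0 <= k < n) u k); last first.
  rewrite -[RHS]add0r -[X in X + _](mul0r (u n)) -[X in X * _](subrr (2 * n%:R : R)).
  rewrite -abel_low //; apply: eq_big_nat => t /andP[_ tn].
  by rewrite /pos tn lE hM.
rewrite [X in - (_ + X)](_ : _ = 2 * \sum_(0 <= j < n.-1) u (n + j).+1); first by ring.
have := abel_high u n n.-1; rewrite (_ : (n + n.-1).+1 = (n + n)%N); last by lia.
rewrite u2n mulr0 add0r => <-.
rewrite -[X in \sum_(X <= _ < _) _](add0n n) big_addn.
have -> : ((2 * n - 2).+1 - n)%N = n.-1 by lia.
apply: eq_big_nat => j _; rewrite /pos ltnNge leq_addl /= lE hM natrD -natr1 [(j + n)%N]addnC.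
ring.
Qed.

Lemma ratio_energy (r : nat -> R) (n : nat) : (1 < n)%N ->
  (forall p, 0 < r p) ->
  (forall k, (k <= n + n)%N -> \prod_(0 <= p < k) r p <= 1) ->
  \prod_(0 <= p < n + n) r p = 1 ->
  \sum_(0 <= t < 2 * n - 2) ratio_coef n t <=
    \sum_(0 <= t < 2 * n - 2) ratio_coef n t * (r (pos n t.+1) / r (pos n t)) /\
  (\sum_(0 <= t < 2 * n - 2) ratio_coef n t * (r (pos n t.+1) / r (pos n t)) =
   \sum_(0 <= t < 2 * n - 2) ratio_coef n t ->
   forall k, (k < n)%N -> \prod_(0 <= p < k) r p = 1).
Proof.
move=> n1 r0 rle r1.
pose l p := ln (r p); pose u k := \sum_(0 <= p < k) l p.
have prod_gt0 k : 0 < \prod_(0 <= p < k) r p by apply: prodr_gt0.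
have uE k : u k = ln (\prod_(0 <= p < k) r p).
  elim: k => [|k IH]; first by rewrite /u !big_geq // ln1.
  by rewrite /u !big_nat_recr //= -/(u k) IH lnM ?posrE.
have u_le0 k : (k <= n + n)%N -> u k <= 0.
  by move=> /rle h; rewrite uE ln_le0.
have u2n : u (n + n)%N = 0 by rewrite uE r1 ln1.
have habel := abel_chain n1 (fun k => erefl (u k)) u2n.
have hterm t : ratio_coef n t * (l (pos n t.+1) - l (pos n t)) <=
    ratio_coef n t * (r (pos n t.+1) / r (pos n t)) - ratio_coef n t.
  rewrite -[X in _ <= _ - X]mulr1 -mulrBr ler_wpM2l ?ler0n //.
  rewrite /l -ln_div ?posrE //.
  have q0 : 0 < r (pos n t.+1) / r (pos n t) by rewrite divr_gt0.
  by have := expR_ge1Dx (ln (r (pos n t.+1) / r (pos n t))); rewrite lnK ?posrE // lerBrDl.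
have hsum : - 2 * (\sum_(0 <= k < n) u k + \sum_(0 <= j < n.-1) u (n + j).+1) <=
   \sum_(0 <= t < 2 * n - 2) ratio_coef n t * (r (pos n t.+1) / r (pos n t)) -
   \sum_(0 <= t < 2 * n - 2) ratio_coef n t.
  by rewrite -habel -sumrB; apply: ler_sum => t _; exact: hterm.
have s2 : \sum_(0 <= j < n.-1) u (n + j).+1 <= 0.
  rewrite big_nat; apply: sumr_le0 => j /andP[_ hj]; apply: u_le0; lia.
have s1 : \sum_(0 <= k < n) u k <= 0.
  rewrite big_nat; apply: sumr_le0 => k /andP[_ hk]; apply: u_le0; lia.
split; first by lra.
move=> heq k kn.
(* Equality squeezes this sum of nonpositive logarithms to 0, hence each of its terms. *)
have s10 : \sum_(0 <= k < n) u k = 0 by lra.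
have : u k = 0.
  move: s10; rewrite big_mkord => /eqP; rewrite -oppr_eq0 -sumrN psumr_eq0.
    by move=> /allP/(_ (Ordinal kn) (mem_index_enum _)) /=; rewrite oppr_eq0 => /eqP.
  by move=> i _; rewrite oppr_ge0 u_le0 //; have := ltn_ord i; lia.
by rewrite uE => /eqP; rewrite ln_eq0 ?prod_gt0 // => /eqP.
Qed.

End RealEnergy.

(** * The Higgs field in the order of the filtration *)

Section ThetaEntries.
Variables (R : realType) (n : nat).
Hypothesis n1 : (1 < n)%N.
Local Notation C := (Cplx R).
Local Notation I := 'I_(n + n).

(** Inverse of [pos] away from position [n]: position [p] carries the power n - 1 - [cidx p] of [K].
    The value at [n], the position of [O'], is a placeholder. *)
Definition cidx (p : nat) : nat := if (p < n)%N then p else p.-1.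
(** Position of the dual summand. It is the reversal of the order, except that [O] and [O'], at the
    adjacent positions [n.-1] and [n], are each self-dual. *)
Definition dual (p : nat) : nat :=
  if (p == n.-1) || (p == n) then p else ((n + n).-1 - p)%N.
(** Whether position [p] belongs to [V]: the powers of [K] alternate between [V] and [W], and [O']
    lies in [W]. *)
Definition vpar (p : nat) : bool := (p != n) && ~~ odd (cidx p).

(* [theta] in the order of the filtration. *)
Definition theta_entry (q : nat -> C) (p b : nat) : C :=
  if p == n then (if b == (n + n).-1%N then q n else 0)
  else if b == n then (if p == 0 then q n else 0)
  else if cidx p == (cidx b).+1 then 1
  else if (cidx p <= cidx b)%N && odd (cidx b - cidx p) then q ((cidx b - cidx p).+1./2)
  else 0.

(** Here and in [eta_val], [sig] and [theta_val] the indices are plain natural numbers, so that the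
    comparisons of indices become linear arithmetic. *)
Definition filt_val (p : nat) : nat :=
  (if p == n then n + n.-1
  else if p < n then (if odd p then n + p./2 else p./2)
  else (if odd p then p./2 else n + p./2.-1))%N.

Lemma filt_valE (p : I) : filt p = filt_val p :> nat.
Proof.
rewrite /filt val_insubd -/(filt_val p).
have -> // : (filt_val p < n + n)%N.
rewrite /filt_val; have := ltn_ord p.
case: eqP => [_|pn]; first by lia.
by case: (ltnP p n) => hp; case: ifP => ho hp'; lia.
Qed.

Lemma dual_lt p : (p < n + n)%N -> (dual p < n + n)%N.
Proof. by rewrite /dual; case: ifP => //; lia. Qed.
Definition dualI (p : I) : I := Ordinal (dual_lt (ltn_ord p)).

Lemma dualK p : (p < n + n)%N -> dual (dual p) = p.
Proof.
rewrite /dual => hp; case: (eqVneq p n.-1) => [->|h1] /=; first by rewrite eqxx.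
case: (eqVneq p n) => [->|h2]; first by rewrite eqxx orbT.
case: eqVneq => [h3|h3] /=; first by lia.
by case: eqVneq => [h4|h4] /=; lia.
Qed.

Lemma filt_inj : injective (@filt n).
Proof.
move=> p p' h; apply/ord_inj; have := filt_valE p; rewrite h filt_valE /filt_val.
clear h; have := ltn_ord p; have := ltn_ord p'.
move: (nat_of_ord p) (nat_of_ord p') => {}p {}p'.
case: (eqVneq p n); case: (eqVneq p' n); case: (ltnP p n); case: (ltnP p' n);
  case: (boolP (odd p)); case: (boolP (odd p')); lia.
Qed.

Definition eta_val (q : nat -> C) (i j : nat) : C :=
  if j.+1 == n then (if i == 0 then q n else 0)
  else if (i <= j)%N then q (j - i).+1 else (i == j.+1)%:R.

Definition sig (j : nat) : nat := if j.+1 == n then j else (n - 2 - j)%N.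
Lemma sig_lt (j : 'I_n) : (sig j < n)%N.
Proof. by rewrite /sig; have := ltn_ord j; case: ifP; lia. Qed.

Lemma QWE (i j : 'I_n) : QW R n i j = (j == Ordinal (sig_lt i))%:R.
Proof.
rewrite mxE -val_eqE /= /sig; have := ltn_ord i; have := ltn_ord j => hj hi.
rewrite -val_eqE /=; case: (eqVneq i.+1 n) => h /=; first by rewrite eq_sym.
by case: (eqVneq j.+1 n) => h' /=; congr (nat_of_bool _)%:R; lia.
Qed.

Lemma QVE (i j : 'I_n) : QV R n i j = (j == rev_ord i)%:R.
Proof.
rewrite mxE -val_eqE /=; have := ltn_ord i; have := ltn_ord j => hj hi.
by congr (nat_of_bool _)%:R; lia.
Qed.

Lemma mulQW m (A : 'M[C]_(n, m)) i j : (QW R n *m A) i j = A (Ordinal (sig_lt i)) j.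
Proof.
rewrite mxE (bigD1 (Ordinal (sig_lt i))) //= QWE eqxx mul1r big1 ?addr0 // => k hk.
by rewrite QWE (negbTE hk) mul0r.
Qed.
Lemma mulQV m (A : 'M[C]_(n, m)) i j : (QV R n *m A) i j = A (rev_ord i) j.
Proof.
rewrite mxE (bigD1 (rev_ord i)) //= QVE eqxx mul1r big1 ?addr0 // => k hk.
by rewrite QVE (negbTE hk) mul0r.
Qed.

Lemma QVT : (QV R n)^T = QV R n.
Proof. by apply/matrixP=> i j; rewrite !mxE addnC. Qed.
Lemma QVK : QV R n *m QV R n = 1%:M.
Proof. by apply/matrixP=> i j; rewrite mulQV QVE rev_ordK !mxE eq_sym. Qed.
Lemma QWK : QW R n *m QW R n = 1%:M.
Proof.
apply/matrixP=> i j; rewrite mulQW QWE !mxE eq_sym; congr (nat_of_bool (_ == _))%:R.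
apply/val_inj; rewrite /= /sig; have := ltn_ord i.
by case: (eqVneq i.+1 n) => h hi; [rewrite h eqxx|rewrite ifF; lia].
Qed.

Lemma invQV : invmx (QV R n) = QV R n.
Proof.
have [u _] := mulmx1_unit QVK.
by rewrite -[LHS]mulmx1 -QVK mulKmx.
Qed.
Lemma invQW : invmx (QW R n) = QW R n.
Proof.
have [u _] := mulmx1_unit QWK.
by rewrite -[LHS]mulmx1 -QWK mulKmx.
Qed.

Lemma eta_adjE (q : nat -> C -> C) z (i j : 'I_n) :
  eta_adj n q z i j = eta_val (fun k => q k z) (n - 1 - j) (sig i).
Proof.
rewrite /eta_adj invQW -mulmxA mulQW.
have -> : ((eta n q z)^T *m QV R n) (Ordinal (sig_lt i)) j = (QV R n *m eta n q z) j (Ordinal (sig_lt i)).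
  by rewrite -[in LHS]QVT -trmx_mul mxE.
by rewrite mulQV mxE /eta_val /= (_ : (n - 1 - j = n - j.+1)%N) //; lia.
Qed.

Definition theta_val (q : nat -> C) (a b : nat) : C :=
  if (a < n)%N then (if (b < n)%N then 0 else eta_val q a (b - n))
  else (if (b < n)%N then eta_val q (n - 1 - b) (sig (a - n)) else 0).

Lemma theta_valE (q : nat -> C -> C) z (a b : I) :
  theta n q z a b = theta_val (fun k => q k z) a b.
Proof.
rewrite /theta /theta_val.
have [a' ->|a' ->] := @split_ordP n n a; have [b' ->|b' ->] := @split_ordP n n b.
- by rewrite block_mxEul mxE.
- by rewrite block_mxEur mxE /= addKn.
- by rewrite block_mxEdl eta_adjE /= addKn.
- by rewrite block_mxEdr mxE.
Qed.

Lemma filt_chain p : p != n -> filt_val p =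
  (if odd (cidx p) then n + (cidx p)./2 else (cidx p)./2)%N.
Proof.
move=> hp; rewrite /filt_val /cidx (negbTE hp); case: (ltnP p n) => h //.
by case: (boolP (odd p)) => op; case: ifP => op'; lia.
Qed.

Lemma cidx_lt p : p != n -> (p < n + n)%N -> (cidx p < n + n.-1)%N.
Proof. by move=> h1 h2; rewrite /cidx; case: ifP; lia. Qed.

(** Even chain indices lie in [V] and odd ones in [W], so indices of equal parity give 0; the blocks
    of eta and of its adjoint interleave into one matrix whose entries depend only on the difference
    of the indices. *)
Lemma theta_val_chain (q : nat -> C) (t s : nat) : (t < n + n.-1)%N -> (s < n + n.-1)%N ->
  theta_val q (if odd t then n + t./2 else t./2)%N (if odd s then n + s./2 else s./2)%N =
  if t == s.+1 then 1 else if (t <= s)%N && odd (s - t) then q (s - t).+1./2 else 0.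
Proof.
move=> ht hs; rewrite /theta_val.
have hq (x y : nat) : x = y -> q x = q y by move=> ->.
case: (boolP (odd t)) => ot; case: (boolP (odd s)) => os.
- have -> : (n + t./2 < n)%N = false by lia.
  have -> : (n + s./2 < n)%N = false by lia.
  have -> : (t == s.+1) = false by lia.
  by have -> : odd (s - t) = false; [lia|rewrite andbF].
- have -> : (n + t./2 < n)%N = false by lia.
  have -> : (s./2 < n)%N by lia.
  rewrite addKn /sig (_ : (t./2.+1 == n) = false); last by lia.
  rewrite /eta_val (_ : ((n - 2 - t./2).+1 == n) = false); last by lia.
  case: (eqVneq t s.+1) => h1.
    rewrite (_ : (n - 1 - s./2 <= n - 2 - t./2)%N = false); last by lia.
    by rewrite (_ : (n - 1 - s./2 == (n - 2 - t./2).+1)%N = true) //; lia.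
  case: (leqP t s) => h2 /=.
    rewrite (_ : odd (s - t) = true); last by lia.
    rewrite (_ : (n - 1 - s./2 <= n - 2 - t./2)%N = true); last by lia.
    by apply: hq; lia.
  rewrite (_ : (n - 1 - s./2 <= n - 2 - t./2)%N = false); last by lia.
  by rewrite (_ : (n - 1 - s./2 == (n - 2 - t./2).+1)%N = false) //; lia.
- have -> : (t./2 < n)%N by lia.
  have -> : (n + s./2 < n)%N = false by lia.
  rewrite addKn /eta_val (_ : (s./2.+1 == n) = false); last by lia.
  case: (eqVneq t s.+1) => h1.
    rewrite (_ : (t./2 <= s./2)%N = false); last by lia.
    by rewrite (_ : (t./2 == (s./2).+1)%N = true) //; lia.
  case: (leqP t s) => h2 /=.
    rewrite (_ : odd (s - t) = true); last by lia.
    rewrite (_ : (t./2 <= s./2)%N = true); last by lia.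
    by apply: hq; lia.
  rewrite (_ : (t./2 <= s./2)%N = false); last by lia.
  by rewrite (_ : (t./2 == (s./2).+1)%N = false) //; lia.
- have -> : (t./2 < n)%N by lia.
  have -> : (s./2 < n)%N by lia.
  have -> : (t == s.+1) = false by lia.
  by have -> : odd (s - t) = false; [lia|rewrite andbF].
Qed.

Lemma theta_filt (q : nat -> C -> C) z (p b : I) :
  theta n q z (filt p) (filt b) = theta_entry (fun k => q k z) p b.
Proof.
rewrite theta_valE !filt_valE; move: (fun k => q k z) => {z} {}q.
have := ltn_ord p; have := ltn_ord b.
move: (nat_of_ord p) (nat_of_ord b) => {p b} p b hb hp.
rewrite /theta_entry.
case: (eqVneq p n) => hpn; case: (eqVneq b n) => hbn.
- rewrite hpn hbn /theta_val /filt_val eqxx.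
  have -> : (n + n.-1 < n)%N = false by lia.
  by have -> : (n == (n + n).-1) = false by lia.
- have := cidx_lt hbn hb; rewrite (filt_chain hbn) hpn /filt_val eqxx => hc.
  have -> : (b == (n + n).-1) = (cidx b == (n + n).-2) by rewrite /cidx; case: ifP; lia.
  rewrite /theta_val (_ : (n + n.-1 < n)%N = false); last by lia.
  case: (boolP (odd (cidx b))) => ob.
    have -> : (n + (cidx b)./2 < n)%N = false by lia.
    by have -> : (cidx b == (n + n).-2) = false by lia.
  have -> : ((cidx b)./2 < n)%N by lia.
  rewrite addKn /sig (_ : (n.-1).+1 == n); last by lia.
  rewrite /eta_val (_ : (n.-1).+1 == n); last by lia.
  by have -> : (n - 1 - (cidx b)./2 == 0)%N = (cidx b == (n + n).-2) by lia.
- have := cidx_lt hpn hp; rewrite (filt_chain hpn) hbn /filt_val eqxx => hc.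
  have -> : (p == 0) = (cidx p == 0) by rewrite /cidx; case: ifP; lia.
  rewrite /theta_val (_ : (n + n.-1 < n)%N = false); last by lia.
  case: (boolP (odd (cidx p))) => op.
    have -> : (n + (cidx p)./2 < n)%N = false by lia.
    by have -> : (cidx p == 0) = false by lia.
  have -> : ((cidx p)./2 < n)%N by lia.
  rewrite addKn /eta_val (_ : (n.-1).+1 == n); last by lia.
  by have -> : ((cidx p)./2 == 0)%N = (cidx p == 0) by lia.
- by rewrite !filt_chain // theta_val_chain // cidx_lt.
Qed.

End ThetaEntries.

(** * Duality of summands in terms of positions *)

Section DualPosition.
Variable n : nat.
Hypothesis n1 : (1 < n)%N.

Lemma cidx_dual p : (p < n + n)%N -> p != n ->
  (dual n p != n) * (cidx n (dual n p) = (n + n).-2 - cidx n p)%N.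
Proof.
move=> hp pn; rewrite /dual /cidx (negbTE pn) orbF.
case: (eqVneq p n.-1) => [->|h1].
  have -> : (n.-1 < n)%N by lia.
  by split; lia.
have h2 : ((n + n).-1 - p != n)%N by lia.
rewrite h2; split=> //; case: (ltnP p n) => h3; last first.
  by have -> : ((n + n).-1 - p < n)%N; lia.
by have -> : ((n + n).-1 - p < n)%N = false; lia.
Qed.

Lemma filt_val_dual p : (p < n + n)%N -> filt_val n (dual n p) =
  (if filt_val n p < n then n - (filt_val n p).+1 else n + sig n (filt_val n p - n))%N.
Proof.
move=> hp; case: (eqVneq p n) => [->|pn].
  have -> : dual n n = n by rewrite /dual eqxx orbT.
  rewrite /filt_val eqxx; have -> : (n + n.-1 < n)%N = false by lia.
  by rewrite addKn /sig (_ : (n.-1.+1 == n) = true) //; lia.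
have [dn cd] := cidx_dual hp pn; have ct := cidx_lt n1 pn hp.
rewrite !(filt_chain n1) // cd.
move: (cidx n p) ct => t ct.
have -> : odd ((n + n).-2 - t) = odd t by lia.
case: (boolP (odd t)) => ot.
  have -> : (n + t./2 < n)%N = false by lia.
  rewrite addKn /sig (_ : (t./2.+1 == n) = false); last by lia.
  lia.
have -> : (t./2 < n)%N by lia.
lia.
Qed.
End DualPosition.

(** * Matrices rewritten in the order of the filtration *)

Section Reorder.
Variables (R : realType) (n : nat).
Hypothesis n1 : (1 < n)%N.
Local Notation C := (Cplx R).
Local Notation I := 'I_(n + n).
Local Notation M := 'M[C]_(n + n).

Definition reo (A : M) : M := \matrix_(p, b) A (filt p) (filt b).

Lemma filt_bij : bijective (@filt n).
Proof. by apply: injF_bij; exact: (filt_inj n1). Qed.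

Lemma reoM A B : reo (A *m B) = reo A *m reo B.
Proof.
apply/matrixP=> p b; rewrite !mxE (reindex _ (onW_bij _ filt_bij)).
by apply: eq_bigr => k _; rewrite !mxE.
Qed.
Lemma reoD A B : reo (A + B) = reo A + reo B.
Proof. by apply/matrixP=> p b; rewrite !mxE. Qed.
Lemma reoN A : reo (- A) = - reo A.
Proof. by apply/matrixP=> p b; rewrite !mxE. Qed.
Lemma reo_tr A : reo A^T = (reo A)^T.
Proof. by apply/matrixP=> p b; rewrite !mxE. Qed.
Lemma reo_conj A : reo (conjmx A) = conjmx (reo A).
Proof. by apply/matrixP=> p b; rewrite !mxE. Qed.
Lemma reo1 : reo 1%:M = 1%:M.
Proof. by apply/matrixP=> p b; rewrite !mxE (inj_eq (filt_inj n1)). Qed.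
Lemma reo_unit A : A \in unitmx -> reo A \in unitmx.
Proof.
move=> uA; have e : reo A *m reo (invmx A) = 1%:M by rewrite -reoM mulmxV // reo1.
have [u _] := mulmx1_unit e; exact: u.
Qed.
Lemma reoV A : A \in unitmx -> reo (invmx A) = invmx (reo A).
Proof.
move=> uA; rewrite -[LHS]mul1mx -(mulVmx (reo_unit uA)) -mulmxA -reoM mulmxV //.
by rewrite reo1 mulmx1.
Qed.
Lemma mxtrace_reo A : \tr (reo A) = \tr A.
Proof.
rewrite /mxtrace [RHS](reindex _ (onW_bij _ filt_bij)); apply: eq_bigr => p _.
by rewrite mxE.
Qed.
Lemma reo_inj : injective reo.
Proof.
move=> A B AB; apply/matrixP=> a b; have [g _ gK] := filt_bij.
by have := congr1 (fun X : M => X (g a) (g b)) AB; rewrite !mxE !gK.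
Qed.

Lemma det_lead (F : numFieldType) m k (A : 'M[F]_m) (le : (k <= m)%N) :
  \det (\matrix_(i < k, j < k) A (widen_ord le i) (widen_ord le j)) = \det (trunc k A).
Proof.
(* Replacing the size by [k + r] exposes the leading block to [block_mx]. *)
have e : (k + (m - k) = m)%N by exact: subnKC.
move: (m - k)%N e => r e; subst m.
have -> : trunc k A = block_mx (ulsubmx A) 0 0 1%:M.
  apply/matrixP=> i j; rewrite truncE.
  have [i' ->|i' ->] := split_ordP i; have [j' ->|j' ->] := split_ordP j.
  - by rewrite block_mxEul !mxE.
  - by rewrite block_mxEur mxE /= eq_lrshift.
  - by rewrite block_mxEdl mxE /= eq_rlshift.
  - by rewrite block_mxEdr !mxE /= eq_rshift.
rewrite det_ublock det1 mulr1; congr (\det _); apply/matrixP=> i j; rewrite !mxE.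
by congr (A _ _); apply/val_inj.
Qed.

Lemma gramFE (H : M) (k : I) : gramF H k = \det (trunc k.+1 (reo H)).
Proof.
rewrite -(det_lead _ (ltn_ord k)) /gramF; congr (\det _).
by apply/matrixP=> i j; rewrite !mxE.
Qed.

Lemma block_QE (a b : I) : block_mx (QV R n) 0 0 (QW R n) a b =
  ((b : nat) == if (a < n)%N then (n - a.+1)%N else (n + sig n (a - n))%N)%:R.
Proof.
have [a' ->|a' ->] := split_ordP a; have [b' ->|b' ->] := split_ordP b.
- by rewrite block_mxEul QVE // -val_eqE.
- rewrite block_mxEur mxE /=; have := ltn_ord a'.
  by case: eqP => //; lia.
- rewrite block_mxEdl mxE /=; have := ltn_ord b'.
  by case: eqP => //; lia.
- by rewrite block_mxEdr QWE // -val_eqE /= addKn eqn_add2l.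
Qed.

Definition Jmx : M := reo (block_mx (QV R n) 0 0 (QW R n)).

Lemma JmxE (p b : I) : Jmx p b = (b == dualI n1 p)%:R.
Proof.
rewrite mxE block_QE; congr (nat_of_bool _)%:R.
rewrite -(inj_eq (filt_inj n1)) -[RHS]val_eqE /=; congr (_ == _).
rewrite !filt_valE //=.
by rewrite filt_val_dual.
Qed.

End Reorder.

(** * The hyperbolic metric *)

Section LogLap.
Variable R : realType.
Local Notation C := (Cplx R).
Implicit Types (f g : C -> C) (z : C).
Local Notation dz := (dop (- 'i%C)).
Local Notation dzb := (dop 'i%C).

(* [f ^ 2] times the complex Laplacian of [log f]. *)
Definition loglap f z : C := f z * dzb (dz f) z - dzb f z * dz f z.

Lemma loglap_ext f g z : smooth f -> disc z -> (forall w, disc w -> f w = g w) ->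
  loglap f z = loglap g z.
Proof.
move=> hf zd fg; rewrite /loglap (eq_dop _ hf zd fg) (eq_dop _ hf zd fg) fg //.
congr (_ * _ - _); apply: eq_dop => //; first exact: smooth_dop.
by move=> w wd; apply: eq_dop.
Qed.

Lemma dop2M f g z : smooth f -> smooth g -> disc z ->
  dzb (dz (fun w => f w * g w)) z =
  dzb (dz f) z * g z + dz f z * dzb g z + (dzb f z * dz g z + f z * dzb (dz g) z).
Proof.
move=> hf hg zd; have sf := smooth_dop (- 'i%C) hf; have sg := smooth_dop (- 'i%C) hg.
rewrite (@eq_dop _ 'i%C _ (fun w => dz f w * g w + f w * dz g w)) //; last first.
- by move=> w wd; rewrite dopM.
- by apply: smooth_dop; exact: smoothM.
rewrite dopD //; [|exact: smoothM|exact: smoothM].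
by rewrite !dopM.
Qed.

(** Additivity of the Laplacian of a logarithm under products, with denominators cleared. *)
Lemma loglapM f g z : smooth f -> smooth g -> disc z ->
  loglap (fun w => f w * g w) z = f z ^+ 2 * loglap g z + g z ^+ 2 * loglap f z.
Proof.
move=> hf hg zd; rewrite /loglap dop2M // !dopM //.
move: (f z) (g z) (dz f z) (dzb f z) (dz g z) (dzb g z) (dzb (dz f) z) (dzb (dz g) z).
by move=> a b c d e h i j; ring.
Qed.

Lemma loglap_cst (a : C) z : disc z -> loglap (fun=> a) z = 0.
Proof.
move=> zd; rewrite /loglap dop_cst mul0r subr0.
rewrite (@eq_dop _ 'i%C (dz (fun=> a)) (fun=> 0)) //.
- by rewrite dop_cst mulr0.
- exact: smooth_dop (smooth_cst a).
- by move=> w _; rewrite dop_cst.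
Qed.

Lemma loglap_prod (I : Type) (r : seq I) (F : I -> C -> C) (lam : I -> C) z :
  (forall i, smooth (F i)) -> disc z ->
  (forall i, loglap (F i) z = lam i * F i z ^+ 2) ->
  loglap (fun w => \prod_(i <- r) F i w) z =
  (\sum_(i <- r) lam i) * (\prod_(i <- r) F i z) ^+ 2.
Proof.
move=> hF zd hl; elim: r => [|i r IH].
  rewrite !big_nil mul0r -[RHS](loglap_cst 1 zd); apply: loglap_ext => //.
    exact: (@smooth_prod _ _ [::]).
  by move=> w _; rewrite big_nil.
rewrite (@loglap_ext _ (fun w => F i w * \prod_(j <- r) F j w)) //; last first.
- by move=> w _; rewrite big_cons.
- exact: (@smooth_prod _ _ (i :: r)).
rewrite loglapM //; last exact: smooth_prod.
rewrite IH hl !big_cons exprMn.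
move: (F i z) (\prod_(j <- r) F j z) (lam i) (\sum_(j <- r) lam j) => a b c d; ring.
Qed.

Definition rho z : R := (1 - n2 z)^-1.
Definition rhoC z : C := (1 - z * (z^*)%C)^-1.

Lemma normc2 z : z * (z^*)%C = ((n2 z)%:C)%C.
Proof. by case: z => x y; apply/eqP; rewrite eq_complex /n2 /=; apply/andP; split; apply/eqP; ring. Qed.

Lemma rhoCE z : rhoC z = ((rho z)%:C)%C.
Proof. by rewrite /rhoC normc2 /rho fmorphV rmorphB rmorph1. Qed.

Lemma disc_n2 z : disc z -> n2 z < 1.
Proof. by move=> /discE; rewrite -n2_lt // expr1n. Qed.

Lemma rho_gt0 z : disc z -> 0 < rho z.
Proof. by move=> zd; rewrite invr_gt0 subr_gt0 disc_n2. Qed.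

Lemma rho_den_neq0 z : disc z -> 1 - z * (z^*)%C != 0 :> C.
Proof.
move=> zd; rewrite normc2 -[1](rmorph1 (real_complex R)) -rmorphB fmorph_eq0.
by rewrite subr_eq0 eq_sym lt_eqF // disc_n2.
Qed.

Lemma poincareE z : poincare z / 2 = ((2 * rho z ^+ 2)%:C)%C.
Proof.
have h4 : 4 / 2 = 2 :> C.
  have h : (2 : C) != 0 by rewrite pnatr_eq0.
  by apply: (mulIf h); rewrite mulfVK // -natrM.
rewrite /poincare sqr_normc -/(1 - _) mulrAC h4 rmorphM rmorphXn rmorph_nat /= -rhoCE.
by rewrite exprVn.
Qed.

Lemma smooth_rhoC : smooth rhoC.
Proof.
apply: smoothV; first exact: rho_den_neq0.
apply: smoothD; first exact: smooth_cst.
apply: smoothN; apply: smoothM; first exact: smooth_id.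
by apply: smooth_conj; exact: smooth_id.
Qed.

Lemma dop_id s z : dop s (@id C) z = (1 + s * 'i%C) / 2.
Proof. exact: (dop_val s (has_dir_id 1 z) (has_dir_id 'i%C z)). Qed.

Lemma ii : 'i%C * 'i%C = -1 :> C. Proof. by rewrite -expr2 sqr_i. Qed.

(** Liouville's equation, that is, curvature -1. It is computed for the inverse [N], where it reads
    -(1 - |z|^2) - |z|^2 = -1, and carried over by additivity, since [rhoC * N] is constant. *)
Lemma loglap_rho z : disc z -> loglap rhoC z = rhoC z ^+ 2 * rhoC z ^+ 2.
Proof.
move=> zd.
have sc : smooth (fun w : C => (w^*)%C) by exact: (smooth_conj (@smooth_id R)).
have sM := smoothM (@smooth_id R) sc.
pose N w : C := 1 - w * (w^*)%C.
have sN : smooth N by apply: smoothD; [exact: smooth_cst|exact: smoothN].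
have h2 : (2 : C) != 0 by rewrite pnatr_eq0.
have idz w : dz (@id C) w = 1 by rewrite dop_id mulNr ii opprK -[1 + 1]/(2 : C) divff.
have idb w : dzb (@id C) w = 0 by rewrite dop_id ii subrr mul0r.
have cdz w : disc w -> dz (fun w : C => (w^*)%C) w = 0.
  move=> wd; rewrite (dop_conj _ (@smooth_id R)) // (_ : ((- 'i)^*)%C = 'i%C); last first.
    by apply/eqP; rewrite eq_complex /= oppr0 opprK !eqxx.
  by rewrite idb rmorph0.
have cdb w : disc w -> dzb (fun w : C => (w^*)%C) w = 1.
  move=> wd; rewrite (dop_conj _ (@smooth_id R)) // (_ : (('i)^*)%C = - 'i%C); last first.
    by apply/eqP; rewrite eq_complex /= oppr0 !eqxx.
  by rewrite idz rmorph1.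
have Nd s w : disc w -> dop s N w = - (dop s (@id C) w * (w^*)%C + w * dop s (fun w : C => (w^*)%C) w).
  move=> wd; rewrite dopD //; [|exact: smooth_cst|exact: smoothN].
  by rewrite dop_cst add0r dopN // (dopM _ (@smooth_id R)).
have Ndz w : disc w -> dz N w = - (w^*)%C.
  by move=> wd; rewrite Nd // idz cdz // mul1r mulr0 addr0.
have Ndb w : disc w -> dzb N w = - w.
  by move=> wd; rewrite Nd // idb cdb // mulr1 mul0r add0r.
have Nddb : dzb (dz N) z = - 1.
  rewrite (@eq_dop _ 'i%C _ (fun w => - (w^*)%C)) //; last exact: smooth_dop.
  by rewrite dopN // cdb.
have LN : loglap N z = - 1.
  by rewrite /loglap Nddb Ndz // Ndb // /N mulrNN; ring.
have N0 : N z != 0 by exact: rho_den_neq0.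
have := loglapM smooth_rhoC sN zd.
rewrite LN (@loglap_ext _ (fun=> 1)) ?loglap_cst //; last first.
- by move=> w wd; rewrite /rhoC mulVf // rho_den_neq0.
- by apply: smoothM => //; exact: smooth_rhoC.
rewrite -[rhoC z]/((N z)^-1) => /eqP; rewrite mulrN1 addrC eq_sym subr_eq0 => /eqP h.
by apply: (mulfI (expf_neq0 2 N0)); rewrite h mulrA -exprMn divff // expr1n mul1r.
Qed.

End LogLap.

Section ModelMetric.
Variables (R : realType) (n : nat).
Hypothesis n1 : (1 < n)%N.
Local Notation C := (Cplx R).
Local Notation I := 'I_(n + n).
Implicit Types (z : C).

Definition aR (k : nat) : R :=
  (\prod_(1 <= l < n) ((l * (2 * n - 1 - l))%:R / 2)^-1)
  * \prod_(1 <= l < k) ((l * (2 * n - 1 - l))%:R / 2).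

Lemma a_coefE k : a_coef R n k = ((aR k)%:C)%C.
Proof.
have E l : (((l * (2 * n - 1 - l))%:R / 2 : R)%:C)%C = (l * (2 * n - 1 - l))%:R / 2 :> C.
  by rewrite rmorphM fmorphV !rmorph_nat.
rewrite /a_coef /aR rmorphM !rmorph_prod; congr (_ * _).
  by apply: eq_bigr => l _; rewrite -E -fmorphV.
by apply: eq_bigr => l _; rewrite -E.
Qed.

Lemma b_gt0 l : (0 < l < 2 * n - 1)%N -> 0 < (l * (2 * n - 1 - l))%:R / 2 :> R.
Proof. by move=> h; rewrite divr_gt0 // ltr0n muln_gt0; lia. Qed.

Lemma aR_gt0 k : (k < 2 * n)%N -> 0 < aR k.
Proof.
move=> hk; apply: mulr_gt0; rewrite big_nat; apply: prodr_gt0 => l hl.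
  by rewrite invr_gt0 b_gt0 //; lia.
by rewrite b_gt0 //; lia.
Qed.

Lemma aRS k : (0 < k)%N -> aR k.+1 = aR k * ((k * (2 * n - 1 - k))%:R / 2).
Proof. by move=> hk; rewrite /aR big_nat_recr //= mulrA. Qed.

Lemma aRn : aR n = 1.
Proof.
rewrite /aR -big_split big_nat big1 // => l hl /=; rewrite mulVf //.
by apply: lt0r_neq0; apply: b_gt0; lia.
Qed.

(* The Gram coefficient of [h_X] at position [p], for [r] the conformal factor [rho]. *)
Definition dX (r : R) (p : nat) : R :=
  if p == n then 1 else aR (cidx n p).+1 * (2 * r ^+ 2) ^ ((cidx n p)%:Z - (n%:Z - 1)).

Lemma dX_gt0 r p : 0 < r -> (p < n + n)%N -> 0 < dX r p.
Proof.
move=> r0 hp; rewrite /dX; case: eqVneq => // pn.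
rewrite mulr_gt0 ?aR_gt0 ?exprz_gt0 // ?mulr_gt0 ?exprn_gt0 //.
have := cidx_lt n1 pn hp; lia.
Qed.

Lemma pos_neq t : pos n t != n.
Proof. by rewrite /pos; case: ltnP; lia. Qed.
Lemma cidx_pos t : cidx n (pos n t) = t.
Proof. by rewrite /cidx /pos; case: (ltnP t n) => h; [rewrite h|rewrite ifF //; lia]. Qed.
Lemma pos_cidx p : p != n -> pos n (cidx n p) = p.
Proof.
rewrite /cidx /pos; case: (ltnP p n) => h; first by rewrite h.
by move=> pn; rewrite ifF; lia.
Qed.

(** The origin of the constants in [a_coef]: each step along the powers of [K] multiplies the metric
    by c_t rho^2, which is therefore the energy of the corresponding entry 1 of theta under [hX]. *)
Lemma dX_ratio r t : 0 < r -> (t < 2 * n - 2)%N ->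
  dX r (pos n t.+1) = dX r (pos n t) * (ratio_coef R n t * r ^+ 2).
Proof.
move=> r0 ht; rewrite /dX !(negbTE (pos_neq _)) !cidx_pos aRS //.
have -> : (t.+1)%:Z - (n%:Z - 1) = (t%:Z - (n%:Z - 1)) + 1 by lia.
have u : 2 * r ^+ 2 != 0 by rewrite mulf_neq0 ?expf_neq0 ?lt0r_neq0.
rewrite expfzDr // expr1z /ratio_coef.
have -> : (2 * n - 1 - t.+1 = 2 * n - 2 - t)%N by lia.
by move: (_ ^ _) => w; field.
Qed.

Lemma dX_n r : dX r n = 1. Proof. by rewrite /dX eqxx. Qed.
Lemma dX_pred r : dX r n.-1 = 1.
Proof.
rewrite /dX ifF; last by lia.
have -> : cidx n n.-1 = n.-1 by rewrite /cidx ifT; lia.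
have -> : (n.-1)%:Z - (n%:Z - 1) = 0 by lia.
by rewrite prednK ?aRn ?mul1r //; lia.
Qed.

(** Induction outwards from the middle summand [O], using that the coefficients c_t are symmetric
    about the middle of the chain. *)
Lemma dX_pair r j : 0 < r -> (j < n)%N -> dX r (pos n (n.-1 + j)) * dX r (pos n (n.-1 - j)) = 1.
Proof.
move=> r0; elim: j => [|j IH] hj.
  by rewrite addn0 subn0 (_ : pos n n.-1 = n.-1) ?dX_pred ?mulr1 // /pos ifT; lia.
have h1 := @dX_ratio r (n.-1 + j) r0 ltac:(lia).
have h2 := @dX_ratio r (n.-1 - j.+1) r0 ltac:(lia).
have e : ((n.-1 - j.+1).+1 = n.-1 - j)%N by lia.
rewrite e in h2; rewrite addnS h1.
have := IH (ltnW hj); rewrite h2 => <-.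
have -> : ratio_coef R n (n.-1 - j.+1) = ratio_coef R n (n.-1 + j).
  by rewrite /ratio_coef; congr (_%:R); nia.
by ring.
Qed.

Lemma dX_dual r p : 0 < r -> (p < n.-1)%N -> dX r (dual n p) * dX r p = 1.
Proof.
move=> r0 hp; have := @dX_pair r (n.-1 - p) r0 ltac:(lia).
have -> : pos n (n.-1 + (n.-1 - p)) = dual n p.
  rewrite /pos /dual ifF; last by lia.
  by rewrite ifF; lia.
by have -> : pos n (n.-1 - (n.-1 - p)) = p by rewrite /pos ifT; lia.
Qed.

Definition wt_val (a : nat) : int :=
  if (a < n)%N then n%:Z - 1 - 2 * a%:Z
  else if ((a - n).+1 == n)%N then 0 else n%:Z - 2 - 2 * (a - n)%N%:Z.

Lemma wtE (s : I) : wt s = wt_val s.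
Proof.
rewrite /wt /wt_val.
have [a ->|b ->] := split_ordP s.
  by [].
by rewrite /= addKn.
Qed.

Lemma is_extraE (s : I) : is_extra s = (s == (n + n.-1)%N :> nat).
Proof.
rewrite /is_extra.
have [a ->|b ->] := split_ordP s.
  by rewrite /=; have := ltn_ord a; lia.
by rewrite /=; lia.
Qed.

Lemma wt_filt (p : I) : p != n :> nat -> wt (filt p) = n%:Z - 1 - (cidx n p)%:Z.
Proof.
move=> pn; rewrite wtE (filt_valE n1) (filt_chain n1) // /wt_val.
have := cidx_lt n1 pn (ltn_ord p); move: (cidx n p) => t ht.
case: (boolP (odd t)) => ot.
  have -> : (n + t./2 < n)%N = false by lia.
  have -> : ((n + t./2 - n).+1 == n)%N = false by lia.
  lia.
have -> : (t./2 < n)%N by lia.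
lia.
Qed.

Lemma is_extra_filt (p : I) : is_extra (filt p) = (p == n :> nat).
Proof.
rewrite is_extraE (filt_valE n1).
case: (eqVneq (p : nat) n) => [->|pn]; first by rewrite /filt_val !eqxx.
rewrite (filt_chain n1) //; have := cidx_lt n1 pn (ltn_ord p); move: (cidx n p) => t ht.
by case: (boolP (odd t)) => ot; lia.
Qed.

Lemma reo_hX z : reo (hX n z) = diag_mx (\row_(p < n + n) ((dX (rho z) p)%:C)%C).
Proof.
apply/matrixP=> p b; rewrite !mxE (inj_eq (filt_inj n1)).
case: eqVneq => [e|]; last by rewrite !mulr0n.
rewrite !mulr1n is_extra_filt /dX; case: (eqVneq (p : nat) n) => pn; first by [].
rewrite wt_filt // poincareE a_coefE [RHS]rmorphM; congr (_ * _).
  congr ((aR _)%:C)%C; have := cidx_lt n1 pn (ltn_ord p); lia.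
rewrite (_ : - _ = (cidx n p)%:Z - (n%:Z - 1)); last by lia.
by rewrite fmorphXz.
Qed.

End ModelMetric.

(** * Minors of a harmonic metric *)

Section HarmonicMinors.
Variables (R : realType) (m : nat).
Local Notation C := (Cplx R).
Local Notation M := 'M[C]_m.
Local Notation cjC := (@conjc R : {rmorphism (Cplx R) -> (Cplx R)}).
Local Notation hdm k := (@headmx C m k).
Implicit Types (z : C).

Lemma cjC_norm (x : C) : x * cjC x = `|x| ^+ 2. Proof. by rewrite sqr_normc. Qed.

Variables (h T : C -> M).
Hypothesis hs : msmooth h.
Hypothesis hpd : forall z, disc z -> posdef cjC (h z).
Let U z := invmx (conjmx (h z)) *m (conjmx (T z))^T *m conjmx (h z).
Let A z := (mdop (- 'i%C) h z *m invmx (h z))^T.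
Hypothesis hharm : forall z, disc z -> mdop 'i%C A z = T z *m U z - U z *m T z.

Lemma pd_frame z : disc z -> exists N (d : 'rV[C]_m),
  [/\ unitri N, N^T *m h z *m conjmx N = diag_mx d & forall p, 0 < d 0 p].
Proof. by move=> zd; exact: (LDL cjC_norm (hpd zd)). Qed.

Lemma pd_unit z : disc z -> h z \in unitmx.
Proof.
move=> zd; have [N [d [hN hd d0]]] := pd_frame zd.
have : \det (N^T *m h z *m conjmx N) != 0.
  by rewrite hd det_diag; apply/prodf_neq0 => p _; exact: lt0r_neq0.
rewrite !det_mulmx !mulf_eq0 !negb_or => /andP[/andP[_ hh] _].
by rewrite unitmxE unitfE.
Qed.

Lemma conj_pd_unit z : disc z -> conjmx (h z) \in unitmx.
Proof. by move=> zd; have := pd_unit zd; rewrite -(map_unitmx cjC). Qed.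

Lemma adjE z : disc z -> conjmx (h z) *m U z = (conjmx (T z))^T *m conjmx (h z).
Proof. by move=> zd; rewrite /U -mulmxA mulKVmx // conj_pd_unit. Qed.

Lemma msmooth_chern : msmooth A.
Proof.
apply: msmooth_tr; apply: msmoothM; first exact: msmooth_mdop.
by apply: msmoothV => // z zd; exact: pd_unit.
Qed.

Lemma dz_metric z : disc z -> mdop (- 'i%C) h z = (A z)^T *m h z.
Proof. by move=> zd; rewrite /A trmxK mulmxKV // pd_unit. Qed.

Lemma conj_metric z : disc z -> conjmx (h z)^T = h z.
Proof. by move=> zd; have [h1 _] := hpd zd; exact: h1. Qed.

(** The conjugate transpose of [dz_metric], as [h] is Hermitian. *)
Lemma dzb_metric z : disc z -> mdop 'i%C h z = h z *m conjmx (A z).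
Proof.
move=> zd.
have ht := msmooth_tr hs.
rewrite (@eq_mdop _ _ _ _ h (fun w => conjmx (h w)^T)) //; last first.
  by move=> w wd; rewrite conj_metric.
rewrite mdop_conj // (_ : ('i^*)%C = - 'i%C); last first.
  by apply/eqP; rewrite eq_complex /= oppr0 !eqxx.
rewrite mdop_tr // dz_metric // trmx_mul trmxK.
have e : conjmx ((h z)^T *m A z) = conjmx (h z)^T *m conjmx (A z) by exact: (map_mxM cjC).
by rewrite e conj_metric.
Qed.

Lemma dzb_dz_metric z : disc z -> mdop 'i%C (mdop (- 'i%C) h) z =
  (T z *m U z - U z *m T z)^T *m h z + (A z)^T *m h z *m conjmx (A z).
Proof.
move=> zd; have hA := msmooth_chern; have hAt := msmooth_tr hA.
rewrite (@eq_mdop _ 'i%C _ _ _ (fun w => (A w)^T *m h w)) //; last first.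
- by move=> w wd; rewrite dz_metric.
- exact: msmooth_mdop.
have e1 := mdopM 'i%C hAt hs zd.
have e2 := mdop_tr 'i%C hA zd.
by rewrite e1 e2 (hharm zd) (dzb_metric zd) mulmxA.
Qed.

Lemma msmooth_trunc k : msmooth (fun z => trunc k (h z)).
Proof.
move=> i j; case E : ((i < k)%N && (j < k)%N).
  by apply: smooth_ext (hs i j) => z _; rewrite truncE E.
by apply: smooth_ext (smooth_cst ((i == j)%:R)) => z _; rewrite truncE E.
Qed.

Lemma mdop_head s k (B : C -> M) z : msmooth B -> disc z ->
  mdop s (fun w => hdm k *m B w *m hdm k) z = hdm k *m mdop s B z *m hdm k.
Proof.
move=> hB zd; have hc := @msmooth_cst R m m (hdm k).
rewrite mdopM //; last exact: msmoothM.
by rewrite mdop_cst mulmx0 addr0 mdopM // mdop_cst mul0mx add0r.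
Qed.

Lemma mdop_trunc s k z : disc z ->
  mdop s (fun w => trunc k (h w)) z = hdm k *m mdop s h z *m hdm k.
Proof.
move=> zd; rewrite -mdop_head //.
apply/matrixP=> i j; rewrite !mdopE.
case E : ((i < k)%N && (j < k)%N).
  apply: eq_dop => //; first exact: msmooth_trunc.
  move=> w _; rewrite truncE E mulheadE headmxE.
  by move: E => /andP[-> ->]; rewrite mul1r mulr1.
transitivity (dop s (fun=> (i == j)%:R : C) z).
  by apply: eq_dop => //; [exact: msmooth_trunc|move=> w _; rewrite truncE E].
rewrite dop_cst -[LHS](dop_cst s 0 z); apply: eq_dop => //; first exact: smooth_cst.
move=> w _; rewrite mulheadE headmxE.
by move: E => /nandP[/negbTE ->|/negbTE ->]; rewrite ?mul0r ?mulr0.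
Qed.

(** The harmonic equation substituted into the curvature of [det F_k]. The data [N] and [d] belong
    to the single point [z]: derivatives are taken of [h] first and read in the frame afterwards. *)
Lemma loglap_minor k z N (d : 'rV[C]_m) : disc z -> unitri N ->
  N^T *m h z *m conjmx N = diag_mx d -> (forall p, 0 < d 0 p) ->
  loglap (fun w => \det (trunc k (h w))) z = \det (trunc k (h z)) ^+ 2 *
  \sum_(p : 'I_m | (p < k)%N) \sum_(b : 'I_m | (k <= b)%N)
    (m2 N d (T z) p b - m2 N d (T z) b p + m2 N d (A z) b p).
Proof.
move=> zd hN hd d0; have hG := msmooth_trunc k.
have uG w : disc w -> trunc k (h w) \in unitmx.
  move=> wd; have [N' [d' [hN' hd' d0']]] := pd_frame wd.
  exact: (trunc_unit hN' hd' d0').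
have := log_laplacian_det (- 'i%C) 'i%C hG uG zd.
rewrite /loglap => ->; congr (_ * _).
have -> : mdop 'i%C (mdop (- 'i%C) (fun w => trunc k (h w))) z =
    hdm k *m mdop 'i%C (mdop (- 'i%C) h) z *m hdm k.
  rewrite -mdop_head //; last exact: msmooth_mdop.
  apply: eq_mdop => //; first exact: msmooth_mdop.
  by move=> w wd; rewrite mdop_trunc.
rewrite !mdop_trunc // dzb_dz_metric // dzb_metric // dz_metric //.
by have := lap_formula cjC_norm hN hd d0 k (A z) (adjE zd).
Qed.

End HarmonicMinors.

(** * Matrix entries under unitriangular changes of frame *)

Section FrameEntries.
Variables (F : numFieldType) (m : nat).
Implicit Types (N X Y : 'M[F]_m).

Lemma unitri_inv N : unitri N -> unitri (invmx N).
Proof.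
move=> hN; have [N0 N1] := hN; have Nu := unitri_unit hN.
pose X := invmx N.
have XN i j : \sum_a X i a * N a j = (i == j)%:R.
  have := congr1 (fun Y : 'M[F]_m => Y i j) (mulVmx Nu); rewrite !mxE => <-.
  by [].
have X0 : forall i j : 'I_m, (j < i)%N -> X i j = 0.
  move=> i j; move e : (nat_of_ord j) => k; elim/ltn_ind: k i j e => k IH i j e ki.
  have := XN i j; rewrite (bigD1 j) //= N1 mulr1 big1 ?addr0.
    move=> ->; case: eqP => // eij; move: ki; by rewrite eij e ltnn.
  move=> a aj; case: (ltnP a j) => h.
    by rewrite (IH a _ i a) ?mul0r // -?e // (ltn_trans h) ?e.
  by rewrite N0 ?mulr0 // ltn_neqAle eq_sym h andbT.
split=> // i; have := XN i i; rewrite (bigD1 i) //= N1 mulr1 big1 ?addr0 ?eqxx // => a ai.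
case: (ltnP a i) => h; first by rewrite -/X X0 ?mul0r.
by rewrite N0 ?mulr0 // ltn_neqAle eq_sym h andbT.
Qed.

(** Conjugation by an upper unitriangular matrix mixes the entry (i, j) only with entries below it
    or to its left, so it survives unchanged when those vanish. *)
Lemma frame_kept N X (i j : 'I_m) : unitri N ->
  (forall a b : 'I_m, (i <= a)%N -> (b <= j)%N -> (a, b) != (i, j) -> X a b = 0) ->
  frame N X i j = X i j.
Proof.
move=> hN hX; have [N0 N1] := hN; have [V0 V1] := unitri_inv hN.
rewrite /frame mxE (bigD1 j) //= N1 mulr1 [X in _ + X]big1 ?addr0.
  rewrite mxE (bigD1 i) //= V1 mul1r big1 ?addr0 // => a ai.
  case: (ltnP a i) => h; first by rewrite V0 ?mul0r.
  by rewrite hX ?mulr0 // xpair_eqE negb_and ai.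
move=> b bj; case: (ltnP j b) => h; first by rewrite N0 ?mulr0.
rewrite mxE big1 ?mul0r // => a _; case: (ltnP a i) => ha; first by rewrite V0 ?mul0r.
by rewrite hX ?mulr0 // xpair_eqE negb_and bj orbT.
Qed.

Lemma frame_zero N X (i j : 'I_m) : unitri N ->
  (forall a b : 'I_m, (i <= a)%N -> (b <= j)%N -> X a b = 0) -> frame N X i j = 0.
Proof. by move=> hN hX; rewrite frame_kept ?hX // => a b ha hb _; exact: hX. Qed.

Lemma frameK N X : unitri N -> frame (invmx N) (frame N X) = X.
Proof.
move=> /unitri_unit Nu; rewrite /frame invmxK -!mulmxA mulmxV // mulmx1.
by rewrite mulKVmx.
Qed.

Lemma frame_zero_inv N X (i j : 'I_m) : unitri N ->
  (forall a b : 'I_m, (i <= a)%N -> (b <= j)%N -> frame N X a b = 0) -> X i j = 0.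
Proof. by move=> hN hX; rewrite -(frameK X hN); apply: frame_zero => //; exact: unitri_inv. Qed.

End FrameEntries.

(** * Entries of the Higgs field in a unitriangular frame *)

Section ChainEntries.
Variables (R : realType) (n : nat).
Hypothesis n1 : (1 < n)%N.
Local Notation C := (Cplx R).
Local Notation I := 'I_(n + n).
Implicit Types (q : nat -> C).

Lemma pos_lt t : (t < (n + n).-1)%N -> (pos n t < n + n)%N.
Proof. by rewrite /pos; case: (ltnP t n); lia. Qed.

Lemma theta_chain_one q t : (t < (n + n).-2)%N -> theta_entry n q (pos n t.+1) (pos n t) = 1.
Proof.
move=> ht; rewrite /theta_entry (negbTE (pos_neq n1 t.+1)) (negbTE (pos_neq n1 t)).
by rewrite !cidx_pos // eqxx.
Qed.

Lemma theta_chain_zero q t a b : (t < (n + n).-2)%N -> (pos n t.+1 <= a)%N ->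
  (b <= pos n t)%N -> (a, b) != (pos n t.+1, pos n t) -> theta_entry n q a b = 0.
Proof.
move=> ht ha hb; rewrite xpair_eqE => hab; rewrite /theta_entry.
have pt : (pos n t.+1 > 0)%N by rewrite /pos; case: (ltnP t.+1 n).
have pt2 : (pos n t < (n + n).-1)%N by rewrite /pos; case: (ltnP t n); lia.
case: (eqVneq a n) => an.
  by rewrite (_ : (b == (n + n).-1) = false) //; lia.
case: (eqVneq b n) => bn.
  by rewrite (_ : (a == 0) = false) //; lia.
have ca : (t < cidx n a)%N.
  by rewrite -(cidx_pos n1 t.+1) /cidx; case: (ltnP (pos n t.+1) n); case: (ltnP a n); lia.
have cb : (cidx n b <= t)%N.
  by rewrite -(cidx_pos n1 t) /cidx; case: (ltnP (pos n t) n); case: (ltnP b n); lia.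
rewrite (_ : (cidx n a <= cidx n b)%N = false); last by lia.
case: (eqVneq (cidx n a) (cidx n b).+1) => //= e.
have e1 : cidx n b = t by lia.
have e2 : cidx n a = t.+1 by lia.
by move: hab; rewrite -(pos_cidx n1 an) -(pos_cidx n1 bn) e1 e2 !eqxx.
Qed.

Definition theta_mx q : 'M[C]_(n + n) := \matrix_(p, b) theta_entry n q p b.

Lemma frame_theta_one q N t (i j : I) : unitri N -> (t < (n + n).-2)%N ->
  i = pos n t.+1 :> nat -> j = pos n t :> nat -> frame N (theta_mx q) i j = 1.
Proof.
move=> hN ht hi hj; rewrite frame_kept //; first by rewrite mxE hi hj theta_chain_one.
move=> a b ha hb hab; rewrite mxE; apply: (theta_chain_zero q ht); rewrite -?hi -?hj //.
Qed.

(** For [k < n] theta leaves the first [k] summands through the entry 1 at [(k, k.-1)] alone, and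
    this shape does not depend on the frame. *)
Lemma frame_theta_zero q N k (i j : I) : unitri N -> (0 < k < n)%N ->
  (k <= i)%N -> (j < k)%N -> ~~ ((i == k :> nat) && (j == k.-1 :> nat)) -> frame N (theta_mx q) i j = 0.
Proof.
move=> hN hk hi hj hij; apply: frame_zero => // a b ha hb; rewrite mxE.
have p1 : pos n k = k by rewrite /pos ifT; lia.
have p2 : pos n k.-1 = k.-1 by rewrite /pos ifT; lia.
apply: (@theta_chain_zero q k.-1); rewrite ?prednK ?p1 ?p2 ?xpair_eqE; lia.
Qed.

(* Pairing each position with its successor in the chain of powers of [K]. *)
Lemma sum_chain (g : nat -> nat -> R) :
  (forall i j : I, 0 <= g i j) ->
  \sum_(0 <= t < 2 * n - 2) g (pos n t.+1) (pos n t) <= \sum_(i < n + n) \sum_(j < n + n) g i j.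
Proof.
move=> g0.
have hf (t : 'I_(2 * n - 2)) : (pos n t < n + n)%N by apply: pos_lt; have := ltn_ord t; lia.
have hf' (t : 'I_(2 * n - 2)) : (pos n t.+1 < n + n)%N by apply: pos_lt; have := ltn_ord t; lia.
pose f t : I := Ordinal (hf t).
pose f' t : I := Ordinal (hf' t).
have finj : injective f.
  move=> t s /(congr1 (fun i : I => cidx n i)); rewrite /= !cidx_pos //; exact: val_inj.
rewrite big_mkord [X in _ <= X]exchange_big /=.
apply: (@le_trans _ _ (\sum_(t < 2 * n - 2) \sum_(i < n + n) g i (f t))).
  apply: ler_sum => t _; rewrite (bigD1 (f' t)) //= lerDl sumr_ge0 // => i _; exact: (g0 i (f t)).
pose G (j : I) : R := \sum_(i < n + n) g i j.
have -> : \sum_(t < 2 * n - 2) \sum_(i < n + n) g i (f t) = \sum_(j in f @: [set: 'I_(2 * n - 2)]%SET) G j.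
  rewrite big_imset /=; last by move=> t s _ _; exact: finj.
  by apply: eq_bigl => t; rewrite finset.in_setT.
rewrite [X in X <= _]big_mkcond; apply: ler_sum => j _; case: ifP => // _.
by apply: sumr_ge0 => i _; exact: g0.
Qed.

End ChainEntries.

Lemma frame_bracketE (F : numFieldType) m (N X Y : 'M[F]_m) i j : unitri N ->
  frame N (X *m Y - Y *m X) i j =
  \sum_c frame N X i c * frame N Y c j - \sum_c frame N Y i c * frame N X c j.
Proof. by move=> hN; rewrite frameB !(frameM hN) mxE [X in _ + X]mxE !mxE. Qed.

(** In the (b, m) entry of the bracket every product has a vanishing factor except [Y b p * X p m],
    with [X p m = 1]; so [Y b p], a nonzero multiple of the conjugate of [X p b], must vanish. This
    clears the row that the curvature terms do not reach. *)
Lemma bracket_last_row (F : fieldType) (cj : {rmorphism F -> F}) s (X Y w : 'M[F]_s) (m p b : 'I_s) :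
  (forall i j, Y i j = cj (X j i) * w i j) -> w b p != 0 ->
  (forall i j : 'I_s, (i <= m)%N -> (i < j)%N -> X i j = 0) ->
  (forall i j : 'I_s, (p <= i)%N -> (j < p)%N -> (i, j) != (p, m) -> X i j = 0) ->
  X p m = 1 -> p = m.+1 :> nat -> (p < b)%N ->
  \sum_c X b c * Y c m - \sum_c Y b c * X c m = 0 -> X p b = 0.
Proof.
move=> YE wbp up low one ep pb.
rewrite [X in X - _]big1 ?sub0r => [|c _]; last first.
  case: (ltnP m c) => mc; first by rewrite YE (up m c) // rmorph0 mul0r mulr0.
  rewrite (low b c) ?mul0r //; [exact: ltnW|by rewrite ep ltnS|].
  by apply/eqP => -[h1 _]; move: pb; rewrite h1 ltnn.
rewrite (bigD1 p) //= one mulr1 big1 ?addr0 => [|c cp]; last first.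
  case: (ltnP c p) => hc.
    rewrite YE (up c b) ?rmorph0 ?mul0r //; first by rewrite -ltnS -ep.
    exact: ltn_trans pb.
  rewrite (low c m) ?mulr0 //; first by rewrite ep.
  by apply: contra cp => /eqP[->].
by rewrite YE => /eqP; rewrite oppr_eq0 mulf_eq0 fmorph_eq0 (negbTE wbp) orbF => /eqP.
Qed.

(** * The energy inequality and its equality case *)

Section Core.
Variables (R : realType) (n : nat).
Hypothesis n1 : (1 < n)%N.
Local Notation C := (Cplx R).
Local Notation I := 'I_(n + n).
Local Notation M := 'M[C]_(n + n).
Local Notation cjC := (@conjc R : {rmorphism (Cplx R) -> (Cplx R)}).
Local Notation dz := (dop (- 'i%C)).
Local Notation dzb := (dop 'i%C).
Implicit Types (z : C) (k : nat).

Variables (q : nat -> C -> C) (h : C -> M).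
Let T z : M := theta_mx n (fun k => q k z).
Hypothesis hs : msmooth h.
Hypothesis hpd : forall z, disc z -> posdef cjC (h z).
Let U z := invmx (conjmx (h z)) *m (conjmx (T z))^T *m conjmx (h z).
Let A z := (mdop (- 'i%C) h z *m invmx (h z))^T.
Hypothesis hharm : forall z, disc z -> mdop 'i%C A z = T z *m U z - U z *m T z.
Hypothesis hdet : forall z, disc z -> \det (h z) = 1.
Definition DX k (r : R) : R := \prod_(0 <= p < k) dX n r p.
Hypothesis hdom : forall z k, disc z -> (k <= n + n)%N ->
  \det (trunc k (h z)) <= ((DX k (rho z))%:C)%C.

Lemma DX_gt0 k z : disc z -> (k <= n + n)%N -> 0 < DX k (rho z).
Proof.
move=> zd hk; rewrite /DX big_nat; apply: prodr_gt0 => p /andP[_ hp].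
by apply: dX_gt0 => //; [exact: rho_gt0|exact: leq_trans hk].
Qed.

Lemma dX_dual_all (r : R) (p : nat) : 0 < r -> (p < n + n)%N -> dX n r (dual n p) * dX n r p = 1.
Proof.
move=> r0 hp; case: (ltnP p n.-1) => h1; first exact: dX_dual.
case: (eqVneq p n.-1) => [->|h2].
  by rewrite /dual eqxx /= dX_pred // mulr1.
case: (eqVneq p n) => [->|h3].
  by rewrite /dual eqxx orbT /= dX_n mulr1.
have := @dX_dual R n n1 r (dual n p) r0.
rewrite (dualK n1) // mulrC; apply.
by rewrite /dual (negbTE h2) (negbTE h3) /=; lia.
Qed.

(** Dual positions contribute inverse factors, so the square of the product is 1. *)
Lemma DX_full (r : R) : 0 < r -> DX (n + n) r = 1.
Proof.
move=> r0; have p0 : 0 < DX (n + n) r.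
  rewrite /DX big_nat; apply: prodr_gt0 => p /andP[_ hp]; exact: dX_gt0.
apply/eqP; rewrite -(@eqrXn2 _ 2) ?ler01 ?ltW // expr1n expr2; apply/eqP.
rewrite /DX big_mkord {1}(reindex (dualI n1)) /=; last first.
  by apply: onW_bij; exists (dualI n1) => p; apply/val_inj => /=; rewrite dualK.
rewrite -big_split big1 // => p _; exact: dX_dual_all.
Qed.

Definition minor_ratio k z : R := complex.Re (\det (trunc k (h z))) / DX k (rho z).

Lemma minor_gt0 k z : disc z -> 0 < \det (trunc k (h z)).
Proof.
move=> zd; have [N [d [hN hd d0]]] := pd_frame hpd zd; exact: (det_trunc_gt0 hN hd d0).
Qed.

Lemma pos_real (x : C) : 0 < x -> x = ((complex.Re x)%:C)%C /\ 0 < complex.Re x.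
Proof. by case: x => a b; rewrite ltcE /= => /andP[/eqP -> ->]. Qed.

Lemma minorE k z : disc z -> (k <= n + n)%N ->
  \det (trunc k (h z)) = ((minor_ratio k z * DX k (rho z))%:C)%C.
Proof.
move=> zd hk; rewrite /minor_ratio mulfVK ?lt0r_neq0 ?DX_gt0 //.
by have [] := pos_real (minor_gt0 k zd).
Qed.

Lemma minor_ratio_gt0 k z : disc z -> (k <= n + n)%N -> 0 < minor_ratio k z.
Proof.
by move=> zd hk; rewrite divr_gt0 ?DX_gt0 //; have [] := pos_real (minor_gt0 k zd).
Qed.

Lemma minor_ratio_le1 k z : disc z -> (k <= n + n)%N -> minor_ratio k z <= 1.
Proof.
move=> zd hk; rewrite ler_pdivrMr ?DX_gt0 // mul1r -lecR.
by have [<- _] := pos_real (minor_gt0 k zd); exact: hdom.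
Qed.

Section Point.
Variables (z : C) (N : M) (d : 'rV[C]_(n + n)).
Hypotheses (zd : disc z) (hN : unitri N) (hd : N^T *m h z *m conjmx N = diag_mx d)
  (d0 : forall p, 0 < d 0 p).

(** The default 1 outside the range keeps [rr] positive at every natural number, as [ratio_energy]
    asks. *)
Definition rr (p : nat) : R := oapp (fun i : I => complex.Re (d 0 i) / dX n (rho z) i) 1 (insub p).

Lemma rr_gt0 p : 0 < rr p.
Proof.
rewrite /rr; case: insubP => //= i _ _; rewrite divr_gt0 //.
  by have [] := pos_real (d0 i).
by apply: dX_gt0 => //; exact: rho_gt0.
Qed.

Lemma rrE (i : I) : d 0 i = ((rr i * dX n (rho z) i)%:C)%C.
Proof.
rewrite /rr (_ : insub (i : nat) = Some i) /=; last exact: valK.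
have [e _] := pos_real (d0 i).
by rewrite mulfVK //; apply: lt0r_neq0; apply: dX_gt0 => //; exact: rho_gt0.
Qed.

Lemma prod_rr k : (k <= n + n)%N -> \prod_(0 <= p < k) rr p = minor_ratio k z.
Proof.
move=> hk; have hX : DX k (rho z) != 0 by exact: lt0r_neq0 (DX_gt0 zd hk).
apply: (mulIf hX); rewrite /minor_ratio mulfVK //.
rewrite (det_trunc k hN hd) /DX -big_split /= big_mkord (big_ord_widen (n + n) (fun p => rr p * dX n (rho z) p)) //.
rewrite (eq_bigr (fun i : I => ((rr i * dX n (rho z) i)%:C)%C)); last by move=> i _; exact: rrE.
by rewrite -rmorph_prod.
Qed.

Lemma m2_real X (i j : I) : exists2 x : R, 0 <= x & m2 N d X i j = (x%:C)%C.
Proof.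
have := m2_ge0 N d0 X i j; case: (m2 _ _ _ _ _) => a b; rewrite lecE /= => /andP[/eqP -> ha].
by exists a.
Qed.

Lemma m2_chain t (i j : I) : (t < 2 * n - 2)%N -> i = pos n t.+1 :> nat -> j = pos n t :> nat ->
  m2 N d (T z) i j = ((ratio_coef R n t * rho z ^+ 2 * (rr (pos n t.+1) / rr (pos n t)))%:C)%C.
Proof.
move=> ht hi hj; rewrite /m2 (frame_theta_one n1 _ hN _ hi hj); last by lia.
rewrite normr1 expr1n mul1r !rrE hi hj dX_ratio ?rho_gt0 // -fmorphV -rmorphM /=.
congr (_%:C)%C.
have h1 := lt0r_neq0 (rr_gt0 (pos n t)).
have h2 : dX n (rho z) (pos n t) != 0.
  by rewrite -hj; apply: lt0r_neq0; apply: dX_gt0 => //; exact: rho_gt0.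
by field; rewrite h1 h2.
Qed.

(** All entries contribute nonnegatively to the trace, and only those joining consecutive powers of
    [K] are kept. *)
Lemma energy_bound :
  rho z ^+ 2 * \sum_(0 <= t < 2 * n - 2) ratio_coef R n t *
     (rr (pos n t.+1) / rr (pos n t)) <= complex.Re (\tr (T z *m U z)).
Proof.
(* Extension by 0 to natural-number indices, the form in which [sum_chain] takes its summand. *)
pose g (i j : nat) : R := oapp (fun i : I => oapp (fun j : I => complex.Re (m2 N d (T z) i j)) 0 (insub j)) 0 (insub i).
have gE (i j : I) : g i j = complex.Re (m2 N d (T z) i j).
  rewrite /g (_ : insub (i : nat) = Some i) /=; last exact: valK.
  by rewrite (_ : insub (j : nat) = Some j) /=; last exact: valK.
have -> : complex.Re (\tr (T z *m U z)) = \sum_(i < n + n) \sum_(j < n + n) g i j.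
  have aE : conjmx (h z) *m U z = (conjmx (T z))^T *m conjmx (h z) by apply: adjE.
  rewrite (mxtrace_adj (cjC_norm (R := R)) hN hd d0 aE).
  rewrite (raddf_sum (@complex.Re R : Rcomplex R -> R)); apply: eq_bigr => i _.
  rewrite (raddf_sum (@complex.Re R : Rcomplex R -> R)); apply: eq_bigr => j _.
  by rewrite gE.
have g0 (i j : I) : 0 <= g i j by rewrite gE; have [x x0 ->] := m2_real (T z) i j.
apply: le_trans (sum_chain n1 g0).
rewrite mulr_sumr !big_nat; apply: ler_sum => t /andP[_ ht].
have hi : (pos n t.+1 < n + n)%N by apply: pos_lt => //; lia.
have hj : (pos n t < n + n)%N by apply: pos_lt => //; lia.
have e := gE (Ordinal hi) (Ordinal hj); rewrite /= in e.
by rewrite e (@m2_chain t) //= mulrCA mulrA.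
Qed.
End Point.

Lemma energy_ge z : disc z ->
  rho z ^+ 2 * \sum_(0 <= t < 2 * n - 2) ratio_coef R n t <= complex.Re (\tr (T z *m U z)) /\
  (complex.Re (\tr (T z *m U z)) = rho z ^+ 2 * \sum_(0 <= t < 2 * n - 2) ratio_coef R n t ->
   forall k, (k < n)%N -> minor_ratio k z = 1).
Proof.
move=> zd; have [N [d [hN hd d0]]] := pd_frame hpd zd.
have hb := energy_bound zd hN hd d0.
have p0 : forall p, 0 < rr z d p by move=> p; exact: rr_gt0.
have ple : forall k, (k <= n + n)%N -> \prod_(0 <= p < k) rr z d p <= 1.
  by move=> k hk; rewrite (prod_rr zd hN hd d0) // minor_ratio_le1.
have p1 : \prod_(0 <= p < n + n) rr z d p = 1.
  rewrite (prod_rr zd hN hd d0) // /minor_ratio DX_full ?rho_gt0 // divr1.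
  have -> : trunc (n + n) (h z) = h z by apply/matrixP=> i j; rewrite truncE !ltn_ord.
  by rewrite hdet.
have [r1 r2] := ratio_energy n1 p0 ple p1.
have rp : 0 < rho z ^+ 2 by rewrite exprn_gt0 // rho_gt0.
split; first by apply: le_trans hb; rewrite ler_pM2l.
move=> heq k kn; rewrite -(prod_rr zd hN hd d0); last by lia.
apply: r2 => //; apply/eqP; rewrite eq_le r1 andbT.
by rewrite heq ler_pM2l // in hb.
Qed.

(* [(DX k (rho z))^-1] as a polynomial in [rhoC], hence visibly smooth. *)
Definition Einv k z : C :=
  \prod_(p < k) (((aR R n p.+1)^-1)%:C%C * \prod_(i < n.-1 - p) (2 * (rhoC z * rhoC z))).

Lemma smooth_2rho : smooth (fun z : C => 2 * (rhoC z * rhoC z)).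
Proof.
apply: smoothM; first exact: smooth_cst.
by apply: smoothM; exact: smooth_rhoC.
Qed.

Lemma smooth_Einv k : smooth (Einv k).
Proof.
apply: smooth_prod => p; apply: smoothM; first exact: smooth_cst.
by apply: smooth_prod => i; exact: smooth_2rho.
Qed.

Lemma EinvE k z : disc z -> (k <= n)%N -> Einv k z = (((DX k (rho z))^-1)%:C)%C.
Proof.
move=> zd hk; rewrite /Einv /DX big_mkord -prodfV rmorph_prod; apply: eq_bigr => p _.
have hp : (p < n)%N by exact: leq_trans (ltn_ord p) hk.
rewrite /dX ifF; last by lia.
have -> : cidx n p = p by rewrite /cidx hp.
have -> : (p : nat)%:Z - (n%:Z - 1) = - ((n.-1 - p)%N)%:Z by lia.
rewrite [in RHS]invfM invr_expz opprK [RHS]rmorphM; congr (_ * _).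
rewrite prodr_const card_ord /= rhoCE -exprnP rmorphXn; congr (_ ^+ _).
by rewrite rmorphM rmorph_nat rmorphXn.
Qed.

Lemma sum_weights k : (k <= n)%N ->
  \sum_(p < k) \sum_(i < n.-1 - p) (2 : C) = (k * (2 * n - 1 - k))%:R.
Proof.
elim: k => [|k IH] hk; first by rewrite big_ord0.
rewrite big_ord_recr /= IH ?(ltnW hk) // sumr_const card_ord -mulrnA -natrD.
by congr (_%:R); nia.
Qed.

(** For [k > 0] the constant is the sum of the exponents 2(n - 1 - p) for [p < k], and it coincides
    with the chain coefficient c_(k-1); this balances the equation for [e_k] when all ratios are
    1. *)
Lemma loglap_Einv k z : disc z -> (k <= n)%N ->
  loglap (Einv k) z = (k * (2 * n - 1 - k))%:R * rhoC z ^+ 2 * Einv k z ^+ 2.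
Proof.
move=> zd hk.
have l2 : loglap (fun z : C => 2 * (rhoC z * rhoC z)) z =
    2 * rhoC z ^+ 2 * (2 * (rhoC z * rhoC z)) ^+ 2.
  have sr := @smooth_rhoC R; have srr := smoothM sr sr.
  rewrite (loglapM (smooth_cst 2) srr zd) loglap_cst // mulr0 addr0.
  rewrite (loglapM sr sr zd) loglap_rho //; move: (rhoC z) => r; ring.
have lp p : loglap (fun w => \prod_(i < n.-1 - p) (2 * (rhoC w * rhoC w))) z =
   (\sum_(i < n.-1 - p) (2 * rhoC z ^+ 2)) * (\prod_(i < n.-1 - p) (2 * (rhoC z * rhoC z))) ^+ 2.
  exact: (loglap_prod _ (fun _ => smooth_2rho) zd (fun _ => l2)).
pose F (p : 'I_k) (w : C) : C := ((aR R n p.+1)^-1)%:C%C * \prod_(i < n.-1 - p) (2 * (rhoC w * rhoC w)).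
have sF p : smooth (F p).
  apply: smoothM; first exact: smooth_cst.
  by apply: smooth_prod => i; exact: smooth_2rho.
have lF p : loglap (F p) z = (\sum_(i < n.-1 - p) (2 * rhoC z ^+ 2)) * F p z ^+ 2.
  have sp : smooth (fun w : C => \prod_(i < n.-1 - p) (2 * (rhoC w * rhoC w)) : C).
    exact: (@smooth_prod R _ (index_enum 'I_(n.-1 - p)) xpredT _ (fun _ => smooth_2rho)).
  rewrite /F (loglapM (smooth_cst _) sp zd) loglap_cst // mulr0 addr0 lp.
  by rewrite exprMn mulrCA.
have -> : loglap (Einv k) z = (\sum_(p < k) \sum_(i < n.-1 - p) (2 * rhoC z ^+ 2)) * Einv k z ^+ 2.
  exact: (loglap_prod (index_enum 'I_k) sF zd lF).
congr (_ * _); rewrite -sum_weights // mulr_suml; apply: eq_bigr => p _.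
by rewrite mulr_suml.
Qed.

(* The smooth complex-valued version of [minor_ratio k]. *)
Definition eC k z : C := \det (trunc k (h z)) * Einv k z.

Lemma smooth_eC k : smooth (eC k).
Proof.
by apply: smoothM; [exact: smooth_det (msmooth_trunc hs k)|exact: smooth_Einv].
Qed.

Lemma eCE k z : disc z -> (k <= n)%N -> eC k z = ((minor_ratio k z)%:C)%C.
Proof.
move=> zd hk; rewrite /eC EinvE // minorE //; last by lia.
rewrite -rmorphM /= mulfK //; apply: lt0r_neq0; apply: DX_gt0 => //; lia.
Qed.

(** The nonnegative terms in the curvature of [det F_k] that the inequality discards: the entries of
    theta that map into [F_k] from outside it, and its second fundamental form. *)
Definition excess N (d : 'rV[C]_(n + n)) k z : C :=
  \sum_(p : I | (p < k)%N) \sum_(b : I | (k <= b)%N) (m2 N d (T z) p b + m2 N d (A z) b p).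

Lemma ratio_coef_pred k : (0 < k)%N -> ratio_coef R n k.-1 = (k * (2 * n - 1 - k))%:R.
Proof. by move=> hk; rewrite /ratio_coef prednK //; congr (_%:R); congr (_ * _)%N; lia. Qed.

(** Of the entries of theta leaving [F_k] only the one at [(k, k.-1)] is nonzero. It is the sole
    negative term, and its size is c_(k-1) rho^2 times the quotient of two successive ratios [rr],
    that is, e_(k+1) e_(k-1) / e_k^2. *)
Lemma loglap_eC k z N (d : 'rV[C]_(n + n)) : disc z -> (0 < k < n)%N -> unitri N ->
  N^T *m h z *m conjmx N = diag_mx d -> (forall p, 0 < d 0 p) ->
  loglap (eC k) z = ((minor_ratio k z ^+ 2)%:C)%C * excess N d k z +
   (((k * (2 * n - 1 - k))%:R * rho z ^+ 2 *
     (minor_ratio k z ^+ 2 - minor_ratio k.+1 z * minor_ratio k.-1 z))%:C)%C.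
Proof.
move=> zd hk hN hd d0.
have sG : smooth (fun w => \det (trunc k (h w))) by exact: smooth_det (msmooth_trunc hs k).
have hkn : (k <= n)%N by lia.
rewrite /eC (loglapM sG (smooth_Einv k) zd) loglap_Einv //.
have -> := loglap_minor hs hpd hharm k zd hN hd d0.
have hk0 : (k < n + n)%N by lia.
have hk1 : (k.-1 < n + n)%N by lia.
have [i0 hi0] : exists i0 : I, i0 = k :> nat by exists (Ordinal hk0).
have [j0 hj0] : exists j0 : I, j0 = k.-1 :> nat by exists (Ordinal hk1).
have hs1 : \sum_(p : I | (p < k)%N) \sum_(b : I | (k <= b)%N) m2 N d (T z) b p = m2 N d (T z) i0 j0.
  rewrite (bigD1 j0) /=; last by rewrite hj0; lia.
  have hki : (k <= i0)%N by rewrite hi0.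
  rewrite [X in X + _](bigD1 i0 hki) /=.
  rewrite [X in _ + X + _]big1 ?addr0.
    rewrite big1 ?addr0 // => p /andP[pk pj]; rewrite big1 // => b kb.
    rewrite /m2 (frame_theta_zero n1 _ hN hk kb pk) ?normr0 ?expr0n ?mul0r //.
    by apply/negP => /andP[_ /eqP e]; move/eqP: pj; apply; apply/val_inj; rewrite /= e hj0.
  move=> b /andP[kb bi]; rewrite /m2 (frame_theta_zero n1 _ hN hk kb).
  - by rewrite normr0 expr0n mul0r.
  - by rewrite hj0; lia.
  - by apply/negP => /andP[/eqP e _]; move/eqP: bi; apply; apply/val_inj; rewrite /= e hi0.
have pk1 : pos n k.-1.+1 = k by rewrite /pos prednK ?ifT; lia.
have pk2 : pos n k.-1 = k.-1 by rewrite /pos ifT; lia.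
have hm : m2 N d (T z) i0 j0 = (((k * (2 * n - 1 - k))%:R * rho z ^+ 2 *
     (rr z d k / rr z d k.-1))%:C)%C.
  rewrite (@m2_chain z N d zd hN d0 k.-1) ?pk1 ?pk2 //; last by lia.
  by rewrite ratio_coef_pred //; lia.
have -> : \sum_(p : I | (p < k)%N) \sum_(b : I | (k <= b)%N)
    (m2 N d (T z) p b - m2 N d (T z) b p + m2 N d (A z) b p) =
    excess N d k z - m2 N d (T z) i0 j0.
  rewrite -hs1 /excess -sumrB; apply: eq_bigr => p _; rewrite -sumrB; apply: eq_bigr => b _.
  by rewrite addrAC.
rewrite hm.
have ek : minor_ratio k z != 0 by apply: lt0r_neq0; apply: minor_ratio_gt0 => //; lia.
have ek1 : minor_ratio k.-1 z != 0 by apply: lt0r_neq0; apply: minor_ratio_gt0 => //; lia.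
have h1 : rr z d k = minor_ratio k.+1 z / minor_ratio k z.
  rewrite -!(prod_rr zd hN hd d0); [|lia|lia].
  rewrite big_nat_recr //= mulrAC divff ?mul1r //.
  by rewrite (prod_rr zd hN hd d0) //; lia.
have h2 : rr z d k.-1 = minor_ratio k z / minor_ratio k.-1 z.
  rewrite -!(prod_rr zd hN hd d0); [|lia|lia].
  rewrite -{2}(@prednK k); last by lia.
  rewrite big_nat_recr //= mulrAC divff ?mul1r //.
  by rewrite (prod_rr zd hN hd d0) //; lia.
have hE : \det (trunc k (h z)) * Einv k z = ((minor_ratio k z)%:C)%C by exact: eCE.
have key (D E X a c x y : C) : y != 0 -> x != 0 -> D * E = y ->
   D ^+ 2 * (c * E ^+ 2) + E ^+ 2 * (D ^+ 2 * (X - c * (a / y / (y / x)))) =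
   y ^+ 2 * X + c * (y ^+ 2 - a * x).
  move=> y0 x0 e.
  have -> : D ^+ 2 * (c * E ^+ 2) + E ^+ 2 * (D ^+ 2 * (X - c * (a / y / (y / x)))) =
     (D * E) ^+ 2 * (c + X - c * (a / y / (y / x))) by ring.
  by rewrite e; field; rewrite x0 y0.
have := @key (\det (trunc k (h z))) (Einv k z) (excess N d k z) ((minor_ratio k.+1 z)%:C)%C
  ((k * (2 * n - 1 - k))%:R * rhoC z ^+ 2) ((minor_ratio k.-1 z)%:C)%C ((minor_ratio k z)%:C)%C.
rewrite !fmorph_eq0 => /(_ ek ek1 hE) e.
have eL : (((k * (2 * n - 1 - k))%:R * rho z ^+ 2 * (rr z d k / rr z d k.-1))%:C)%C =
    (k * (2 * n - 1 - k))%:R * rhoC z ^+ 2 * (((minor_ratio k.+1 z)%:C)%C / ((minor_ratio k z)%:C)%C /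
      (((minor_ratio k z)%:C)%C / ((minor_ratio k.-1 z)%:C)%C)).
  by rewrite h1 h2 rhoCE !(rmorphM, fmorphV, rmorphXn, rmorph_nat).
have eR : (((k * (2 * n - 1 - k))%:R * rho z ^+ 2 *
     (minor_ratio k z ^+ 2 - minor_ratio k.+1 z * minor_ratio k.-1 z))%:C)%C =
    (k * (2 * n - 1 - k))%:R * rhoC z ^+ 2 * (((minor_ratio k z)%:C)%C ^+ 2 -
      ((minor_ratio k.+1 z)%:C)%C * ((minor_ratio k.-1 z)%:C)%C).
  by rewrite rhoCE !(rmorphM, rmorphB, rmorphXn, rmorph_nat).
have eS : ((minor_ratio k z ^+ 2)%:C)%C = ((minor_ratio k z)%:C)%C ^+ 2 by rewrite rmorphXn.
by rewrite eL eR eS.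
Qed.

Lemma excess_ge0 N (d : 'rV[C]_(n + n)) k z : (forall p, 0 < d 0 p) -> 0 <= excess N d k z.
Proof.
move=> d0; apply: sumr_ge0 => p _; apply: sumr_ge0 => b _.
by rewrite addr_ge0 // m2_ge0.
Qed.

Lemma Re_loglap_eC k z : disc z -> (0 < k < n)%N ->
  (k * (2 * n - 1 - k))%:R * rho z ^+ 2 * (minor_ratio k z ^+ 2 - 1) <=
  complex.Re (loglap (eC k) z).
Proof.
move=> zd hk; have [N [d [hN hd d0]]] := pd_frame hpd zd.
rewrite (loglap_eC zd hk hN hd d0).
have := excess_ge0 N k z d0; case: (excess _ _ _ _) => x y; rewrite lecE => /andP[_ x0].
rewrite cReD cReM /= mul0r subr0.
have ha : minor_ratio k.+1 z <= 1 by apply: minor_ratio_le1 => //; lia.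
have hb : minor_ratio k.-1 z <= 1 by apply: minor_ratio_le1 => //; lia.
have ha0 : 0 < minor_ratio k.+1 z by apply: minor_ratio_gt0 => //; lia.
have hb0 : 0 < minor_ratio k.-1 z by apply: minor_ratio_gt0 => //; lia.
have hc : minor_ratio k.+1 z * minor_ratio k.-1 z <= 1 by rewrite mulr_ile1 // ltW.
rewrite -[X in X <= _]add0r; apply: lerD.
  by rewrite mulr_ge0 // sqr_ge0.
apply: ler_wpM2l; first by rewrite mulr_ge0 ?ler0n ?sqr_ge0.
by rewrite lerD2l lerN2.
Qed.

Lemma Re_normc (x : C) : 0 <= complex.Re (((x^*)%C) * x).
Proof. by case: x => a b; rewrite cReM /= mulNr opprK addr_ge0 // -expr2 sqr_ge0. Qed.

(** Nonnegative on the disc for [k <= n], zero exactly where [e_k = 1], and smooth because it is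
    polynomial in [eC]. *)
Definition defect k (z : C) : C := 1 - eC k z * eC k z.

Lemma smooth_defect k : smooth (defect k).
Proof.
apply: smoothD; first exact: smooth_cst.
by apply: smoothN; apply: smoothM; exact: smooth_eC.
Qed.

Lemma defectE k z : disc z -> (k <= n)%N -> defect k z = ((1 - minor_ratio k z ^+ 2)%:C)%C.
Proof. by move=> zd hk; rewrite /defect eCE // -rmorphM /= -expr2 rmorphB rmorph1. Qed.

(** The mixed derivative of e^2 is 2 [loglap] e + 4 |d_z e|^2; the gradient term has the favourable
    sign and is dropped. The constant 8 is this 2 times the 4 relating [lap] to the Wirtinger
    derivatives. *)
Lemma lap_defect k z : disc z -> (0 < k < n)%N ->
  lap (defect k) z <= 8 * (k * (2 * n - 1 - k))%:R * rho z ^+ 2 * complex.Re (defect k z).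
Proof.
move=> zd hk; have hkn : (k <= n)%N by lia.
have sf := smooth_defect k; have se := smooth_eC k; have see := smoothM se se.
have fr w : disc w -> complex.Im (defect k w) = 0 by move=> wd; rewrite defectE.
rewrite -(Re_dop_dop sf zd fr).
have e1 : dzb (dz (defect k)) z = - (2 * loglap (eC k) z + 4 * (dzb (eC k) z * dz (eC k) z)).
  have hw w : disc w -> dz (defect k) w = - dz (fun w => eC k w * eC k w) w.
    move=> wd; rewrite /defect dopD //; [|exact: smooth_cst|exact: smoothN].
    by rewrite dop_cst add0r dopN.
  rewrite (eq_dop _ (smooth_dop _ sf) zd hw) dopN //; last exact: smooth_dop.
  rewrite (dop2M se se zd) /loglap.
  move: (eC k z) (dz (eC k) z) (dzb (eC k) z) (dzb (dz (eC k)) z) => a b c e; ring.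
have e2 : dzb (eC k) z = ((dz (eC k) z)^*)%C.
  have hw w : disc w -> eC k w = ((eC k w)^*)%C by move=> wd; rewrite eCE // conjc_real.
  rewrite (eq_dop _ se zd hw) (dop_conj _ se) // (_ : ('i^*)%C = - 'i%C) //.
  by apply/eqP; rewrite eq_complex /= oppr0 !eqxx.
rewrite e1 e2 defectE //=.
have := Re_normc (dz (eC k) z); move: (((dz (eC k) z)^*)%C * dz (eC k) z) => y y0.
have := Re_loglap_eC zd hk; move: (loglap (eC k) z) => x.
have -> : 2 * x + 4 * y = x + x + (y + y + (y + y)) by ring.
rewrite cReN !cReD; move: (complex.Re x) (complex.Re y) y0 => x1 y1 y0.
move: (_%:R) (rho z ^+ 2) (minor_ratio k z ^+ 2) => c r e hx; nra.
Qed.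

Lemma rho_bound (r : R) : r < 1 -> exists B, forall z, nrm z <= r -> rho z ^+ 2 <= B.
Proof.
move=> r1; case: (ltP r 0) => r0.
  by exists 0 => z zr; have := lt_le_trans (le_lt_trans zr r0) (nrm_ge0 z); rewrite ltxx.
exists ((1 - r ^+ 2)^-1 ^+ 2) => z zr.
have hp : 0 < 1 - r ^+ 2 by rewrite subr_gt0 expr_lt1.
have hr : 1 - r ^+ 2 <= 1 - n2 z by rewrite lerD2l lerN2 n2_le.
have hn : 0 < 1 - n2 z by exact: lt_le_trans hr.
by rewrite /rho lerXn2r ?nnegrE ?invr_ge0 ?(ltW hp) ?(ltW hn) // lef_pV2.
Qed.

Lemma minor_ratio_rigid k z0 : disc z0 -> (0 < k < n)%N -> minor_ratio k z0 = 1 ->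
  forall z, disc z -> minor_ratio k z = 1.
Proof.
move=> zd0 hk e0 z zd; have hkn : (k <= n)%N by lia.
have f0 w : disc w -> 0 <= complex.Re (defect k w).
  move=> wd; rewrite defectE //= subr_ge0 expr_le1 //; first by apply: minor_ratio_le1 => //; lia.
  by apply: ltW; apply: minor_ratio_gt0 => //; lia.
have : complex.Re (defect k z) = 0.
  apply: (strong_max (smooth_defect k) f0 _ zd0) => //; last first.
    by rewrite defectE // e0 expr1n subrr.
  move=> r r1; have [B hB] := rho_bound r1.
  exists (8 * (k * (2 * n - 1 - k))%:R * B) => w wr.
  have wd : disc w by apply/discE; exact: le_lt_trans r1.
  apply: le_trans (lap_defect wd hk) _.
  by rewrite ler_wpM2r ?f0 // ler_wpM2l ?hB // mulr_ge0 // ler0n.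
rewrite defectE //= => /eqP; rewrite subr_eq0 eq_sym => /eqP e.
apply/eqP; rewrite -(@eqrXn2 _ 2) ?e ?expr1n //.
by apply: ltW; apply: minor_ratio_gt0 => //; lia.
Qed.

(** * Consequences of equality on the whole disc *)

Section Rigid.
Hypothesis hone : forall z k, disc z -> (k < n)%N -> minor_ratio k z = 1.

(** With [e_k] and [e_(k-1)] identically 1 the equation reads 0 = excess + c (1 - e_(k+1)), a sum of
    nonnegative terms. For [k = n - 1] this yields the missing [e_n = 1]. *)
Lemma rigid_excess k z N (d : 'rV[C]_(n + n)) : disc z -> (0 < k < n)%N -> unitri N ->
  N^T *m h z *m conjmx N = diag_mx d -> (forall p, 0 < d 0 p) ->
  excess N d k z = 0 /\ minor_ratio k.+1 z = 1.
Proof.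
move=> zd hk hN hd d0; have hkn : (k < n)%N by lia.
have e0 : loglap (eC k) z = 0.
  rewrite (@loglap_ext _ _ (fun=> 1)) ?loglap_cst //; first exact: smooth_eC.
  by move=> w wd; rewrite (eCE wd (ltnW hkn)) (hone wd hkn) rmorph1.
have := loglap_eC zd hk hN hd d0; rewrite e0 (hone zd hkn) (hone zd (leq_ltn_trans (leq_pred k) hkn)).
rewrite expr1n mulr1.
have := excess_ge0 N k z d0; case: (excess _ _ _ _) => x y; rewrite lecE /= => /andP[/eqP -> x0].
have h1 : minor_ratio k.+1 z <= 1 by apply: minor_ratio_le1 => //; lia.
have h2 : 0 < (k * (2 * n - 1 - k))%:R :> R by rewrite ltr0n muln_gt0; lia.
have h3 : 0 < rho z ^+ 2 by rewrite exprn_gt0 // rho_gt0.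
have hc := mulr_gt0 h2 h3; move: (_ * rho z ^+ 2) hc => c c0.
move=> /(congr1 (@complex.Re R)); rewrite cReD cReM /= mul0r subr0 mul1r.
move: (minor_ratio _ _) h1 => e e1 he.
have e2 : c * (1 - e) >= 0 by rewrite mulr_ge0 ?(ltW c0) // subr_ge0.
have x1 : x = 0 by lra.
have : c * (1 - e) = 0 by lra.
move=> /eqP; rewrite mulf_eq0 (gt_eqF c0) /= subr_eq0 => /eqP <-.
by rewrite x1.
Qed.

Lemma rigid_minor z : disc z -> minor_ratio n z = 1.
Proof.
move=> zd; have [N [d [hN hd d0]]] := pd_frame hpd zd.
have hk : (0 < n.-1 < n)%N by lia.
by have [_] := rigid_excess zd hk hN hd d0; rewrite prednK //; lia.
Qed.

Section RigidPoint.
Variables (z : C) (N : M) (d : 'rV[C]_(n + n)).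
Hypotheses (zd : disc z) (hN : unitri N) (hd : N^T *m h z *m conjmx N = diag_mx d)
  (d0 : forall p, 0 < d 0 p).

Lemma m2_eq0 (X : M) (a b : I) : m2 N d X a b = 0 -> frame N X a b = 0.
Proof.
move/eqP; rewrite /m2 mulf_eq0 expf_eq0 /= normr_eq0 => /orP[/eqP //|].
by rewrite gt_eqF // divr_gt0.
Qed.

Lemma rigid_frame (p b : I) : (p < b)%N -> (p.+1 < n)%N ->
  frame N (T z) p b = 0 /\ frame N (A z) b p = 0.
Proof.
move=> pb pn; have hk : (0 < p.+1 < n)%N by lia.
have [ex _] := rigid_excess zd hk hN hd d0; move/eqP: ex.
rewrite /excess psumr_eq0; last first.
  by move=> a _; apply: sumr_ge0 => c _; rewrite addr_ge0 // m2_ge0.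
move=> /allP/(_ p (mem_index_enum _)); rewrite ltnSn /= psumr_eq0; last first.
  by move=> c _; rewrite addr_ge0 // m2_ge0.
move=> /allP/(_ b (mem_index_enum _)); rewrite pb /= paddr_eq0 ?m2_ge0 //.
by move=> /andP[/eqP h1 /eqP h2]; split; [exact: m2_eq0 h1|exact: m2_eq0 h2].
Qed.

(** A vanishing lower left region is invariant under unitriangular changes of frame. Stated in the
    fixed frame, the vanishing can be differentiated. *)
Lemma rigid_chern (p b : I) : (p < b)%N -> (p.+1 < n)%N -> A z b p = 0.
Proof.
move=> pb pn; apply: (frame_zero_inv hN) => a c ha hc.
by have [] := @rigid_frame c a (leq_ltn_trans hc (leq_trans pb ha)) (@leq_ltn_trans p.+1 c.+1 n hc pn).
Qed.
End RigidPoint.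

Lemma rigid_bracket z (p b : I) : disc z -> (p < b)%N -> (p.+1 < n)%N ->
  (T z *m U z - U z *m T z) b p = 0.
Proof.
move=> zd pb pn; rewrite -hharm // mdopE.
have sA : smooth (fun w => A w b p) := msmooth_chern hs hpd b p.
rewrite (@eq_dop _ _ _ (fun=> 0) _ sA zd) ?dop_cst // => w wd.
by have [N [d [hN hd d0]]] := pd_frame hpd wd; exact: rigid_chern hN hd d0 _ _ _ _.
Qed.

(** Rows [p] with [p.+1 < n] come from the vanishing excess. The last row, [p = n.-1], comes from
    the bracket in column [m = n - 2], which vanishes as the derivative of an identically zero
    connection entry. *)
Lemma rigid_frame_theta z N (d : 'rV[C]_(n + n)) (p b : I) : disc z -> unitri N ->
  N^T *m h z *m conjmx N = diag_mx d -> (forall p, 0 < d 0 p) ->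
  (p < b)%N -> (p < n)%N -> frame N (T z) p b = 0.
Proof.
move=> zd hN hd d0 pb pn.
have aE : conjmx (h z) *m U z = (conjmx (T z))^T *m conjmx (h z) by apply: adjE.
have fU := frame_adjE (cjC_norm (R := R)) hN hd d0 aE.
case: (ltnP p.+1 n) => pn1; first by have [] := rigid_frame zd hN hd d0 pb pn1.
have ep : p = n.-1 :> nat by lia.
have hm : (n - 2 < n + n)%N by lia.
have [m em] : exists m : I, m = (n - 2)%N :> nat by exists (Ordinal hm).
have mn : (m.+1 < n)%N by lia.
have low (a c : I) : (n.-1 <= a)%N -> (c < n.-1)%N -> (a, c) != (p, m) -> frame N (T z) a c = 0.
  move=> ha hc hac; apply: (@frame_theta_zero _ n n1 _ N n.-1) => //; first by lia.
  apply/negP => /andP[/eqP h1 /eqP h2]; move/eqP: hac; apply; congr pair; apply/val_inj => /=; lia.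
have one : frame N (T z) p m = 1.
  apply: (@frame_theta_one _ n n1 _ N (n - 2)) => //; first by lia.
    by rewrite /pos ifT; lia.
  by rewrite /pos ifT; lia.
have br : frame N (T z *m U z - U z *m T z) b m = 0.
  apply: frame_zero => // a c ha hc; apply: rigid_bracket => //.
    by apply: leq_ltn_trans hc _; apply: leq_trans ha; lia.
  by apply: leq_ltn_trans mn; rewrite ltnS.
have {}br := etrans (esym (frame_bracketE (T z) (U z) b m hN)) br.
pose w : M := \matrix_(i, j) (d 0 j / d 0 i).
have fU' i j : frame N (U z) i j = cjC (frame N (T z) j i) * w i j by rewrite [w i j]mxE; exact: fU.
have ep' : p = m.+1 :> nat by lia.
have w0 : w b p != 0 by rewrite mxE gt_eqF // divr_gt0.
have up' (i j : I) : (i <= m)%N -> (i < j)%N -> frame N (T z) i j = 0.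
  by move=> im ij; have [] := rigid_frame zd hN hd d0 ij (@leq_ltn_trans m.+1 i.+1 n im mn).
have low' (i j : I) : (p <= i)%N -> (j < p)%N -> (i, j) != (p, m) -> frame N (T z) i j = 0.
  by move=> pi jp; apply: low; rewrite -ep.
exact: bracket_last_row fU' w0 up' low' one ep' pb br.
Qed.

(** Taking adjoints turns vanishing to the right of the diagonal into vanishing below it, a shape
    that survives the return to the fixed frame. *)
Lemma rigid_adjoint z (a b : I) : disc z -> (b < a)%N -> (b < n)%N -> U z a b = 0.
Proof.
move=> zd ba bn; have [N [d [hN hd d0]]] := pd_frame hpd zd.
have aE : conjmx (h z) *m U z = (conjmx (T z))^T *m conjmx (h z) by apply: adjE.
apply: (frame_zero_inv hN) => a' b' ha hb.
rewrite (frame_adjE (cjC_norm (R := R)) hN hd d0 aE).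
rewrite (rigid_frame_theta zd hN hd d0) ?rmorph0 ?mul0r //; last exact: leq_ltn_trans bn.
exact: leq_ltn_trans hb (leq_trans ba ha).
Qed.

End Rigid.

End Core.

(** * Pointwise rigidity *)

Lemma posdef_diag (F : numFieldType) (cj : {rmorphism F -> F}) m (h : 'M[F]_m) a :
  posdef cj h -> 0 < h a a.
Proof.
move=> [_ hp]; have e0 : (delta_mx a 0 : 'cV[F]_m) != 0.
  by apply/eqP => /matrixP/(_ a 0); rewrite !mxE !eqxx => /eqP; rewrite oner_eq0.
have := hp _ e0; rewrite trmx_delta -rowE mxE (bigD1 a) //= big1 ?addr0.
  by rewrite !mxE !eqxx rmorph1 mulr1.
by move=> j ja; rewrite !mxE (negbTE ja) rmorph0 mulr0.
Qed.

Lemma mulmx_entry (F : pzRingType) m p s (X : 'M[F]_(m, p)) (Y : 'M[F]_(p, s)) i j :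
  (X *m Y) i j = \sum_c X i c * Y c j.
Proof. by rewrite mxE. Qed.

Section Pointwise.
Variables (R : realType) (n : nat).
Hypothesis n1 : (1 < n)%N.
Local Notation C := (Cplx R).
Local Notation I := 'I_(n + n).
Local Notation M := 'M[C]_(n + n).
Local Notation cjC := (@conjc R : {rmorphism (Cplx R) -> (Cplx R)}).
Local Notation J := (Jmx R n).

Lemma mulJ (X : M) a b : (J *m X) a b = X (dualI n1 a) b.
Proof.
rewrite mxE (bigD1 (dualI n1 a)) //= big1 ?addr0; first by rewrite (JmxE R n1) eqxx mul1r.
by move=> c ca; rewrite (JmxE R n1) (negbTE ca) mul0r.
Qed.

Lemma dualIK : involutive (dualI n1).
Proof. by move=> p; apply/val_inj; rewrite /= (dualK n1). Qed.

Lemma Jsym : J^T = J.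
Proof.
apply/matrixP=> a b; rewrite mxE !(JmxE R n1) -[X in (X == _)%:R](dualIK a).
by rewrite (inj_eq (can_inj dualIK)) eq_sym.
Qed.

Lemma mulrJ (X : M) a b : (X *m J) a b = X a (dualI n1 b).
Proof. by rewrite -[X *m J]trmxK trmx_mul Jsym mxE mulJ mxE. Qed.

Lemma Jconj : conjmx J = J.
Proof. by apply/matrixP=> a b; rewrite mxE (JmxE R n1) rmorph_nat. Qed.

Variable q : nat -> C.
Local Notation T := (theta_mx n q).

Lemma theta_entry_dual (a b : nat) : (a < n + n)%N -> (b < n + n)%N ->
  theta_entry n q (dual n a) (dual n b) = theta_entry n q b a.
Proof.
move=> ha hb; rewrite /theta_entry.
have dn : dual n n = n by rewrite /dual eqxx orbT.
case: (eqVneq b n) => [->|bn].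
  rewrite dn eqxx; case: (eqVneq a n) => [->|an].
    by rewrite dn eqxx; congr (if _ then _ else _); lia.
  have [] := cidx_dual n1 ha an => /negbTE -> _.
  by congr (if _ then _ else _); rewrite /dual (negbTE an) orbF; case: (eqVneq a n.-1); lia.
have [dbn cb] := cidx_dual n1 hb bn; rewrite (negbTE dbn).
case: (eqVneq a n) => [->|an].
  rewrite dn eqxx.
  by congr (if _ then _ else _); rewrite /dual (negbTE bn) orbF; case: (eqVneq b n.-1); lia.
have [dan ca] := cidx_dual n1 ha an; rewrite (negbTE dan) ca cb.
have := cidx_lt n1 an ha; have := cidx_lt n1 bn hb; move: (cidx n a) (cidx n b) => t s ht hs.
have -> : ((n + n).-2 - t == ((n + n).-2 - s).+1)%N = (s == t.+1) by lia.
have -> : ((n + n).-2 - s - ((n + n).-2 - t) = t - s)%N by lia.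
by have -> : ((n + n).-2 - t <= (n + n).-2 - s)%N = (s <= t)%N by lia.
Qed.

Lemma theta_mx_sym : T^T *m J = J *m T.
Proof.
apply/matrixP=> a b; rewrite mulrJ mulJ !mxE.
by rewrite -[in LHS](dualIK a) /= theta_entry_dual // dual_lt.
Qed.

Lemma theta_entry_par (a b : nat) : vpar n a = vpar n b -> theta_entry n q a b = 0.
Proof.
rewrite /vpar /theta_entry; case: (eqVneq a n) => [->|an]; case: (eqVneq b n) => [->|bn] //=.
- by case: eqP => //; lia.
- case: eqP => // -> /esym/negbFE; rewrite /cidx; case: ltnP; lia.
- by case: eqP => // -> /negbFE; rewrite /cidx ifT //; lia.
- move: (cidx n a) (cidx n b) => t s h; case: eqP => [e|_]; first by move: h; rewrite e /=; case: odd.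
  by case: ifP => // /andP[ts]; rewrite oddB // => o; move: h o; do 2 case: odd.
Qed.

Variables h U : M.
Hypotheses (hpd : posdef cjC h) (hU : conjmx h *m U = (conjmx T)^T *m conjmx h)
  (hJ : h *m J *m h^T = J)
  (hpar : forall a b : I, vpar n a != vpar n b -> h a b = 0)
  (hlow : forall a b : I, (b < a)%N -> (b < n)%N -> U a b = 0).

Lemma JJ : J *m J = 1%:M.
Proof. by apply/matrixP=> a b; rewrite mulJ (JmxE R n1) dualIK mxE eq_sym. Qed.

Lemma h_unit : h \in unitmx.
Proof.
have e : h *m (J *m h^T *m J) = 1%:M by rewrite !mulmxA hJ JJ.
by have [u _] := mulmx1_unit e.
Qed.

(** Theta is symmetric for the pairing [J] and [h] is compatible with it, so the adjoint is
    symmetric too: [U J = J U^T]. *)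
Lemma adjoint_dual (a b : I) : U a (dualI n1 b) = U b (dualI n1 a).
Proof.
have cu : conjmx h \in unitmx by rewrite map_unitmx h_unit.
have ct : (conjmx T)^T *m J = J *m conjmx T.
  by rewrite -Jconj map_trmx -!map_mxM theta_mx_sym.
have cJ : conjmx h *m J *m (conjmx h)^T = J by rewrite -Jconj map_trmx -!map_mxM hJ.
have e : conjmx h *m (J *m U^T) *m (conjmx h)^T = conjmx h *m (U *m J) *m (conjmx h)^T.
  rewrite -!mulmxA -trmx_mul hU trmx_mul trmxK (mulmxA _ J) (mulmxA _ _ (conjmx T)) cJ.
  by rewrite (mulmxA (conjmx h) U) hU -!mulmxA (mulmxA _ J) cJ ct.
have cut : (conjmx h)^T \in unitmx by rewrite unitmx_tr.
have {}e : J *m U^T = U *m J.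
  apply: (can_inj (mulKmx cu)); exact: (can_inj (mulmxK cut)).
by rewrite -mulrJ -e mulJ mxE.
Qed.

Definition parmx : M := diag_mx (\row_p (if vpar n p then 1 else -1)).

Lemma mulpar (X : M) a b : (parmx *m X *m parmx) a b = if vpar n a == vpar n b then X a b else - X a b.
Proof.
rewrite mul_mx_diag mxE mul_diag_mx !mxE.
by do 2 case: (vpar n _) => /=; rewrite ?mul1r ?mulr1 ?mulN1r ?mulrN1 ?opprK.
Qed.

Lemma parK : parmx *m parmx = 1%:M.
Proof.
rewrite /parmx mulmx_diag -diag_const_mx; congr diag_mx; apply/rowP=> i; rewrite !mxE.
by case: ifP; rewrite ?mulr1 ?mulrNN ?mulr1.
Qed.

(** Theta anticommutes with the grading [parmx] by [V] and [W] while [h] commutes with it; hence the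
    adjoint anticommutes as well and has zero diagonal. *)
Lemma adjoint_par (a : I) : U a a = 0.
Proof.
have cu : conjmx h \in unitmx by rewrite map_unitmx h_unit.
have ph : parmx *m conjmx h *m parmx = conjmx h.
  apply/matrixP=> x y; rewrite mulpar; case: eqVneq => // hxy.
  by rewrite mxE hpar // rmorph0 oppr0.
have pT : parmx *m (conjmx T)^T *m parmx = - (conjmx T)^T.
  apply/matrixP=> x y; rewrite mulpar !mxE; case: eqVneq => // hxy.
  by rewrite theta_entry_par ?rmorph0 ?oppr0.
have e : conjmx h *m (parmx *m U *m parmx) = conjmx h *m (- U).
  rewrite mulmxN hU -mulNmx -pT -{2}ph -{1}ph.
  have E (X Y : M) : parmx *m X *m parmx *m (parmx *m Y *m parmx) = parmx *m (X *m Y) *m parmx.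
    by rewrite !mulmxA -(mulmxA _ parmx parmx) parK mulmx1.
  exact: etrans (E _ _) (etrans (congr1 (fun X => parmx *m X *m parmx) hU) (esym (E _ _))).
have /matrixP/(_ a a) := can_inj (mulKmx cu) e.
by rewrite mulpar eqxx mxE => /esym/eqP; rewrite eqNr => /eqP.
Qed.

(** Below the diagonal, columns from [n] on are reflected by the pairing into columns before [n.-1],
    where [hlow] applies. *)
Lemma adjoint_upper (a b : I) : (b <= a)%N -> U a b = 0.
Proof.
rewrite leq_eqVlt => /orP[/eqP/val_inj ->|ba]; first exact: adjoint_par.
case: (ltnP b n) => bn; first exact: hlow.
rewrite -(dualIK b) adjoint_dual.
have an : a != n :> nat by lia.
have a1 : (a == n.-1 :> nat) = false by lia.
have da : dualI n1 a = ((n + n).-1 - a)%N :> nat by rewrite /= /dual a1 (negbTE an).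
have db : (dualI n1 a < dualI n1 b)%N.
  rewrite da /= /dual; case: ifP; first by lia.
  have := ltn_ord a; lia.
apply: hlow => //; rewrite da; lia.
Qed.

Local Notation V := (conjmx U).

Lemma upperV (a b : I) : (b <= a)%N -> V a b = 0.
Proof. by move=> ba; rewrite mxE adjoint_upper // rmorph0. Qed.

Lemma theta_h : T^T *m h = h *m V.
Proof.
have := congr1 (fun X : M => conjmx X) hU; rewrite /Defs.conjmx !map_mxM map_trmx.
by rewrite !(cjmxK (cjC_norm (R := R))).
Qed.

Lemma theta_h_sum (s j : I) : \sum_p T p s * h p j = \sum_c h s c * V c j.
Proof.
have /matrixP/(_ s j) := theta_h; rewrite !mulmx_entry => <-.
by apply: eq_bigr => p _; rewrite [in RHS]mxE.
Qed.

(** Compare the entry in row [n] and column 0 of [theta_h]: column 0 of the strictly upper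
    triangular [V] is 0, and the left side is [q n * h 0 0] with [h 0 0 > 0]. *)
Lemma qn_eq0 : q n = 0.
Proof.
have h0 : (0 < n + n)%N by lia.
have hn : (n < n + n)%N by lia.
have := theta_h_sum (Ordinal hn) (Ordinal h0).
rewrite [RHS]big1 => [|c _]; last by rewrite upperV ?mulr0.
rewrite (bigD1 (Ordinal h0)) //= big1 ?addr0 => [|p p0]; last first.
  rewrite mxE /theta_entry /= eqxx; case: eqVneq => [e|e].
    by rewrite ifF ?mul0r //; lia.
  by rewrite ifF ?mul0r //; apply: contraNF p0 => /eqP h'; apply/eqP/val_inj.
rewrite mxE /theta_entry /= eqxx ifF; last by lia.
move/eqP; rewrite mulf_eq0 => /orP[/eqP //|].
by rewrite gt_eqF // (posdef_diag _ hpd).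
Qed.

Hypothesis q0n : q n = 0.

(* [T] is conjugate to a strictly triangular matrix, hence nilpotent; its orbit
   of the first basis vector reads off the first nonzero [q i] as the
   coefficient of a Toeplitz matrix. *)
Definition orbit_vec k : 'cV[C]_(n + n) :=
  iter k (mulmx T) (\col_p ((p : nat) == 0%N)%:R).

(** Through [h^T] the action of [T] becomes that of the strictly lower triangular [V^T], which
    clears one more leading coordinate each time. *)
Lemma orbit_vec_top k (a : I) : (a < k)%N -> (h^T *m orbit_vec k) a 0 = 0.
Proof.
elim: k a => // k IH a ak.
have hT : h^T *m T = V^T *m h^T by rewrite -trmx_mul -theta_h trmx_mul trmxK.
rewrite /orbit_vec iterS -/(orbit_vec k) mulmxA hT -mulmxA mulmx_entry big1 // => c _.
case: (ltnP c a) => ca; first by rewrite IH ?mulr0 //; exact: leq_trans ca _.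
by rewrite mxE upperV ?mul0r.
Qed.

Lemma orbit_vec_eq0 : orbit_vec (n + n) = 0.
Proof.
have hu : h^T \in unitmx by rewrite unitmx_tr h_unit.
apply: (can_inj (mulKmx hu)); rewrite mulmx0; apply/matrixP => a j.
by rewrite ord1 orbit_vec_top // mxE.
Qed.

Definition shift_part (y : 'cV[C]_(n + n)) t : C :=
  \sum_(c : I | (c != n :> nat) && (t == (cidx n c).+1)) y c 0.
Definition toeplitz_part (y : 'cV[C]_(n + n)) t : C :=
  \sum_(c : I | [&& c != n :> nat, (t <= cidx n c)%N & odd (cidx n c - t)])
    q ((cidx n c - t).+1./2) * y c 0.

Lemma theta_mul y (a : I) : a != n :> nat ->
  (T *m y) a 0 = shift_part y (cidx n a) + toeplitz_part y (cidx n a).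
Proof.
move=> an; rewrite mulmx_entry /shift_part /toeplitz_part !(big_mkcond (fun c => _ && _)) /= -big_split /=.
apply: eq_bigr => c _; rewrite mxE /theta_entry (negbTE an).
case: (eqVneq (c : nat) n) => cn /=.
  by rewrite q0n if_same mul0r addr0.
case: (eqVneq (cidx n a) (cidx n c).+1) => e; last first.
  by rewrite add0r; case: ifP => _; rewrite ?mul0r.
by rewrite mul1r (_ : (cidx n a <= cidx n c)%N = false) ?addr0 // e ltnn.
Qed.

Lemma shift_part0 y : shift_part y 0 = 0.
Proof. by rewrite /shift_part big_pred0 // => c; rewrite andbF. Qed.

Lemma cidx_injI (a c : I) : a != n :> nat -> c != n :> nat -> cidx n a = cidx n c -> a = c.
Proof. by move=> an cn e; apply/val_inj; rewrite /= -(pos_cidx n1 an) e (pos_cidx n1 cn). Qed.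

Lemma shift_partS y (c : I) : c != n :> nat -> shift_part y (cidx n c).+1 = y c 0.
Proof.
move=> cn; rewrite /shift_part (bigD1 c) ?cn ?eqxx //= big1 ?addr0 // => b.
by rewrite eqSS => /andP[/andP[bn /eqP e]] /eqP[]; exact: cidx_injI.
Qed.

Lemma exists_cidx t : (t < (n + n).-1)%N -> exists2 c : I, c != n :> nat & cidx n c = t.
Proof.
move=> ht; exists (Ordinal (pos_lt n1 ht)); first exact: pos_neq.
by rewrite /= cidx_pos.
Qed.

Section Induction.
Variable i : nat.
Hypotheses (hi : (0 < i < n)%N) (hq : forall j, (0 < j < i)%N -> q j = 0).

Lemma toeplitz_part0 (y : 'cV[C]_(n + n)) k t :
  (forall c : I, c != n :> nat -> (k < cidx n c)%N -> y c 0 = 0) ->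
  (k.+1 < t + 2 * i)%N -> toeplitz_part y t = 0.
Proof.
move=> hy ht; rewrite /toeplitz_part big1 // => c /and3P[cn tc o].
case: (ltnP (cidx n c - t).+1./2 i) => hj; first by rewrite hq ?mul0r //; lia.
by rewrite hy ?mulr0 //; lia.
Qed.

Lemma toeplitz_part1 (y : 'cV[C]_(n + n)) k (a c : I) : c != n :> nat -> cidx n c = k ->
  (forall c : I, c != n :> nat -> (k < cidx n c)%N -> y c 0 = 0) ->
  k.+1 = (cidx n a + 2 * i)%N -> toeplitz_part y (cidx n a) = q i * y c 0.
Proof.
move=> cn ck hy ht; rewrite /toeplitz_part (bigD1 c) /=; last by rewrite cn; lia.
have -> : uphalf (cidx n c - cidx n a) = i by rewrite uphalfE; lia.
rewrite big1 ?addr0 // => b /andP[/and3P[bn tb o] bc].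
rewrite uphalfE; case: (ltnP (cidx n b - cidx n a).+1./2 i) => hj; first by rewrite hq ?mul0r //; lia.
rewrite hy ?mulr0 // -ck ltn_neqAle; apply/andP; split; last by lia.
by apply: contra bc => /eqP/(cidx_injI cn bn) ->.
Qed.

(** The 1's raise the chain index by 1 and [q i] lowers it by 2i - 1, so one use of [q i] in [k]
    steps leads to index k - 2i. The factor counts the moments at which the index is high enough to
    be lowered. *)
Lemma orbit_vecE k : (k < n + n)%N -> forall a : I, a != n :> nat ->
  ((k < cidx n a + 2 * i)%N -> orbit_vec k a 0 = (cidx n a == k)%:R) /\
  (k = (cidx n a + 2 * i)%N -> orbit_vec k a 0 = (cidx n a).+1%:R * q i).
Proof.
elim: k => [|k IH] hk a an.
  split=> [_|]; last by lia.
  rewrite mxE; congr (nat_of_bool _)%:R; rewrite /cidx; case: ltnP => //; lia.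
have hk' : (k < n + n)%N by lia.
have hy : forall c : I, c != n :> nat -> (k < cidx n c)%N -> orbit_vec k c 0 = 0.
  move=> c cn kc; have [yc _] := IH hk' c cn; rewrite yc; last by lia.
  by rewrite gtn_eqF.
have eS : orbit_vec k.+1 = T *m orbit_vec k by [].
have ca := cidx_lt n1 an (ltn_ord a).
rewrite eS theta_mul //; split=> [h1|h1].
  rewrite (toeplitz_part0 hy h1) addr0.
  case e : (cidx n a) => [|t]; first by rewrite shift_part0.
  have [|c cn ec] := @exists_cidx t; first by lia.
  rewrite -ec shift_partS //; have [yc _] := IH hk' c cn; rewrite yc; last by lia.
  by rewrite eqSS.
have [|c cn ec] := @exists_cidx k; first by lia.
rewrite (toeplitz_part1 cn ec hy h1); have [yc _] := IH hk' c cn; rewrite yc; last by lia.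
rewrite ec eqxx mulr1.
case e : (cidx n a) => [|t]; first by rewrite shift_part0 add0r mul1r.
have [|b bn eb] := @exists_cidx t; first by lia.
rewrite -eb shift_partS //; have [_ yb] := IH hk' b bn; rewrite yb; last by lia.
by rewrite -[in RHS]natr1 mulrDl mul1r.
Qed.

Lemma qi_eq0 : q i = 0.
Proof.
(* At this index the vector [T^(2n) e_0 = 0] has coordinate [(2n - 2i) q i]: it is shifted from the
   previous index, and the coefficients [q j] that could still reach it have [j < i]. *)
have [|a an ea] := @exists_cidx (n + n - 2 * i); first by lia.
have [|c cn ec] := @exists_cidx (n + n - 2 * i).-1; first by lia.
have hk : ((n + n).-1 < n + n)%N by lia.
have hy : forall c : I, c != n :> nat -> ((n + n).-1 < cidx n c)%N -> orbit_vec (n + n).-1 c 0 = 0.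
  move=> b bn; have := cidx_lt n1 bn (ltn_ord b); lia.
have eS : orbit_vec (n + n) = T *m orbit_vec (n + n).-1.
  have e : (n + n = (n + n).-1.+1)%N by lia.
  exact: (congr1 orbit_vec e).
have := congr1 (fun X : 'cV[C]_(n + n) => X a 0) orbit_vec_eq0.
rewrite eS theta_mul // mxE ea.
have ts : toeplitz_part (orbit_vec (n + n).-1) (n + n - 2 * i) = 0.
  rewrite /toeplitz_part big1 // => b /and3P[bn tb o].
  have := cidx_lt n1 bn (ltn_ord b) => hb.
  by rewrite hq ?mul0r //; lia.
rewrite ts addr0.
have -> : (n + n - 2 * i = (cidx n c).+1)%N by lia.
rewrite shift_partS //; have [_ yc] := orbit_vecE hk cn; rewrite yc; last by lia.
move/eqP; rewrite mulf_eq0 => /orP[|/eqP //].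
by rewrite pnatr_eq0.
Qed.
End Induction.

Lemma q_eq0 i : (0 < i < n)%N -> q i = 0.
Proof.
elim/ltn_ind: i => i IH hi; apply: qi_eq0 => // j hj; apply: IH; lia.
Qed.

Section Diagonal.
Hypothesis q0 : forall i, (0 < i < n)%N -> q i = 0.

Lemma theta_entry0 (a b : nat) : (a < n + n)%N -> (b < n + n)%N ->
  theta_entry n q a b = [&& a != n, b != n & cidx n a == (cidx n b).+1]%:R.
Proof.
move=> ha hb; rewrite /theta_entry; case: (eqVneq a n) => [_|an] /=; first by rewrite q0n if_same.
case: (eqVneq b n) => [_|bn] /=; first by rewrite q0n if_same.
case: eqP => // _; case: ifP => // /andP[h1 h2]; apply: q0.
have := cidx_lt n1 an ha; have := cidx_lt n1 bn hb; lia.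
Qed.

Lemma h_herm (a b : I) : h a b = ((h b a)^*)%C.
Proof. by have [hh _] := hpd; rewrite -{1}hh !mxE. Qed.

(** Induction on the column. With [s] the predecessor of [a] in the chain, [theta_h] writes [h a j]
    as a combination of the [h s c] with [c < j], which vanish already. *)
Lemma h_column (a j : I) : (j < n)%N -> (j < a)%N -> a != n :> nat -> h a j = 0.
Proof.
move e : (nat_of_ord j) => k; elim/ltn_ind: k a j e => k IH a j e jn ja an.
have ca := cidx_lt n1 an (ltn_ord a).
have [|s sn es] := @exists_cidx (cidx n a).-1; first by lia.
have ca0 : (0 < cidx n a)%N by rewrite /cidx; case: (ltnP a n); lia.
have cas : cidx n a = (cidx n s).+1 by lia.
have js : (k <= s)%N by move: cas; rewrite /cidx; case: (ltnP a n); case: (ltnP s n); lia.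
have := theta_h_sum s j; rewrite (bigD1 a) //= big1 ?addr0 => [|p pa]; last first.
  rewrite mxE theta_entry0 // -cas; case: (boolP [&& _, _ & _]) => [/and3P[pn _ /eqP e']|_].
    by move: pa; rewrite (cidx_injI pn an e') eqxx.
  by rewrite mul0r.
rewrite mxE theta_entry0 // an sn cas eqxx mul1r => ->.
apply: big1 => c _; case: (ltnP c j) => cj; last by rewrite upperV ?mulr0.
rewrite (IH c _ s c) ?mul0r //; rewrite -?e; lia.
Qed.

Lemma h_row (j c : I) : (j < n)%N -> c != j -> c != n :> nat -> h j c = 0.
Proof.
move=> jn cj cn; case: (ltnP j c) => jc; first by rewrite h_herm h_column ?rmorph0.
apply: h_column => //; [by apply: leq_ltn_trans jn| |by apply/eqP; lia].
by rewrite ltn_neqAle jc andbT.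
Qed.

Variable r : R.
Hypotheses (r0 : 0 < r)
  (hmin : forall k, (k <= n)%N -> \det (trunc k h) = ((DX n k r)%:C)%C).

Lemma h_diag_low (p : I) : (p < n)%N -> h p p = ((dX n r p)%:C)%C.
Proof.
move=> pn; have hk k : (k <= n)%N -> \det (trunc k h) = \prod_(a < n + n | (a < k)%N) h a a.
  move=> kn; have -> : trunc k h = diag_mx (\row_a (if (a < k)%N then h a a else 1)).
    apply/matrixP=> a b; rewrite truncE !mxE; case: (eqVneq a b) => [->|ab].
      by rewrite andbb mulr1n.
    rewrite mulr0n; case: ifP => // /andP[ak bk]; apply: h_row; [lia|by rewrite eq_sym|lia].
  rewrite det_diag [RHS]big_mkcond; apply: eq_bigr => a _; by rewrite mxE.
have h1 := hmin (ltnW pn); have h2 := hmin pn; rewrite hk // in h2; rewrite hk ?(ltnW pn) // in h1.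
have e : \prod_(a < n + n | (a < p.+1)%N) h a a = h p p * \prod_(a < n + n | (a < p)%N) h a a.
  rewrite (bigD1 p) //=; congr (_ * _); apply: eq_bigl => a.
  by rewrite ltnS -val_eqE /= [RHS]ltn_neqAle andbC.
rewrite e h1 /DX big_nat_recr //= rmorphM mulrC in h2.
apply: (mulfI _ h2); rewrite fmorph_eq0 big_nat; apply: lt0r_neq0; apply: prodr_gt0 => c /andP[_ cp].
by apply: dX_gt0 => //; lia.
Qed.

Lemma h_compat (a b : I) : \sum_c h a c * h b (dualI n1 c) = J a b.
Proof.
rewrite -hJ -mulmxA mulmx_entry; apply: eq_bigr => c _; congr (_ * _).
by rewrite mulJ mxE.
Qed.

Lemma dualIE (p : I) : dualI n1 p =
  (if (p == n.-1 :> nat) || (p == n :> nat) then (p : nat) else ((n + n).-1 - p)%N) :> nat.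
Proof. by []. Qed.

(** The compatibility relation at [(j, j)] gives a zero square directly when [j < n.-1]. For
    [j = n.-1], the summand [O], the sum of the squares of [h j j] and [h j c] is 1, while
    [h j j = 1]. *)
Lemma h_row_extra (j c : I) : (j < n)%N -> c = n :> nat -> h j c = 0.
Proof.
move=> jn cn; have jc : j != c by apply: contraTneq jn => ->; rewrite cn ltnn.
have dc : dualI n1 c = c by apply/ord_inj; rewrite dualIE cn eqxx orbT.
have neqn (b : I) : b != c -> b != n :> nat.
  by apply: contra => /eqP e; apply/eqP/ord_inj; rewrite e cn.
have := h_compat j j; rewrite (bigD1 c) //= dc.
case: (eqVneq (j : nat) n.-1) => jp.
  have dj : dualI n1 j = j by apply/ord_inj; rewrite dualIE jp eqxx.
  rewrite (bigD1 j) //= dj big1 => [|b /andP[bc bj]].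
    rewrite (JmxE R n1) dj eqxx h_diag_low // jp dX_pred // mulr1 addr0 => /eqP.
    by rewrite -subr_eq0 addrK mulf_eq0 orbb => /eqP.
  by rewrite h_row ?mul0r // neqn.
have dj : dualI n1 j = ((n + n).-1 - j)%N :> nat by rewrite dualIE (negbTE jp) ifF //; lia.
have jdj : dualI n1 j != j by apply: contraTneq jn => e; rewrite e in dj; lia.
rewrite (JmxE R n1) eq_sym (negbTE jdj) big1 => [|b bc].
  by rewrite addr0 => /eqP; rewrite mulf_eq0 orbb => /eqP.
case: (eqVneq b j) => [->|bj]; last by rewrite h_row ?mul0r // neqn.
by rewrite [X in _ * X]h_row ?mulr0 // dj; apply/eqP; lia.
Qed.

Lemma h_row0 (j c : I) : (j < n)%N -> c != j -> h j c = 0.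
Proof.
by move=> jn cj; case: (eqVneq (c : nat) n) => cn; [exact: h_row_extra|exact: h_row].
Qed.

(** Row [j] is already diagonal, so the compatibility sum collapses to one term; duality thus
    determines the second half of [h]. *)
Lemma h_high (a j : I) : (j < n.-1)%N -> h a (dualI n1 j) * h j j = (a == dualI n1 j)%:R.
Proof.
move=> jn; have jn' : (j < n)%N by lia.
have := h_compat a j; rewrite (bigD1 (dualI n1 j)) //= dualIK big1 ?addr0 => [|c cj].
  by move=> ->; rewrite (JmxE R n1) -(inj_eq (can_inj dualIK)) dualIK eq_sym.
by rewrite [X in _ * X]h_row0 ?mulr0 //; apply: contra cj => /eqP <-; rewrite dualIK.
Qed.

Lemma h_diagonal : h = diag_mx (\row_p ((dX n r p)%:C)%C).
Proof.
have high0 (a b : I) : (n < b)%N -> h a b = (a == b)%:R * ((dX n r b)%:C)%C.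
  move=> nb; have lb := ltn_ord b.
  have db : (dualI n1 b < n.-1)%N by rewrite dualIE ifF; lia.
  have := h_high a db; rewrite dualIK h_diag_low; last by lia.
  have := @dX_dual R n n1 r _ r0 db; rewrite (dualK n1) // => e1 e2.
  rewrite -e2 -mulrA -rmorphM /= [X in (X%:C)%C](_ : _ = 1) ?rmorph1 ?mulr1 //.
  by rewrite mulrC.
have low0 (a b : I) : (b < n)%N -> a != b -> h a b = 0.
  by move=> bn ab; rewrite h_herm h_row0 ?rmorph0.
apply/matrixP=> a b; rewrite !mxE.
case: (ltngtP b n) => hb; last 2 first.
- by rewrite high0 //; case: eqP => [->|_]; rewrite ?mul1r ?mulr1n ?mul0r ?mulr0n.
- case: (eqVneq a b) => [->|ab]; rewrite ?mulr1n ?mulr0n; last first.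
    case: (ltngtP a n) => ha.
    + by apply: h_row0 => //; rewrite eq_sym.
    + by rewrite h_herm high0 // eq_sym (negbTE ab) mul0r rmorph0.
    + by move/eqP: ab; case; apply/val_inj; rewrite /= ha hb.
  have dc : dualI n1 b = b by apply/ord_inj; rewrite dualIE hb eqxx orbT.
  have b0 : 0 < h b b by exact: (posdef_diag b hpd).
  (* At [O'] compatibility fixes only the square of the entry; positivity excludes -1. *)
  have := h_compat b b; rewrite (bigD1 b) //= dc (JmxE R n1) dc eqxx big1 ?addr0 => [|c cb].
    rewrite hb dX_n /= => /eqP; rewrite -expr2 sqrf_eq1 => /orP[/eqP ->|/eqP e]; first by rewrite rmorph1.
    by move: b0; rewrite e oppr_gt0 ltr10.
  case: (ltngtP c n) => hc.
  + by rewrite low0 ?mul0r // eq_sym.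
  + by rewrite high0 // eq_sym (negbTE cb) !mul0r.
  + by move/eqP: cb; case; apply/val_inj; rewrite /= hc hb.
case: (eqVneq a b) => [->|ab]; rewrite ?mulr1n ?mulr0n; first exact: h_diag_low.
exact: low0.
Qed.
End Diagonal.

End Pointwise.

(** * Energy densities and parallel frames *)

Section Transport.
Variables (R : realType) (n : nat).
Hypothesis n1 : (1 < n)%N.
Local Notation C := (Cplx R).
Local Notation I := 'I_(n + n).
Local Notation M := 'M[C]_(n + n).
Local Notation cjC := (@conjc R : {rmorphism (Cplx R) -> (Cplx R)}).
Local Notation J := (Jmx R n).
Implicit Types (A B : M) (z : C).

(** The permutation matrix of the reordering: it presents [reo] as a congruence, which preserves
    positivity. *)
Definition filtmx : M := \matrix_(p, a) (a == filt p)%:R.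

Lemma mul_filtmx m (A : 'M[C]_(n + n, m)) p j : (filtmx *m A) p j = A (filt p) j.
Proof.
rewrite mxE (bigD1 (filt p)) //= big1 ?addr0 => [|a ap]; rewrite mxE; first by rewrite eqxx mul1r.
by rewrite (negbTE ap) mul0r.
Qed.

Lemma mulr_filtmx A p b : (A *m filtmx^T) p b = A p (filt b).
Proof. by rewrite -[A *m _]trmxK trmx_mul trmxK mxE mul_filtmx mxE. Qed.

Lemma reoE A : reo A = filtmx *m A *m filtmx^T.
Proof. by apply/matrixP=> p b; rewrite mxE mulr_filtmx mul_filtmx. Qed.

Lemma posdef_reo A : posdef cjC A -> posdef cjC (reo A).
Proof.
move=> [hh hp]; split.
  have e : conjmx (reo A)^T = reo A by rewrite -reo_tr -reo_conj; congr reo; exact: hh.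
  exact: e.
move=> u u0; have fu : filtmx *m filtmx^T = 1%:M by rewrite -(reo1 R n1) reoE mulmx1.
pose v := filtmx^T *m u; have v0 : v != 0.
  apply: contra u0 => /eqP v0; by rewrite -(mul1mx u) -fu -mulmxA -/v v0 mulmx0.
have := hp v v0; rewrite reoE /v trmx_mul trmxK.
have -> : map_mx cjC (filtmx^T *m u) = filtmx^T *m map_mx cjC u.
  by rewrite map_mxM; congr (_ *m _); apply/matrixP=> i j; rewrite !mxE rmorph_nat.
by rewrite !mulmxA.
Qed.

Lemma posdef_diag_mx m (d : 'rV[C]_m) : (forall p, 0 < d 0 p) -> posdef cjC (diag_mx d).
Proof.
move=> d0; split.
  by rewrite tr_diag_mx map_diag_mx; congr diag_mx; apply/rowP=> i; rewrite mxE (cj_pos (cjC_norm (R := R))).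
move=> u /cV0Pn[i ui]; rewrite mxE (bigD1 i) //=.
have e (j : 'I_m) : (u^T *m diag_mx d) 0 j * (map_mx cjC u) j 0 = `|u j 0| ^+ 2 * d 0 j.
  by rewrite mul_mx_diag !mxE mulrAC cjC_norm.
rewrite e ltr_wpDr ?mulr_gt0 ?exprn_gt0 ?normr_gt0 //.
by apply: sumr_ge0 => j _; rewrite e mulr_ge0 ?exprn_ge0 // ltW.
Qed.

Lemma hX_diagE z : exists2 d : 'rV[C]_(n + n), hX n z = diag_mx d &
  forall p, d 0 (filt p) = ((dX n (rho z) p)%:C)%C.
Proof.
rewrite /hX; eexists; first by []. move=> p.
have := congr1 (fun A : M => A p p) (reo_hX n1 z); rewrite !mxE !eqxx !mulr1n.
by move=> <-.
Qed.

Lemma posdef_hX z : disc z -> posdef cjC (hX n z).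
Proof.
move=> zd; have [d -> hd] := hX_diagE z; apply: posdef_diag_mx => a.
have [g _ gK] := filt_bij n1; rewrite -(gK a) hd.
by rewrite (_ : 0 = (0%:C)%C) // ltcR; apply: dX_gt0 => //; exact: rho_gt0.
Qed.

Lemma reo_theta (q : nat -> C -> C) z : reo (theta n q z) = theta_mx n (fun k => q k z).
Proof. by apply/matrixP=> p b; rewrite [LHS]mxE [RHS]mxE theta_filt. Qed.

Lemma sum_pos (F : I -> C) (G : nat -> C) : (forall b : I, b != n :> nat -> F b = G (cidx n b)) ->
  (forall b : I, b = n :> nat -> F b = 0) ->
  \sum_b F b = \sum_(0 <= t < (n + n).-1) G t.
Proof.
move=> FG F0; rewrite (bigID (fun b : I => b == n :> nat)) /= big1 ?add0r => [|b /eqP]; last exact: F0.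
rewrite big_mkord.
pose f (t : 'I_(n + n).-1) : I := Ordinal (pos_lt n1 (ltn_ord t)).
have hg (b : I) : b != n :> nat -> (cidx n b < (n + n).-1)%N.
  by move=> bn; have := cidx_lt n1 bn (ltn_ord b); lia.
have ht : (0 < (n + n).-1)%N by lia.
pose g (b : I) : 'I_(n + n).-1 := insubd (Ordinal ht) (cidx n b).
rewrite (reindex f) /=.
  apply: eq_big => [t|t _]; first by rewrite (pos_neq n1).
  by rewrite FG /= ?(pos_neq n1) // (cidx_pos n1).
exists g => [t _|b bn]; apply/val_inj.
  by rewrite /g val_insubd /= (cidx_pos n1) ltn_ord.
by rewrite /= /g val_insubd hg // pos_cidx.
Qed.

Lemma trace_real (h T : M) : posdef cjC h -> exists x : R, \tr (T *m hadj h T) = (x%:C)%C.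
Proof.
move=> hp; have [N [d [hN hd d0]]] := LDL (cjC_norm (R := R)) hp.
have hu : conjmx h \in unitmx.
  rewrite map_unitmx; have : \det (N^T *m h *m map_mx cjC N) != 0.
    by rewrite hd det_diag; apply/prodf_neq0 => p _; exact: lt0r_neq0.
  rewrite !det_mulmx !mulf_eq0 !negb_or => /andP[/andP[_ hh] _].
  by rewrite unitmxE unitfE.
have aE : conjmx h *m hadj h T = (conjmx T)^T *m conjmx h by rewrite /hadj -mulmxA mulKVmx.
rewrite (mxtrace_adj (cjC_norm (R := R)) hN hd d0 aE).
have : 0 <= \sum_a \sum_b m2 N d T a b.
  by apply: sumr_ge0 => a _; apply: sumr_ge0 => b _; exact: m2_ge0.
by case: (\sum_a _) => x y; rewrite lecE /= => /andP[/eqP -> _]; exists x.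
Qed.

Lemma reo_hadj (A B : M) : conjmx A \in unitmx -> reo (hadj A B) = hadj (reo A) (reo B).
Proof. move=> u; rewrite /hadj (reoM n1 (_ *m _)) (reoM n1 (invmx _)) (reoV n1) //.
by rewrite reo_tr !reo_conj. Qed.

Lemma reo_bracket (A B : M) : conjmx A \in unitmx ->
  reo (B *m hadj A B - hadj A B *m B) =
  reo B *m hadj (reo A) (reo B) - hadj (reo A) (reo B) *m reo B.
Proof.
move=> u; rewrite -reo_hadj //; move: (hadj A B) => Z.
by rewrite reoD reoN !(reoM n1).
Qed.

Lemma trace_reo (A B : M) : conjmx A \in unitmx ->
  \tr (B *m hadj A B) = \tr (reo B *m hadj (reo A) (reo B)).
Proof. move=> u; rewrite -reo_hadj //; move: (hadj A B) => Z.
by rewrite -(reoM n1) (mxtrace_reo n1). Qed.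

End Transport.

(** * Energy density of the model and smoothness of its metric *)

Section Energy.
Variables (R : realType) (n : nat).
Hypothesis n1 : (1 < n)%N.
Local Notation C := (Cplx R).
Local Notation I := 'I_(n + n).
Local Notation M := 'M[C]_(n + n).
Local Notation cjC := (@conjc R : {rmorphism (Cplx R) -> (Cplx R)}).

Lemma energy_densityE (q : nat -> C -> C) (H : C -> M) z : energy_density q H z =
  (2 * n - 2)%:R * (((2 * rho z ^+ 2)^-1%:C)%C * \tr (theta n q z *m hadj (H z) (theta n q z))).
Proof.
rewrite /energy_density; congr (_ * (_ * _)).
have i0 : 'i%C != 0 :> C by rewrite eq_complex /= oner_eq0 andbF.
by rewrite -mulrA [2^-1 * _]mulrC invfM mulrA divff // mul1r poincareE fmorphV.
Qed.

Lemma energy_hX z : disc z ->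
  \tr (theta n (fun _ _ => 0) z *m hadj (hX n z) (theta n (fun _ _ => 0) z)) =
  ((rho z ^+ 2 * \sum_(0 <= t < 2 * n - 2) ratio_coef R n t)%:C)%C.
Proof.
move=> zd; have hp := posdef_hX n1 zd.
have hu : conjmx (hX n z) \in unitmx.
  by have := @pd_unit R _ (fun=> hX n z) (fun _ _ => hp) z zd; rewrite -(map_unitmx cjC).
rewrite (trace_reo n1) // (reo_theta n1) (reo_hX n1).
set d := \row_p _; set T := theta_mx _ _.
have d0 p : 0 < d 0 p.
  by rewrite mxE (_ : 0 = (0%:C)%C) // ltcR; apply: dX_gt0 => //; exact: rho_gt0.
have h1 : unitri (1%:M : M).
  by split=> [i j ij|i]; rewrite mxE ?eqxx //; case: eqP => // e; move: ij; rewrite e ltnn.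
have hd : (1%:M : M)^T *m diag_mx d *m map_mx cjC 1%:M = diag_mx d.
  by rewrite trmx1 mul1mx map_mx1 mulmx1.
have aE : map_mx cjC (diag_mx d) *m hadj (diag_mx d) T = (map_mx cjC T)^T *m map_mx cjC (diag_mx d).
  apply: (@adjE R _ (fun=> diag_mx d) (fun=> T) _ z zd) => w _; exact: posdef_diag_mx.
rewrite (mxtrace_adj (cjC_norm (R := R)) h1 hd d0 aE) exchange_big /=.
have tE (a b : I) : T a b = [&& a != n :> nat, b != n :> nat & cidx n a == (cidx n b).+1]%:R.
  by rewrite [LHS]mxE; apply: theta_entry0.
have mE (a b : I) : m2 1%:M d T a b = [&& a != n :> nat, b != n :> nat & cidx n a == (cidx n b).+1]%:R *
    (d 0 a / d 0 b).
  rewrite /m2 /frame invmx1 mul1mx mulmx1 tE normr_nat -natrX; congr (_%:R * _).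
  by case: [&& _, _ & _].
(* The last power of [K] in the chain has no successor, hence contributes 0. *)
pose G t : C := if (t < 2 * n - 2)%N then ((ratio_coef R n t * rho z ^+ 2)%:C)%C else 0.
rewrite (@sum_pos R n n1 _ G) => [|b bn|b bn]; last 2 first.
- rewrite /G; case: ifP => ht.
    have [|a an ea] := @exists_cidx n n1 (cidx n b).+1; first by lia.
    rewrite (bigD1 a) //= big1 ?addr0 => [|c ca]; last first.
      rewrite mE; case: (boolP [&& _, _ & _]) => [/and3P[cn _ /eqP e]|_]; last by rewrite mul0r.
      by move: ca; rewrite (@cidx_injI n n1 c a cn an) ?eqxx // e ea.
    rewrite mE an bn ea eqxx mul1r !mxE -fmorphV -rmorphM; congr (_%:C)%C.
    rewrite -(pos_cidx n1 an) -(pos_cidx n1 bn) ea dX_ratio ?rho_gt0 //.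
    have nz : dX n (rho z) b != 0 by apply: lt0r_neq0; apply: dX_gt0 => //; exact: rho_gt0.
    by rewrite (pos_cidx n1 bn) mulrAC divff // mul1r.
  rewrite big1 // => a _; rewrite mE; case: (boolP [&& _, _ & _]) => [/and3P[an _ /eqP e]|_]; last by rewrite mul0r.
  by have := cidx_lt n1 an (ltn_ord a); lia.
- by rewrite big1 // => a _; rewrite mE bn eqxx andbF mul0r.
have -> : ((n + n).-1 = (2 * n - 2).+1)%N by lia.
rewrite big_nat_recr //= [G (2 * n - 2)%N]/G ltnn addr0 mulr_sumr rmorph_sum /= !big_nat.
by apply: eq_bigr => t /andP[_ ht]; rewrite /G ht mulrC.
Qed.

Lemma smooth_hX : msmooth (hX (R := R) n).
Proof.
move=> i j; have [->|ij] := eqVneq i j; last first.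
  by apply: smooth_ext (smooth_cst 0) => z _; rewrite mxE (negbTE ij) mulr0n.
case E : (is_extra j).
  by apply: smooth_ext (smooth_cst 1) => z _; rewrite mxE eqxx mulr1n mxE E.
pose u z : C := 2 * (rhoC z * rhoC z).
have su : smooth u by exact: smooth_2rho.
have ue z : poincare z / 2 = u z.
  by rewrite poincareE /u rmorphM rmorphXn rmorph_nat /= -rhoCE expr2.
have u0 z : disc z -> u z != 0.
  by move=> zd; rewrite -ue poincareE fmorph_eq0 lt0r_neq0 // mulr_gt0 // exprn_gt0 // rho_gt0.
have sp (m : int) : smooth (fun z => u z ^ m).
  case: m => k; first exact: smoothX.
  by apply: smoothV; [move=> z zd; rewrite expf_neq0 // u0|exact: smoothX].
apply: smooth_ext (smoothM (smooth_cst (a_coef R n `|n%:Z - wt j|%N)) (sp (- wt j))) => z _.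
by rewrite [RHS]mxE eqxx mulr1n mxE E ue.
Qed.

Lemma theta_eq0 (q : nat -> C -> C) z : (forall i, (0 < i <= n)%N -> q i z = 0) ->
  theta n q z = theta n (fun _ _ => 0) z.
Proof.
move=> hq; have e : eta n q z = eta n (fun _ _ => 0) z.
  apply/matrixP=> i j; rewrite !mxE; case: eqP => hj.
    by case: ifP => // _; apply: hq; lia.
  by case: ifP => // ij; apply: hq; have := ltn_ord j; lia.
by rewrite /theta /eta_adj e.
Qed.

End Energy.

Lemma block_diag_congr (F : comPzRingType) m (A B P Q : 'M[F]_m) :
  block_mx A 0 0 B *m block_mx P 0 0 Q *m (block_mx A 0 0 B)^T =
  block_mx (A *m P *m A^T) 0 0 (B *m Q *m B^T).
Proof. by rewrite tr_block_mx !trmx0 !mulmx_block !(mulmx0, mul0mx, addr0, add0r). Qed.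

Lemma trunc_full (F : numFieldType) m (A : 'M[F]_m) : trunc m A = A.
Proof. by apply/matrixP=> i j; rewrite truncE !ltn_ord. Qed.

Lemma trunc0 (F : numFieldType) m (A : 'M[F]_m) : trunc 0 A = 1%:M.
Proof. by apply/matrixP=> i j; rewrite truncE mxE. Qed.

(** * Recovering the energy from the harmonic map *)

Section Frames.
Variables (R : realType) (n : nat).
Hypothesis n1 : (1 < n)%N.
Local Notation C := (Cplx R).
Local Notation M := 'M[C]_(n + n).
Local Notation cjC := (@conjc R : {rmorphism (Cplx R) -> (Cplx R)}).

Lemma mxd_zE (A : C -> M) z : mxd_z A z = mdop (- 'i%C) A z.
Proof. by apply/matrixP=> a b; rewrite mdopE mxE d_zE. Qed.

Lemma mxd_zbarE (A : C -> M) z : mxd_zbar A z = mdop 'i%C A z.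
Proof. by apply/matrixP=> a b; rewrite mdopE mxE d_zbarE. Qed.

(** The connection terms cancel, as [P] is parallel and [A] is the connection of the metric. The
    Higgs field enters once through [P] and once through its conjugate [Pc], hence the factor 2. *)
Lemma frame_derivative (F : numFieldType) m (P H Pc A T U : 'M[F]_m) : P \in unitmx ->
  H *m U = T^T *m H ->
  (- ((A + T) *m P))^T *m H *m Pc + P^T *m (A^T *m H) *m Pc + P^T *m H *m (- (U *m Pc)) =
  (- (2 *: (P^T *m T^T *m invmx P^T))) *m (P^T *m H *m Pc).
Proof.
move=> uP hU; have uPt : P^T \in unitmx by rewrite unitmx_tr.
rewrite oppmxT trmx_mul addmxT mulmxN !mulmxA -(mulmxA _ H U) hU mulmxDr !mulNmx -scalemxAl.
rewrite !mulmxA mulmxKV // -!scalemxAl !mulmxDl; move: (P^T *m A^T *m H *m Pc) (P^T *m T^T *m H *m Pc) => a b.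
by rewrite opprD (addrAC (- a)) addNr add0r scaler_nat mulr2n opprD.
Qed.

Lemma frame_derivative_conj (F : numFieldType) m (P H Pc A T U : 'M[F]_m) : P \in unitmx ->
  H \in unitmx -> H *m T = U^T *m H ->
  (- (U *m P))^T *m H *m Pc + P^T *m (H *m A) *m Pc + P^T *m H *m (- ((A + T) *m Pc)) =
  (- (2 *: (P^T *m U^T *m invmx P^T))) *m (P^T *m H *m Pc).
Proof.
move=> uP uH hU; have uPt : P^T \in unitmx by rewrite unitmx_tr.
rewrite oppmxT trmx_mul mulmxN mulmxDl mulmxDr !mulmxA -(mulmxA _ H T) hU !mulNmx -scalemxAl.
rewrite !mulmxA mulmxKV // -!scalemxAl; move: (P^T *m H *m A *m Pc) (P^T *m U^T *m H *m Pc) => a b.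
by rewrite opprD addrA addrK scaler_nat mulr2n opprD.
Qed.

Lemma frame_trace (F : numFieldType) m (P T U G X Y : 'M[F]_m) : P \in unitmx -> G \in unitmx ->
  X = (- (2 *: (P^T *m T^T *m invmx P^T))) *m G ->
  Y = (- (2 *: (P^T *m U^T *m invmx P^T))) *m G ->
  \tr (X *m invmx G *m Y *m invmx G) = 4 * \tr (T *m U).
Proof.
move=> uP uG -> ->; have uPt : P^T \in unitmx by rewrite unitmx_tr.
rewrite mulmxK // -(mulmxA _ _ (invmx G)) mulmxK // mulNmx mulmxN opprK.
rewrite -scalemxAl -scalemxAr scalerA mxtraceZ; congr (_ * _); first by rewrite -natrM.
rewrite !mulmxA mulmxKV // mxtrace_mulC !mulmxA mulVmx // mul1mx -trmx_mul mxtrace_tr.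
by rewrite mxtrace_mulC.
Qed.

(** The form [P] is normalised to squares to the identity, which exhibits a left inverse of
    [P z]. *)
Lemma parallel_unit (q : nat -> C -> C) (H P : C -> M) z : parallel_frame q H P -> disc z -> P z \in unitmx.
Proof.
move=> [_ hP] zd; have [_ _ e _ _] := hP z zd.
pose D : M := block_mx 1%:M 0 0 (- 1%:M).
have DD : D *m D = 1%:M.
  by rewrite mulmx_block !(mulmx0, mul0mx, addr0, add0r) mulmx1 mulmxN mulNmx opprK mulmx1 -scalar_mx_block.
have := congr1 (mulmx D) e; rewrite DD !mulmxA => e'.
by have [_ u] := mulmx1_unit e'.
Qed.

Lemma smooth_harmonic_map (q : nat -> C -> C) (H P : C -> M) : msmooth H -> parallel_frame q H P ->
  msmooth (harmonic_map H P).
Proof.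
move=> sH [sP _]; apply: msmoothM; last exact: msmooth_conj.
by apply: msmoothM sH; exact: msmooth_tr.
Qed.

(* The derivatives of [P^T H conj P] are [-2 P^T theta^T H conj P] and
   [-2 P^T (theta^*h)^T H conj P], so this metric alone determines the energy. *)
Lemma frame_energy (q : nat -> C -> C) (H P : C -> M) z : msmooth H ->
  (forall z, disc z -> posdef cjC (H z)) -> parallel_frame q H P -> disc z ->
  \tr (mdop (- 'i%C) (harmonic_map H P) z *m invmx (harmonic_map H P z) *m
       mdop 'i%C (harmonic_map H P) z *m invmx (harmonic_map H P z)) =
  4 * \tr (theta n q z *m hadj (H z) (theta n q z)).
Proof.
move=> sH hp hP zd; have uP := parallel_unit hP zd; have [sP hPz] := hP.
have [eP eb _ _ _] := hPz z zd; rewrite mxd_zE in eP; rewrite mxd_zbarE in eb.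
have uH := pd_unit hp zd.
have uPc : conjmx (P z) \in unitmx by rewrite map_unitmx.
have cm s : mdop s (harmonic_map H P) z = (mdop s P z)^T *m H z *m conjmx (P z) +
    (P z)^T *m mdop s H z *m conjmx (P z) + (P z)^T *m H z *m conjmx (mdop (s^*)%C P z).
  have st := msmooth_tr sP; have sth := msmoothM st sH; have sc := msmooth_conj sP.
  apply: etrans (mdopM s sth sc zd) _.
  by rewrite (mdopM s st sH zd) mdop_tr // mdop_conj // mulmxDl.
have iN : ((- 'i)^*)%C = 'i%C :> C by apply/eqP; rewrite eq_complex /= oppr0 opprK !eqxx.
have iC : ('i^*)%C = - 'i%C :> C by apply/eqP; rewrite eq_complex /= oppr0 !eqxx.
have dH := dz_metric hp zd; have bH := dzb_metric sH hp zd.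
have aE := adjE (theta n q) hp zd.
set A := chern H z; set T := theta n q z; set U := hadj (H z) T.
have dH' : mdop (- 'i%C) H z = A^T *m H z by rewrite /A /chern mxd_zE.
have bH' : mdop 'i%C H z = H z *m conjmx A by rewrite /A /chern mxd_zE.
have aE' : conjmx (H z) *m U = (conjmx T)^T *m conjmx (H z) by exact: aE.
have hU : H z *m conjmx U = T^T *m H z.
  have := congr1 (fun Y : M => conjmx Y) aE'; rewrite /Defs.conjmx !map_mxM map_trmx.
  by rewrite !(cjmxK (cjC_norm (R := R))).
have hT : H z *m conjmx T = U^T *m H z.
  have hh : (conjmx (H z))^T = H z by have := conj_metric hp zd; rewrite /Defs.conjmx map_trmx.
  by have := congr1 trmx aE'; rewrite !trmx_mul trmxK hh => <-.
have cN (Y : M) : conjmx (- Y) = - conjmx Y by rewrite /Defs.conjmx map_mxN.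
have cM (Y Z : M) : conjmx (Y *m Z) = conjmx Y *m conjmx Z by rewrite /Defs.conjmx map_mxM.
have cD (Y Z : M) : conjmx (Y + Z) = conjmx Y + conjmx Z by rewrite /Defs.conjmx map_mxD.
have d1 := cm (- 'i%C); rewrite iN eP eb dH' cN cM in d1.
have d2 := cm 'i%C; rewrite iC eP eb bH' cN cM cD in d2.
have d1' := etrans d1 (frame_derivative (conjmx (P z)) A uP hU).
have d2' := etrans d2 (frame_derivative_conj (conjmx (P z)) (conjmx A) uP uH hT).
apply: (frame_trace uP _ d1' d2').
by rewrite /harmonic_map !unitmx_mul unitmx_tr uP uH uPc.
Qed.

End Frames.

(** * Transfer to the given metric and conclusion *)

Section Main.
Variables (R : realType) (n : nat).
Hypothesis n1 : (1 < n)%N.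
Local Notation C := (Cplx R).
Local Notation I := 'I_(n + n).
Local Notation M := 'M[C]_(n + n).
Local Notation cjC := (@conjc R : {rmorphism (Cplx R) -> (Cplx R)}).
Local Notation J := (Jmx R n).
Variables (X : hyperbolic_surface R) (q : nat -> C -> C) (H : C -> M).
Hypotheses (hH : hermitian_metric X H) (hharm : harmonic_metric q H)
  (hcomp : SOnn_compatible H) (hdom : weakly_dominates H (hX n)).
Let h z : M := reo (H z).

Lemma metric_smooth : msmooth H. Proof. by case: hH. Qed.

Lemma metric_posdef z : disc z -> posdef cjC (H z).
Proof. by case: hH => _ h1 h2 _ zd; split; [exact: h1|move=> u; exact: h2]. Qed.

Lemma metric_unit z : disc z -> H z \in unitmx.
Proof. exact: (pd_unit metric_posdef). Qed.

Lemma metric_conj_unit z : disc z -> conjmx (H z) \in unitmx.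
Proof. exact: (conj_pd_unit metric_posdef). Qed.

Lemma reo_smooth : msmooth h.
Proof.
move=> i j; apply: smooth_ext (metric_smooth (filt i) (filt j)) => z _; by rewrite mxE.
Qed.

Lemma reo_posdef z : disc z -> posdef cjC (h z).
Proof. by move=> zd; apply: posdef_reo => //; exact: metric_posdef. Qed.

Lemma reo_mdop s (A : C -> M) z : reo (mdop s A z) = mdop s (fun w => reo (A w)) z.
Proof.
apply/matrixP=> a b; rewrite mxE !mdopE; congr (dop _ _ z).
by apply/funext => w; rewrite mxE.
Qed.

Lemma reo_chern z : disc z -> reo (chern H z) = (mdop (- 'i%C) h z *m invmx (h z))^T.
Proof.
move=> zd; rewrite /chern reo_tr (reoM n1) (reoV n1) ?metric_unit //.
by rewrite mxd_zE reo_mdop.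
Qed.

Lemma reo_harmonic z : disc z ->
  mdop 'i%C (fun w => (mdop (- 'i%C) h w *m invmx (h w))^T) z =
  theta_mx n (fun k => q k z) *m hadj (h z) (theta_mx n (fun k => q k z)) -
  hadj (h z) (theta_mx n (fun k => q k z)) *m theta_mx n (fun k => q k z).
Proof.
move=> zd; have e := hharm zd.
have {e} : mdop 'i%C (chern H) z = theta n q z *m hadj (H z) (theta n q z) -
    hadj (H z) (theta n q z) *m theta n q z.
  by move/eqP: e; rewrite addrC subr_eq0 mxd_zbarE => /eqP <-.
move=> /(congr1 (@reo R n)) e.
have e2 := reo_bracket n1 (theta n q z) (metric_conj_unit zd).
rewrite (reo_theta n1) in e2.
apply: etrans (etrans (esym (reo_mdop _ _ _)) (etrans e e2)).
apply: eq_mdop => //; last by move=> w wd; exact: esym (reo_chern wd).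
exact: (msmooth_chern reo_smooth reo_posdef).
Qed.

Lemma block_compat z : disc z ->
  H z *m block_mx (QV R n) 0 0 (QW R n) *m (H z)^T = block_mx (QV R n) 0 0 (QW R n).
Proof.
move=> zd; have [e1 e2 e3 e4] := hcomp zd.
have cQ : conjmx (QV R n) = QV R n by apply/matrixP=> i j; rewrite !mxE rmorph_nat.
have cW : conjmx (QW R n) = QW R n.
  by apply/matrixP=> i j; rewrite !mxE; case: ifP => _; rewrite rmorph_nat.
rewrite -[H z]submxK e1 e2; move: e3 e4; rewrite /compatible invQV // invQW // cQ cW => e3 e4.
by rewrite block_diag_congr e3 e4.
Qed.

Lemma reo_compat z : disc z -> h z *m J *m (h z)^T = J.
Proof. by move=> zd; rewrite /h /Jmx -reo_tr -!(reoM n1) block_compat. Qed.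

Lemma reo_par z (a b : I) : disc z -> vpar n a != vpar n b -> h z a b = 0.
Proof.
move=> zd; have [e1 e2 _ _] := hcomp zd.
have vE (p : I) : (filt p < n)%N = vpar n p.
  rewrite filt_valE //; case: (eqVneq (p : nat) n) => [e|pn].
    by rewrite /vpar e eqxx /filt_val eqxx; lia.
  rewrite (filt_chain n1 pn) /vpar pn /=; have := cidx_lt n1 pn (ltn_ord p).
  by case: (odd _); lia.
rewrite -!vE mxE -[H z]submxK e1 e2.
have [a' ->|a' ->] := split_ordP (filt a); have [b' ->|b' ->] := split_ordP (filt b);
  rewrite /= ?ltn_ord ?ltnNge ?leq_addr //= => _.
  by rewrite block_mxEur mxE.
by rewrite block_mxEdl mxE.
Qed.

(** Compatibility with the pairing makes the square of the determinant 1, and positivity selects the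
    root. *)
Lemma reo_det z : disc z -> \det (h z) = 1.
Proof.
move=> zd; have := congr1 determinant (reo_compat zd).
have J0 : \det J != 0.
  have := congr1 determinant (JJ R n1); rewrite det_mulmx det1 => e.
  by apply/eqP => e0; move/eqP: e; rewrite e0 mul0r eq_sym oner_eq0.
rewrite !det_mulmx det_tr mulrAC -expr2 -[RHS]mul1r => /(mulIf J0) /eqP.
have dp : 0 < \det (h z).
  have [N [d [hN hd d0]]] := pd_frame reo_posdef zd.
  have := det_trunc_gt0 hN hd d0 (n + n).
  by rewrite trunc_full.
rewrite sqrf_eq1 => /orP[/eqP //|/eqP e]; by move: dp; rewrite e oppr_gt0 ltr10.
Qed.

Lemma reo_dom z k : disc z -> (k <= n + n)%N ->
  \det (trunc k (h z)) <= ((DX n k (rho z))%:C)%C.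
Proof.
move=> zd; case: k => [|k] hk.
  by rewrite trunc0 det1 /DX big_geq // rmorph1.
have [k' ek] : exists k' : I, k' = k :> nat by exists (Ordinal hk).
have g := gramFE (hX n z) k'; rewrite (reo_hX n1) det_trunc_diag ek in g.
have e : \det (trunc k'.+1 (h z)) <= gramF (hX n z) k'.
  apply: le_trans (hdom k' zd); rewrite le_eqVlt; apply/orP; left; apply/eqP; exact: esym (gramFE (H z) k').
rewrite ek in e; rewrite g in e.
apply: le_trans e _; rewrite /DX big_mkord rmorph_prod.
rewrite [X in _ <= X](big_ord_widen (n + n) (fun p => ((dX n (rho z) p)%:C)%C)) //.
by rewrite le_eqVlt; apply/orP; left; apply/eqP; apply: eq_bigr => p _; rewrite mxE.
Qed.

Let tr z : R := complex.Re (\tr (theta n q z *m hadj (H z) (theta n q z))).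

Lemma trE z : disc z -> \tr (theta n q z *m hadj (H z) (theta n q z)) = ((tr z)%:C)%C.
Proof.
by move=> zd; rewrite /tr; have [x ->] := trace_real (theta n q z) (metric_posdef zd).
Qed.

Let trX z : R := rho z ^+ 2 * \sum_(0 <= t < 2 * n - 2) ratio_coef R n t.

Lemma tr_ge z : disc z -> trX z <= tr z /\
  (tr z = trX z -> forall k, (k < n)%N -> minor_ratio h k z = 1).
Proof.
move=> zd; rewrite /tr (trace_reo n1) ?metric_conj_unit // (reo_theta n1).
exact: (energy_ge n1 q reo_posdef reo_det reo_dom zd).
Qed.

Lemma energy_coef_gt0 z : disc z -> 0 < ((2 * rho z ^+ 2)^-1 : R).
Proof. by move=> zd; rewrite invr_gt0 mulr_gt0 // exprn_gt0 // rho_gt0. Qed.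

Let en z (t : R) : C := (((2 * n - 2)%:R * ((2 * rho z ^+ 2)^-1 * t))%:C)%C.

Lemma scale_en z (t : R) : (2 * n - 2)%:R * (((2 * rho z ^+ 2)^-1%:C)%C * (t%:C)%C) = en z t :> C.
Proof. by rewrite /en !rmorphM rmorph_nat. Qed.

Lemma energy_densityRE z : disc z -> energy_density q H z = en z (tr z).
Proof.
move=> zd; apply: etrans (energy_densityE q H z) _; apply: etrans (scale_en z (tr z)).
exact: (congr1 (fun x => _ * (_ * x)) (trE zd)).
Qed.

Lemma energy_hXRE z : disc z -> energy_density (fun _ _ => 0) (hX n) z = en z (trX z).
Proof.
move=> zd; apply: etrans (energy_densityE _ _ z) _; apply: etrans (scale_en z (trX z)).
exact: (congr1 (fun x => _ * (_ * x)) (energy_hX n1 zd)).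
Qed.

Lemma energy_le z : disc z ->
  energy_density (fun _ _ => 0) (hX n) z <= energy_density q H z.
Proof.
move=> zd; rewrite (energy_hXRE zd) (energy_densityRE zd) /en lecR.
have [le _] := tr_ge zd; apply: ler_wpM2l; first exact: ler0n.
by apply: ler_wpM2l le; apply/ltW/energy_coef_gt0.
Qed.

Lemma energy_eq z : disc z ->
  energy_density q H z = energy_density (fun _ _ => 0) (hX n) z -> tr z = trX z.
Proof.
move=> zd; rewrite (energy_hXRE zd) (energy_densityRE zd) /en => -[].
have n0 : (2 * n - 2)%:R != 0 :> R by rewrite pnatr_eq0; lia.
by move=> /(mulfI n0)/(mulfI (lt0r_neq0 (energy_coef_gt0 zd))).
Qed.

Lemma rigidity z0 : disc z0 -> tr z0 = trX z0 ->
  (forall z, disc z -> H z = hX n z) /\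
  (forall i z, (0 < i <= n)%N -> disc z -> q i z = 0).
Proof.
move=> zd0 e0; have hone z k : disc z -> (k < n)%N -> minor_ratio h k z = 1.
  move=> zd kn; case: k kn => [|k] kn.
    rewrite /minor_ratio /DX big_geq // divr1.
    by rewrite trunc0 det1.
  have [_ /(_ e0 _ kn)] := tr_ge zd0.
  move=> e; apply: (minor_ratio_rigid n1 reo_smooth reo_posdef reo_harmonic reo_dom zd0 _ e zd).
  by [].
have adj z : disc z -> conjmx (h z) *m hadj (h z) (theta_mx n (fun k => q k z)) =
    (conjmx (theta_mx n (fun k => q k z)))^T *m conjmx (h z).
  by move=> zd; exact: (adjE (fun z => theta_mx n (fun k => q k z)) reo_posdef zd).
have low z (zd : disc z) : forall a b : I, (b < a)%N -> (b < n)%N ->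
    hadj (h z) (theta_mx n (fun k => q k z)) a b = 0.
  move=> a b; exact: (rigid_adjoint n1 reo_smooth reo_posdef reo_harmonic reo_dom hone zd).
have qn z (zd : disc z) := qn_eq0 n1 (reo_posdef zd) (adj z zd) (reo_compat zd)
  (fun a b => @reo_par z a b zd) (low z zd).
have qi z (zd : disc z) := q_eq0 n1 (adj z zd) (reo_compat zd)
  (fun a b => @reo_par z a b zd) (low z zd) (qn z zd).
split=> [z zd|i z hi zd]; last first.
  case: (eqVneq i n) => [->|ni]; first exact: qn.
  by apply: qi => //; lia.
apply: (reo_inj n1); rewrite (reo_hX n1).
apply: (h_diagonal n1 (reo_posdef zd) (adj z zd) (reo_compat zd)
  (fun a b => @reo_par z a b zd) (low z zd) (qn z zd) (qi z zd) (rho_gt0 zd)).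
move=> k hk; rewrite (minorE n1 reo_posdef zd) ?(leq_trans hk) ?leq_addr //.
case: (eqVneq k n) => [->|kn].
  by rewrite (rigid_minor n1 reo_smooth reo_posdef reo_harmonic reo_dom hone zd) mul1r.
by rewrite hone ?mul1r // ltn_neqAle kn.
Qed.

Lemma energy_eq_of_eq z : disc z ->
  (forall z, disc z -> H z = hX n z) /\
  (forall i z, (0 < i <= n)%N -> disc z -> q i z = 0) ->
  energy_density q H z = energy_density (fun _ _ => 0) (hX n) z.
Proof.
move=> zd [eH eq].
have et : theta n q z = theta n (fun _ _ => 0) z by apply: (theta_eq0 n1) => i hi; exact: eq.
by rewrite /energy_density (eH z zd) et.
Qed.

Hypothesis disc0 : disc (0 : C).

(** By [frame_energy] equal maps have equal energy, and equality at the single point 0 is enough for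
    [rigidity]. *)
Lemma frame_rigid P P0 : parallel_frame q H P ->
  parallel_frame (fun _ _ => 0) (hX n) P0 ->
  (forall z, disc z -> harmonic_map H P z = harmonic_map (hX n) P0 z) ->
  (forall z, disc z -> H z = hX n z) /\
  (forall i z, (0 < i <= n)%N -> disc z -> q i z = 0).
Proof.
move=> hP hP0 eG; apply: (rigidity disc0).
have e1 := frame_energy metric_smooth metric_posdef hP disc0.
have e2 := frame_energy (@smooth_hX R n) (posdef_hX n1) hP0 disc0.
have sG := smooth_harmonic_map metric_smooth hP.
have e : 4 * \tr (theta n q 0 *m hadj (H 0) (theta n q 0)) =
    4 * \tr (theta n (fun _ _ => 0) 0 *m hadj (hX n 0) (theta n (fun _ _ => 0) 0)) :> C.
  apply: etrans (esym e1) (etrans _ e2).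
  by rewrite (eq_mdop _ sG disc0 eG) (eq_mdop _ sG disc0 eG) (eG 0 disc0).
have f0 : (4 : C) != 0 by rewrite pnatr_eq0.
exact: (congr1 (@complex.Re R) (etrans (mulfI f0 e) (energy_hX n1 disc0))).
Qed.

Lemma frame_of_eq P : parallel_frame q H P ->
  (forall z, disc z -> H z = hX n z) /\
  (forall i z, (0 < i <= n)%N -> disc z -> q i z = 0) ->
  parallel_frame (fun _ _ => 0) (hX n) P.
Proof.
move=> [sP hP] [eH eq]; split=> // z zd; have [h1 h2 h3 h4 h5] := hP z zd.
have et : theta n q z = theta n (fun _ _ => 0) z by apply: (theta_eq0 n1) => i hi; exact: eq.
have ec : chern H z = chern (hX n) z.
  by rewrite /chern !mxd_zE (eq_mdop _ metric_smooth zd eH) (eH z zd).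
split; [by rewrite -ec -et; exact: h1| |exact: h3|by rewrite -(eH z zd); exact: h4|exact: h5].
by rewrite -(eH z zd) -et; exact: h2.
Qed.

End Main.

Theorem theorem6p3 (R : realType) (n : nat) (hn : (0 < n)%N)
  (X : hyperbolic_surface R)
  (q : nat -> Cplx R -> Cplx R) (H : Cplx R -> 'M[Cplx R]_(n + n))
  (hq : forall i, (0 < i < n)%N -> holo_section X (2 * i) (q i))
  (hqn : holo_section X n (q n))
  (hH : hermitian_metric X H)
  (hharm : harmonic_metric q H)
  (hcomp : SOnn_compatible H)
  (hdom : weakly_dominates H (@hX R n)) :
  let q0 := fun (_ : nat) (_ : Cplx R) => 0 : Cplx R in
  let H_eq_hX_and_q_eq_0 :=
    (forall z, disc z -> H z = hX n z) /\
    (forall i z, (0 < i <= n)%N -> disc z -> q i z = 0) in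
  (forall z, disc z ->
     energy_density q0 (@hX R n) z <= energy_density q H z) /\
  ((1 < n)%N ->
     (forall z, disc z ->
        (energy_density q H z = energy_density q0 (@hX R n) z <->
         H_eq_hX_and_q_eq_0)) /\
     (forall P, parallel_frame q H P ->
        (H_eq_hX_and_q_eq_0 <->
         exists P0, [/\ parallel_frame q0 (@hX R n) P0,
           forall g, deck X g -> holonomy P g = holonomy P0 g
         & forall z, disc z ->
             harmonic_map H P z = harmonic_map (@hX R n) P0 z]))).
Proof.
move=> q0 P; split=> [z zd|n1].
  case: (ltnP 1 n) => n1; first exact: (@energy_le R n n1 X q H hH hcomp hdom z zd).
  (* In the remaining case [n = 1] the factor from the Killing form makes both densities 0. *)
  have e : (2 * n - 2 = 0)%N by lia.
  have m0 (x : Cplx R) : (2 * n - 2)%:R * x = 0 by rewrite e mul0r.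
  have e1 : energy_density q0 (hX n) z = 0 := m0 _.
  have e2 : energy_density q H z = 0 := m0 _.
  by rewrite e1 e2 lexx.
have d0 : disc (0 : Cplx R) by rewrite /disc /= normr0 ltr01.
split=> [z zd|F hF]; split.
- by move=> e; apply: (rigidity n1 hH hharm hcomp hdom zd); exact: (@energy_eq R n n1 X q H hH z zd e).
- exact: (energy_eq_of_eq n1 zd).
(* The two systems for parallel frames now coincide, so the given frame serves for both. *)
- move=> hP; exists F; split=> //; first exact: (frame_of_eq n1 hH hF hP).
  by have [eH _] := hP; move=> z zd; rewrite /harmonic_map (eH z zd).
- by move=> [F0 [hF0 _ eG]]; exact: (frame_rigid n1 hH hharm hcomp hdom d0 hF hF0 eG).
Qed.
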